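(* Let $T\in(0,\infty)$ and let $\Gamma$ be a $(C^2$-$C^2)\cap(C^1$-$C^4)$-evolving immersed closed hypersurface on $[0,T]$ with reference surface $M\subset\mathbb{R}^{d+1}$, normal $\nu$ and mean curvature $H$, that evolves with normal velocity $V=V(H)$. Assume that $$\Delta_\Gamma V+V|\nabla_\Gamma\nu|^2=A\colon D_\Gamma^2H+B\cdot\nabla_\Gamma H+CH\qquad\text{on }[0,T]\times M$$ with continuous $A:[0,T]\times M\to\mathbb{R}^{(d+1)\times(d+1)}$, $B:[0,T]\times M\to\mathbb{R}^{d+1}$ and $C:[0,T]\times M\to\mathbb{R}$ such that $A$ is symmetric and positive definite on $[0,T]\times M$. If $H(0)\ge 0$ on $M$, then $H(t)>0$ on $M$ for all $t\in(0,T]$.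
   Context: Let $d\ge 1$. A closed embedded hypersurface $M\subset\mathbb{R}^{d+1}$ is a connected, compact, $d$-dimensional embedded submanifold without boundary admitting a continuous unit normal. For integers $k,l\ge 0$ and a $C^{2+k}$-embedded closed hypersurface $M$, a $C^{1+l}$-$C^{2+k}$-evolving immersed closed hypersurface $\Gamma$ with reference surface $M$ and global parameterization $\theta$ is given by $$\theta\in C^{1+l}([0,T],C^k(M,\mathbb{R}^{d+1}))\cap C^l([0,T],C^{2+k}(M,\mathbb{R}^{d+1}))$$ such that $\theta_t:=\theta(t,\cdot)$ is an immersion for every $t\in[0,T]$; $\Gamma(t):=\theta_t(M)$. ''$(C^2$-$C^2)\cap(C^1$-$C^4)$-evolving'' means that this holds both for $(l,k)=(1,0)$ and for $(l,k)=(0,2)$. All functions on $\Gamma(t)$ are understood as functions of $(t,p)\in[0,T]\times M$ (pullback to $M$). The normal $\nu:[0,T]\times M\to\mathbb{R}^{d+1}$ is a fixed continuous choice of unit normal to $\Gamma(t)$, $t\in[0,T]$. The mean curvature is $H:=-\mathrm{div}_\Gamma\nu$, the normal velocity is $V:=\partial_t\theta\cdot\nu$. The surface gradient $\nabla_\Gamma$, surface divergence $\mathrm{div}_\Gamma$ and Laplace-Beltrami operator $\Delta_\Gamma$ at time $t$ are those of the embedded patches of $\Gamma(t)$, pulled back to $M$ (with $\nabla_\Gamma f$ viewed as $\mathbb{R}^{d+1}$-valued), and the surface Hessian is $[D_\Gamma^2f]_{ij}:=[\nabla_\Gamma([\nabla_\Gamma f]_i)]_j$, $i,j=1,\dots,d+1$.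 $|\nabla_\Gamma\nu|^2$ is the sum of squares of all entries of $\nabla_\Gamma\nu$. For matrices, $A\colon\widetilde A:=\sum_{i,j}A_{ij}\widetilde A_{ij}$. Positive definite on $[0,T]\times M$ means $\xi^\top A(t,p)\xi>0$ for all $(t,p)$ and all $\xi\in\mathbb{R}^{d+1}\setminus\{0\}$. The notation $V=V(H)$ indicates that the normal velocity is prescribed in dependence of the mean curvature (it may also depend on further data, e.g. $V=g(c)H$); the only structural requirement is the displayed identity. *)

(* Defs.v *)
From HB Require Import structures.
From mathcomp Require Import all_boot all_order all_algebra.
From mathcomp Require Import all_classical all_reals all_analysis.
Import Order.TTheory GRing.Theory Num.Theory.
Import numFieldNormedType.Exports.

Set Implicit Arguments.
Unset Strict Implicit.
Unset Printing Implicit Defensive.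

Local Open Scope classical_set_scope.
Local Open Scope ring_scope.

(* Maps on a hypersurface M of R^(d+1), and on [0, T] x M, are represented by
   total functions on the ambient space; only their values on M, respectively
   on [0, T] x M, are ever used. Vectors are row vectors. *)

Section Hypersurfaces.
Variable R : realType.

Definition dot n (u v : 'rV[R]_n) : R := (u *m v^T) 0 0.

Section PartialDerivatives.
Variables (d : nat) (W : normedModType R).

Definition pd (i : 'I_d) (f : 'rV[R]_d -> W) : 'rV[R]_d -> W :=
  fun u => 'D_(delta_mx 0 i) f u.

Definition pds (s : seq 'I_d) (f : 'rV[R]_d -> W) : 'rV[R]_d -> W :=
  foldr pd f s.

(* f is of class C^k on the open set U. *)
Definition Ck (k : nat) (U : set 'rV[R]_d) (f : 'rV[R]_d -> W) : Prop :=
  (forall (s : seq 'I_d) u, (size s <= k)%N -> U u ->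
     {for u, continuous (pds s f)}) /\
  (forall (s : seq 'I_d) i u, (size s < k)%N -> U u ->
     derivable (pds s f) u (delta_mx 0 i)).

End PartialDerivatives.

(* The rows are the partial derivatives of psi, i.e. the coordinate tangent
   vectors. *)
Definition tangents d n (psi : 'rV[R]_d -> 'rV[R]_n) (u : 'rV[R]_d) :
    'M[R]_(d, n) := \matrix_(i < d) pd i psi u.

Section Manifold.
Variable d : nat.
Notation Rd := 'rV[R]_d.
Notation Rd1 := 'rV[R]_d.+1.

(* phi is a local parameterization of class C^r (r >= 1) of the d-dimensional
   embedded submanifold M: an immersion of the open set U that is a
   homeomorphism onto a relatively open subset of M; the last clause makes
   phi : U -> M an open map. *)
Definition is_chart (r : nat) (M : set Rd1) (U : set Rd) (phi : Rd -> Rd1) :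
    Prop :=
  [/\ open U, Ck r U phi,
      forall u, U u -> row_free (tangents phi u),
      {in U &, injective phi}
    & forall W : set Rd, open W -> W `<=` U ->
        exists2 O : set Rd1, open O & phi @` W = M `&` O].

(* theta : M -> R^(d+1) has injective differential everywhere. *)
Definition immersion (M : set Rd1) (theta : Rd1 -> Rd1) : Prop :=
  forall U phi u, is_chart 1 M U phi -> U u ->
    row_free (tangents (theta \o phi) u).

Definition unit_normal_at (M : set Rd1) (theta : Rd1 -> Rd1) (p n : Rd1) :
    Prop :=
  dot n n = 1 /\
  forall U phi u, is_chart 1 M U phi -> U u -> phi u = p ->
    forall i : 'I_d, dot n (pd i (theta \o phi) u) = 0.

Definition closed_hypersurface (r : nat) (M : set Rd1) : Prop :=
  [/\ connected M, compact M,
      forall p, M p -> exists U phi, is_chart r M U phi /\ (phi @` U) p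
    & exists2 n : Rd1 -> Rd1, {within M, continuous n} &
        forall p, M p -> unit_normal_at M id p (n p)].

Section FunctionSpaces.
Variable W : normedModType R.

(* C^k functions on the C^r hypersurface M, for k <= r. *)
Definition CkM (r k : nat) (M : set Rd1) (f : Rd1 -> W) : Prop :=
  forall U phi, is_chart r M U phi -> Ck k U (f \o phi).

(* Convergence f_s -> g along F for the topology of C^k(M): derivatives of
   order at most k in charts converge uniformly on compact sets. As M is
   compact, this is the topology of the C^k norm of any finite atlas. *)
Definition CkM_cvg (r k : nat) (M : set Rd1) (F : set_system R)
    (f : R -> Rd1 -> W) (g : Rd1 -> W) : Prop :=
  forall U phi (K : set Rd), is_chart r M U phi -> compact K -> K `<=` U ->
  forall s : seq 'I_d, (size s <= k)%N ->
  forall e : R, 0 < e ->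
  \forall t \near F, forall u, K u ->
    `|pds s (f t \o phi) u - pds s (g \o phi) u| < e.

(* f \in C^l([0, T], C^k(M, W)); derivatives are one-sided at 0 and T. *)
Fixpoint Cl_CkM (T : R) (r l k : nat) (M : set Rd1) (f : R -> Rd1 -> W) :
    Prop :=
  (forall t, t \in `[0, T] ->
     CkM r k M (f t) /\ CkM_cvg r k M (within `[0, T] (nbhs t)) f (f t)) /\
  if l is l'.+1 then
    exists2 g : R -> Rd1 -> W,
      (forall t, t \in `[0, T] ->
         CkM_cvg r k M (within `[0, T] t^')
           (fun s p => (s - t)^-1 *: (f s p - f t p)) (g t))
      & Cl_CkM T r l' k M g
  else True.

End FunctionSpaces.

(* C^(1+l)-C^(2+k)-evolving immersed closed hypersurface with reference surface
   M and global parameterization theta. *)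
Definition evolving_hypersurface (T : R) (l k : nat) (M : set Rd1)
    (theta : R -> Rd1 -> Rd1) : Prop :=
  [/\ closed_hypersurface (2 + k) M,
      Cl_CkM T (2 + k) (1 + l) k M theta,
      Cl_CkM T (2 + k) l (2 + k) M theta
    & forall t, t \in `[0, T] -> immersion M (theta t)].

Definition evolving_normal (T : R) (M : set Rd1) (theta nu : R -> Rd1 -> Rd1) :
    Prop :=
  {within `[0, T] `*` M, continuous (fun x : R * Rd1 => nu x.1 x.2)} /\
  forall t p, t \in `[0, T] -> M p -> unit_normal_at M (theta t) p (nu t p).

(* The surface gradient \sum_(i, j) g^(ij) (d_i h) (d_j psi), with
   g_(ij) = d_i psi . d_j psi, of a function h given in the parameterization
   psi. *)
Definition chart_grad (psi : Rd -> Rd1) (h : Rd -> R) (u : Rd) : Rd1 :=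
  let J := tangents psi u in
  (\row_(i < d) pd i h u) *m invmx (J *m J^T) *m J.

(* The pullback to M of the surface gradient of the immersed surface theta(M):
   the vector given by chart_grad in every chart of M around p. It exists and
   is unique when p \in M and theta and f are C^1 on M, theta an immersion. *)
Definition surf_grad (M : set Rd1) (theta : Rd1 -> Rd1) (f : Rd1 -> R)
    (p : Rd1) : Rd1 :=
  xget 0 [set v | forall U phi u, is_chart 1 M U phi -> U u -> phi u = p ->
                    v = chart_grad (theta \o phi) (f \o phi) u].

(* [surf_jac F]_(ij) = [surf_grad F_i]_j *)
Definition surf_jac (M : set Rd1) (theta F : Rd1 -> Rd1) (p : Rd1) :
    'M[R]_d.+1 :=
  \matrix_(i < d.+1) surf_grad M theta (fun q => F q 0 i) p.

Definition surf_div (M : set Rd1) (theta F : Rd1 -> Rd1) (p : Rd1) : R :=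
  \tr (surf_jac M theta F p).

Definition surf_hess (M : set Rd1) (theta : Rd1 -> Rd1) (f : Rd1 -> R) :
    Rd1 -> 'M[R]_d.+1 := surf_jac M theta (surf_grad M theta f).

Definition laplace_beltrami (M : set Rd1) (theta : Rd1 -> Rd1)
    (f : Rd1 -> R) : Rd1 -> R := surf_div M theta (surf_grad M theta f).

Definition mean_curvature (M : set Rd1) (theta nu : Rd1 -> Rd1) (p : Rd1) : R :=
  - surf_div M theta nu p.

Definition mxdot n (A B : 'M[R]_n) : R := \sum_i \sum_j A i j * B i j.

(* Time derivative on [0, T], one-sided at the end points. *)
Definition time_deriv (T : R) (theta : R -> Rd1 -> Rd1) (t : R) (p : Rd1) :
    Rd1 :=
  lim ((fun s => (s - t)^-1 *: (theta s p - theta t p)) @ within `[0, T] t^').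

Definition normal_velocity (T : R) (theta nu : R -> Rd1 -> Rd1) (t : R)
    (p : Rd1) : R := dot (time_deriv T theta t p) (nu t p).

Definition posdef n (A : 'M[R]_n) : Prop :=
  forall xi : 'rV[R]_n, xi != 0 -> 0 < dot (xi *m A) xi.

End Manifold.
End Hypersurfaces.

(* Main.v *)
(** Since the hypersurface moves with normal velocity V, its mean curvature
    satisfies d_t H = Delta V + V |grad nu|^2 + X . grad H, where X is the
    tangential part of the velocity. The assumed identity turns this into a linear
    parabolic equation for H with continuous coefficients.

    Weak maximum principle: for L > max C the function exp(- L t) H has a
    negative zeroth order coefficient, hence no negative minimum at a positive
    time, so H >= 0. Strong maximum principle: in a chart, comparison from below
    with eps exp(- lam (t - s)) (rho + kap (t - s) - |u - x|^2)^2, which is a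
    subsolution for large lam, carries positivity from (s, x) to every nearby
    point at any later time. Hence the set of points of M where H > 0 for all
    t > 0 is open and closed. It is not empty: at a point of Gamma(0) farthest
    from the origin the position vector is normal and the trace of the Hessian of
    |theta|^2 is 2 d + 2 (theta . nu) H <= 0, which excludes H = 0. *)

From HB Require Import structures.
Require Import Defs.
From mathcomp Require Import all_boot all_order all_algebra.
From mathcomp Require Import all_classical all_reals all_analysis.
From mathcomp Require Import ring lra.
Import Order.TTheory GRing.Theory Num.Theory.
Import numFieldNormedType.Exports.

Set Implicit Arguments.
Unset Strict Implicit.
Unset Printing Implicit Defensive.

Local Open Scope classical_set_scope.
Local Open Scope ring_scope.
(** * Differential calculus in coordinates *)

(** The normal is given only as a continuous map, while H is its divergence and has to be
    differentiated once more in time and twice in space. Two devices deal with this. A unit normal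
    inherits the regularity of the tangent vectors, because its difference quotients are expressible
    through theirs. And H is rewritten with the second derivatives of the position contracted with
    the normal, so that its quotient in time involves no mixed derivative of the normal. Derivatives
    in time are limits of left difference quotients, which is enough at a minimum and includes the
    final time. The barrier is a square because its second derivatives then leave, at the edge of
    the paraboloid, a positive term quadratic in the distance to the axis, while all other terms
    carry a factor that vanishes there. Away from the edge a large decay rate wins. The growth rate
    [kap] makes the ball reach a prescribed size in an arbitrarily short time, which yields
    positivity at every later time and not only after a delay. *)

Section Limits.
Context {R : realType} {T : Type} {F : set_system T} {FF : Filter F}.

Lemma cvgr_sum (I : Type) (r : seq I) (P : pred I) (f : I -> T -> R) (a : I -> R) :
  (forall i, P i -> f i x @[x --> F] --> a i) ->
  \sum_(i <- r | P i) f i x @[x --> F] --> \sum_(i <- r | P i) a i.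
Proof. by apply: cvg_big; exact: add_continuous. Qed.

Lemma cvgr_prod (I : Type) (r : seq I) (P : pred I) (f : I -> T -> R) (a : I -> R) :
  (forall i, P i -> f i x @[x --> F] --> a i) ->
  \prod_(i <- r | P i) f i x @[x --> F] --> \prod_(i <- r | P i) a i.
Proof. by apply: cvg_big; exact: mul_continuous. Qed.

End Limits.

Section Lines.
Variables (R : realType) (V : normedModType R).
Implicit Types (f : V -> R) (u v : V).

Lemma derivable_line f u v (x : R) : derivable f (x *: v + u) v ->
  is_derive x (1:R) (fun s : R => f (s *: v + u)) ('D_v f (x *: v + u)).
Proof.
move=> df.
have E : (fun h : R => h^-1 *: ((fun s : R => f (s *: v + u)) (h *: (1 : R) + x) - f (x *: v + u)))
    = (fun h => h^-1 *: ((f \o shift (x *: v + u)) (h *: v) - f (x *: v + u))).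
  apply/funext => h; congr (_ *: (f _ - _)).
  have -> : h *: (1 : R) = h by rewrite /GRing.scale /= mulr1.
  by rewrite /= scalerDl addrA.
split; first by rewrite /derivable /comp /= E.
by rewrite /derive /comp /= E.
Qed.

(** One form for both signs of [s], including [s = 0]. The clause [0 < s -> 0 < c] serves the
    second-order test at a minimum, where the intermediate point must lie strictly beyond [u]. *)
Lemma line_mean_value f u v (s : R) :
  (forall x : R, `|x| <= `|s| -> derivable f (x *: v + u) v) ->
  exists c : R, [/\ `|c| <= `|s|, 0 < s -> 0 < c &
    f (s *: v + u) - f u = s * 'D_v f (c *: v + u)].
Proof.
move=> df.
pose g (x : R) := f (x *: v + u).
have dg x : `|x| <= `|s| -> is_derive (x : R) (1 : R) g ('D_v f (x *: v + u)).
  by move=> xs; apply: derivable_line; exact: df.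
have cg (a b : R) : (forall x, x \in `[a, b] -> `|x| <= `|s|) ->
    {within `[a, b], continuous g}.
  move=> ab; apply: derivable_within_continuous => x xab.
  exact: (@ex_derive _ _ _ _ _ _ _ (dg x (ab x xab))).
have g0 : g 0 = f u by rewrite /g scale0r add0r.
have [s0|s0|s0] := ltgtP 0 s.
- have sub x : x \in `[0, s] -> `|x| <= `|s|.
    by rewrite in_itv /= => /andP[x0 xs]; rewrite !ger0_norm// (le_trans x0).
  have [|c cs e] := @MVT _ g (fun x => 'D_v f (x *: v + u)) _ _ s0 _ (cg _ _ sub).
    by move=> x xs; apply: dg; apply: sub; exact: subset_itv_oo_cc.
  exists c; split; first by apply: sub; exact: subset_itv_oo_cc.
    by move: cs; rewrite in_itv /= => /andP[].
  by rewrite -g0 -[f (s *: _ + _)]/(g s) e subr0 mulrC.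
- have sub x : x \in `[s, 0] -> `|x| <= `|s|.
    by rewrite in_itv /= => /andP[xs x0]; rewrite !ler0_norm ?lerN2// ltW.
  have [|c cs e] := @MVT _ g (fun x => 'D_v f (x *: v + u)) _ _ s0 _ (cg _ _ sub).
    by move=> x xs; apply: dg; apply: sub; exact: subset_itv_oo_cc.
  exists c; split=> //; first by apply: sub; exact: subset_itv_oo_cc.
  by rewrite -g0 -[f (s *: _ + _)]/(g s) -opprB e; ring.
- by exists 0; rewrite -s0 normr0 !scale0r add0r subrr mul0r; split.
Qed.

Lemma derive_shift_arg f (a v x : V) :
  'D_v (fun y => f (y + a)) x = 'D_v f (x + a).
Proof.
rewrite /derive; set g := fun h : R => _; set k := fun h : R => _.
by have -> : g = k by apply/funext => h; rewrite /g /k /= addrA.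
Qed.

Lemma derivable_shift_arg f (a v x : V) :
  derivable f (x + a) v -> derivable (fun y => f (y + a)) x v.
Proof.
rewrite /derivable; set g := fun h : R => _; set k := fun h : R => _.
by have -> : g = k by apply/funext => h; rewrite /g /k /= addrA.
Qed.

End Lines.

Section PartialDerivativeTheory.
Variables (R : realType) (d : nat).
Notation Rd := 'rV[R]_d.
Notation e_ i := (delta_mx 0 i : Rd).

Lemma normr_coord m n (M : 'M[R]_(m, n)) i j : `|M i j| <= `|M|.
Proof. by rewrite {2}/Num.norm /= mx_normrE; exact: (le_bigmax _ _ (i, j)). Qed.

Lemma normr_mx_le m n (M : 'M[R]_(m, n)) (e : R) : 0 <= e ->
  (forall i j, `|M i j| <= e) -> `|M| <= e.
Proof.
by move=> e0 Me; rewrite /Num.norm /= mx_normrE; apply: bigmax_le => // -[a b] _ /=.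
Qed.

Lemma near_ballP (u : Rd) (P : Rd -> Prop) :
  (\near u, P u) <-> exists2 r : R, 0 < r & forall y, `|y| < r -> P (y + u).
Proof.
split=> [/nbhs_normP[r /= r0 Pr]|[r r0 Pr]].
  exists r => // y yr; apply: Pr; rewrite /ball_ /=.
  by rewrite opprD addrCA subrr addr0 normrN.
apply/nbhs_normP; exists r => //= y; rewrite /ball_ /= => yr.
by rewrite -[y](subrK u); apply: Pr; rewrite distrC.
Qed.

Lemma linear_form_subproof (c : 'I_d -> R) :
  linear (fun h : Rd => \sum_i h 0 i * c i : R).
Proof.
move=> a x y; rewrite scaler_sumr -big_split; apply: eq_bigr => i _ /=.
by rewrite !mxE mulrDl -mulrA.
Qed.

Definition row_prefix (h : Rd) (k : nat) : Rd :=
  \row_j (if (j < k)%N then h 0 j else 0).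

Lemma row_prefixS h (i : 'I_d) :
  row_prefix h i.+1 = h 0 i *: e_ i + row_prefix h i.
Proof.
apply/rowP => j; rewrite !mxE eqxx /= ltnS leq_eqVlt -val_eqE /=.
by case: eqP => [/val_inj ->|_]; rewrite ?ltnn /= ?mulr1 ?addr0// mulr0 add0r.
Qed.

(* Telescoping along the coordinates reduces the increment of f to one
   application of the mean value theorem per coordinate. *)
Lemma C1_differentiable (f : Rd -> R) u :
  (forall i : 'I_d, \near u, derivable f u (e_ i)) ->
  (forall i, {for u, continuous (pd i f)}) ->
  differentiable f u.
Proof.
move=> df cf.
pose L (h : Rd) : R := \sum_i h 0 i * pd i f u.
have linL : linear L by exact: linear_form_subproof.
pose LM := GRing.isLinear.Build _ _ _ _ L linL.
pose L' : {linear Rd -> R} := HB.pack L LM.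
have cL : continuous L'.
  move=> x; rewrite /L' /= /L; apply: (@cvgr_sum _ _ (nbhs x)) => i _; by apply: cvgM; [exact: coord_continuous|exact: cvg_cst].
suff H : f \o shift u = cst (f u) + L' +o_ 0 id.
  by apply/diff_locallyP; rewrite (diff_unique cL H).
apply/eqaddoP => _/posnumP[e].
(* Each of the [d] coordinates gets a share of [e]; the denominator [d.+1] also covers [d = 0]. *)
have [r r0 Hr] : exists2 r : R, 0 < r & forall y, `|y| < r ->
    forall i : 'I_d, derivable f (y + u) (e_ i) /\ `|pd i f (y + u) - pd i f u| <= e%:num / d.+1%:R.
  apply/(near_ballP u (fun z => forall i : 'I_d, derivable f z (e_ i) /\
    `|pd i f z - pd i f u| <= e%:num / d.+1%:R)).
  apply: (@filter_forall _ _ (fun (i : 'I_d) z => derivable f z (e_ i) /\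
    `|pd i f z - pd i f u| <= e%:num / d.+1%:R) (nbhs u)) => i.
  apply: filterI; first exact: df.
  have /cvgrPdist_le := cf i; move=> /(_ (e%:num / d.+1%:R)).
  by rewrite divr_gt0// => /(_ isT); apply: filterS => y; rewrite distrC.
have N : \forall h \near (0 : Rd), `|h| < r by exact: nbhs0_lt.
apply: (filterS _ N) => h hr.
have -> : (f \o shift u - (cst (f u) + L')) h = f (h + u) - (f u + L h) by [].
have E : f (h + u) - f u = \sum_(i < d) (f (row_prefix h i.+1 + u) - f (row_prefix h i + u)).
  rewrite -(big_mkord xpredT (fun k => f (row_prefix h k.+1 + u) - f (row_prefix h k + u))).
  rewrite (telescope_sumr (fun k => f (row_prefix h k + u)))//; congr (f (_ + _) - f _).
    by apply/rowP => j; rewrite mxE ltn_ord.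
  by rewrite -[LHS]add0r; congr (_ + _); apply/rowP => j; rewrite !mxE.
rewrite opprD addrA E /L -sumrB.
apply: (@le_trans _ _ (\sum_(i < d) e%:num / d.+1%:R * `|h|)).
  apply: (le_trans (ler_norm_sum _ _ _)); apply: ler_sum => i _.
  rewrite row_prefixS.
  (* In the sup norm the broken path from 0 to [h] stays in the ball of radius [|h|]. *)
  have hs (x : R) : `|x| <= `|h 0 i| -> `|x *: e_ i + row_prefix h i| <= `|h|.
    move=> xh; apply: normr_mx_le => // a j; rewrite ord1 !mxE eqxx /=.
    case: (eqVneq j i) => [->|ji]; rewrite ?ltnn.
      by rewrite mulr1 addr0 (le_trans xh)// normr_coord.
    by rewrite mulr0 add0r; case: ifP => _; rewrite ?normr0 ?normr_coord.
  have [|c [cs _]] := @line_mean_value _ _ f (row_prefix h i + u) (e_ i) (h 0 i).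
    by move=> x xh; rewrite addrA; apply: (Hr _ _ i).1; exact: le_lt_trans (hs _ xh) hr.
  rewrite addrA => ->; rewrite -mulrBr normrM addrA mulrC; apply: ler_pM => //; last exact: normr_coord.
  by apply: (Hr _ _ i).2; exact: le_lt_trans (hs _ cs) hr.
rewrite sumr_const card_ord -mulrnAl; apply: ler_wpM2r => //.
by rewrite -mulrnAr ger_pMr// -mulr_natr mulrC ler_pdivrMr// mul1r ler_nat.
Qed.

(** Two applications of the mean value theorem: to the increment of [f] in direction [j], moving
    along [i], and then to [pd i f] along [j]. The left-hand side is symmetric in [i] and [j], which
    is what makes the mixed partials agree. The bound [s + s < r] keeps the whole square in the
    ball. *)
Lemma second_difference (f : Rd -> R) u (i j : 'I_d) (s r : R) :
  0 < s -> s + s < r ->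
  (forall y, `|y| < r -> derivable f (y + u) (e_ i)) ->
  (forall y, `|y| < r -> derivable (pd i f) (y + u) (e_ j)) ->
  exists2 y, `|y| < r &
    f (s *: e_ i + (s *: e_ j + u)) - f (s *: e_ i + u) - (f (s *: e_ j + u) - f u)
    = s * s * pd j (pd i f) (y + u).
Proof.
move=> s0 sr dif djf.
have nle (k l : 'I_d) (a b : R) : `|a| <= s -> `|b| <= s -> `|a *: e_ k + b *: e_ l| < r.
  move=> ha hb; apply: le_lt_trans sr; apply: le_trans (ler_normD _ _) _.
  have n1 (m : 'I_d) : `|e_ m| <= 1.
    by apply: normr_mx_le => // p q; rewrite mxE; case: (_ && _); rewrite ?normr1 ?normr0.
  by apply: lerD; rewrite normrZ (le_trans (ler_piMr _ (n1 _))).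
pose g y := f (y + s *: e_ j) - f y.
have s1 : `|s| = s by rewrite gtr0_norm.
have d1 (x : R) : `|x| <= `|s| -> derivable f (x *: e_ i + u) (e_ i).
  rewrite s1 => xs; apply: dif.
  by have := nle i i x 0 xs; rewrite normr0 scale0r addr0; apply; exact: ltW.
have d2 (x : R) : `|x| <= `|s| -> derivable (fun y => f (y + s *: e_ j)) (x *: e_ i + u) (e_ i).
  move=> xs; apply: derivable_shift_arg; rewrite addrAC; apply: dif; apply: nle.
    by rewrite -s1.
  by rewrite s1.
have [|c [cs _ Ec]] := @line_mean_value _ _ g u (e_ i) s.
  by move=> x xs; apply: derivableB; [exact: d2|exact: d1].
have [|c' [cs' _ Ec']] := @line_mean_value _ _ (pd i f) (c *: e_ i + u) (e_ j) s.
  move=> x xs; rewrite addrA; apply: djf; apply: nle; by rewrite -s1.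
exists (c' *: e_ j + c *: e_ i); first by apply: nle; rewrite -s1.
rewrite -mulrA -[_ + _ + u]addrA -[pd j _ _]/('D_(e_ j) (pd i f) _) -Ec'.
move: Ec; rewrite deriveB; [|exact: d2|exact: d1].
rewrite derive_shift_arg /g => Ec1.
have -> : s *: e_ j + (c *: e_ i + u) = c *: e_ i + u + s *: e_ j by rewrite addrC.
rewrite /pd -Ec1 addrA.
by rewrite -[s *: e_ i + u + s *: e_ j]addrA [u + s *: e_ j]addrC addrA.
Qed.

(** Both iterated partials, each taken at some point near [u], equal the same second difference
    divided by [s * s]; continuity at [u] moves both points to [u]. *)
Lemma mixed_partials (f : Rd -> R) u (i j : 'I_d) :
  (\near u, [/\ derivable f u (e_ i), derivable f u (e_ j),
    derivable (pd i f) u (e_ j) & derivable (pd j f) u (e_ i)]) ->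
  {for u, continuous (pd j (pd i f))} -> {for u, continuous (pd i (pd j f))} ->
  pd j (pd i f) u = pd i (pd j f) u.
Proof.
move=> df cji cij; apply/eqP; rewrite -subr_eq0 -normr_le0.
apply/ler_addgt0Pr => e e0; rewrite add0r.
have e2 : 0 < e / 2 by rewrite divr_gt0.
have [r r0 Hr] : exists2 r : R, 0 < r & forall y, `|y| < r ->
   [/\ derivable f (y + u) (e_ i), derivable f (y + u) (e_ j),
    derivable (pd i f) (y + u) (e_ j) & derivable (pd j f) (y + u) (e_ i)] /\ (`|pd j (pd i f) u - pd j (pd i f) (y + u)| <= e / 2 /\ `|pd i (pd j f) u - pd i (pd j f) (y + u)| <= e / 2).
  apply/(near_ballP u (fun z => [/\ derivable f z (e_ i), derivable f z (e_ j),
    derivable (pd i f) z (e_ j) & derivable (pd j f) z (e_ i)] /\ (`|pd j (pd i f) u - pd j (pd i f) z| <= e / 2 /\ `|pd i (pd j f) u - pd i (pd j f) z| <= e / 2))).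
  apply: filterI => //; apply: filterI.
    by move/cvgrPdist_le : cji => /(_ _ e2).
  by move/cvgrPdist_le : cij => /(_ _ e2).
pose s := r / 3; have s0 : 0 < s by rewrite divr_gt0.
have sr : s + s < r by rewrite /s; lra.
have [||y1 y1r E1] := @second_difference f u i j s r s0 sr.
- by move=> y /Hr[[h _ _ _] _].
- by move=> y /Hr[[_ _ h _] _].
have [||y2 y2r E2] := @second_difference f u j i s r s0 sr.
- by move=> y /Hr[[_ h _ _] _].
- by move=> y /Hr[[_ _ _ h] _].
have E : pd j (pd i f) (y1 + u) = pd i (pd j f) (y2 + u).
  apply: (@mulfI _ (s * s)); first by rewrite mulf_neq0// gt_eqF.
  apply: etrans (esym E1) _; apply: etrans _ E2.
  have -> : s *: e_ j + (s *: e_ i + u) = s *: e_ i + (s *: e_ j + u) by exact: addrCA.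
  by move: (f _) (f (s *: e_ i + u)) (f (s *: e_ j + u)) (f u) => a b c k; ring.
have [_ [h1 _]] := Hr _ y1r; have [_ [_ h2]] := Hr _ y2r.
move: h1 h2 E.
move: (pd j (pd i f) (y1 + u)) (pd i (pd j f) (y2 + u)) => p q h1 h2 pq.
move: h1 h2; rewrite pq; move: (pd j (pd i f) u) (pd i (pd j f) u) => a b h1 h2.
rewrite [e]splitr; apply: le_trans (lerD h1 h2).
by rewrite [X in _ <= _ + X]distrC; exact: ler_distD.
Qed.

Lemma diff_row (f : Rd -> R) u (xi : Rd) : differentiable f u ->
  'D_xi f u = \sum_i xi 0 i * pd i f u.
Proof.
move=> df; rewrite deriveE// [in LHS](row_sum_delta xi) linear_sum.
by apply: eq_bigr => i _; rewrite linearZ /= /pd deriveE.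
Qed.

Lemma derive_lt0_decr (f : Rd -> R) u v : derivable f u v -> 'D_v f u < 0 ->
  exists2 r : R, 0 < r & forall h, 0 < h < r -> f (h *: v + u) < f u.
Proof.
move=> df dlt; have /cvgr_lt/(_ _ dlt) := df.
move=> /nbhs_normP[r /= r0 Hr]; exists r => // h /andP[h0 hr].
have := Hr h; rewrite /ball_ /= sub0r normrN gtr0_norm// gt_eqF// => /(_ hr isT).
by rewrite /GRing.scale /= pmulr_rlt0 ?invr_gt0// subr_lt0.
Qed.

Lemma local_min_derive (f : Rd -> R) u : differentiable f u ->
  (\forall y \near u, f u <= f y) -> forall xi, 'D_xi f u = 0.
Proof.
move=> df fmin.
suff H xi : 0 <= 'D_xi f u.
  move=> xi; apply/eqP; rewrite eq_le H andbT.
  by have := H (- xi); rewrite !deriveE// linearN oppr_ge0.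
rewrite leNgt; apply/negP => dlt.
have [r r0 Hr] := derive_lt0_decr (diff_derivable df) dlt.
have : \forall h \near (0 : R), f u <= f (h *: xi + u).
  have : (fun h : R => h *: xi + u) @ (0 : R) --> u.
    rewrite -[X in _ --> X]add0r -[X in _ --> X + _](scale0r xi).
    by apply: cvgD; [apply: cvgZ; [exact: cvg_id|exact: cvg_cst]|exact: cvg_cst].
  by move=> /(_ _ fmin).
move=> /nbhs_normP[r' /= r'0 Hr'].
pose h := Num.min r r' / 2.
have m0 : 0 < Num.min r r' by rewrite lt_min r0.
have h0 : 0 < h by rewrite divr_gt0.
have hm : h < Num.min r r' by rewrite /h ltr_pdivrMr// ltr_pMr// ltr1n.
have := Hr' h; rewrite /ball_ /= sub0r normrN gtr0_norm//.
move: hm; rewrite lt_min => /andP[hr hr'] /(_ hr').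
by rewrite leNgt Hr// h0.
Qed.

(** No Taylor expansion: if the form were negative at [xi], the derivative [E] along [xi], which
    vanishes at [u], would be negative just beyond [u], and by the mean value theorem [f] would drop
    below [f u]. *)
Lemma local_min_hessian (f : Rd -> R) u :
  (\near u, differentiable f u) -> (forall i, differentiable (pd i f) u) ->
  (\forall y \near u, f u <= f y) ->
  forall xi : Rd, 0 <= \sum_i \sum_j xi 0 i * xi 0 j * pd j (pd i f) u.
Proof.
move=> df ddf fmin xi; rewrite leNgt; apply/negP => Q0.
pose E y := \sum_i xi 0 i * pd i f y.
have EE : E = \sum_i (fun y => xi 0 i * pd i f y).
  by apply/funext => y; rewrite fct_sumE.
have dE : differentiable E u.
  rewrite EE; apply: differentiable_sum => i.
  by apply: differentiableM => //; exact: differentiable_cst.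
have DE : 'D_xi E u = \sum_i \sum_j xi 0 i * xi 0 j * pd j (pd i f) u.
  rewrite EE derive_sum; last first.
    move=> i; apply: diff_derivable.
    by apply: differentiableM => //; exact: differentiable_cst.
  apply: eq_bigr => i _.
  apply: etrans (@deriveZ _ _ _ (pd i f) (xi 0 i) u xi (diff_derivable (ddf i))) _.
  rewrite diff_row /GRing.scale; last exact: ddf.
  by rewrite /= mulr_sumr; apply: eq_bigr => j _; exact: mulrA.
rewrite -DE in Q0.
have E0 : E u = 0.
  by rewrite /E -diff_row; [exact: local_min_derive (nbhs_singleton df) _ _|exact: nbhs_singleton df].
have [r r0 Hr] := derive_lt0_decr (diff_derivable dE) Q0.
have [r' r'0 Hr'] : exists2 r : R, 0 < r & forall y, `|y| < r ->
   differentiable f (y + u) /\ f u <= f (y + u).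
  apply/(near_ballP u (fun z => differentiable f z /\ f u <= f z)).
  exact: filterI.
pose k := r' / (`|xi| + 1).
have x1 : 0 < `|xi| + 1 by rewrite ltr_wpDl.
have k0 : 0 < k by rewrite divr_gt0.
pose h := Num.min r k / 2.
have m0 : 0 < Num.min r k by rewrite lt_min r0.
have h0 : 0 < h by rewrite divr_gt0.
have : h < Num.min r k by rewrite /h ltr_pdivrMr// ltr_pMr// ltr1n.
rewrite lt_min => /andP[hr hk].
have sm (x : R) : `|x| <= `|h| -> `|x *: xi| < r'.
  rewrite (gtr0_norm h0) => xh; rewrite normrZ.
  have : h * (`|xi| + 1) < r' by rewrite -ltr_pdivlMr.
  apply: le_lt_trans; apply: ler_pM => //; by rewrite lerDl.
have [|c [ch c0 Ec]] := @line_mean_value _ _ f u xi h.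
  by move=> x xh; apply: diff_derivable; exact: (Hr' _ (sm _ xh)).1.
have c_gt0 := c0 h0.
have : f u <= f (h *: xi + u) by apply: (Hr' _ (sm _ _)).2.
rewrite -subr_ge0 Ec pmulr_rge0// diff_row; last exact: (Hr' _ (sm _ ch)).1.
rewrite leNgt -[X in _ < X]E0 Hr// c_gt0 /=.
by apply: le_lt_trans hr; move: ch; rewrite !gtr0_norm.
Qed.

End PartialDerivativeTheory.

(** * Families of class C^k in space, jointly continuous in time *)

Section JointlySmooth.
Variables (R : realType) (d : nat).
Notation Rd := 'rV[R]_d.
Notation e_ i := (delta_mx 0 i : Rd).

Section JointClass.
Variable W : normedModType R.

Definition jcont (U : set Rd) (F : R -> Rd -> W) : Prop :=
  forall t u, U u -> {for (t, u), continuous (fun x : R * Rd => F x.1 x.2)}.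

(* F t is of class C^k on U, and its derivatives of order at most k are jointly
   continuous in (t, u). *)
Fixpoint jC (k : nat) (U : set Rd) (F : R -> Rd -> W) : Prop :=
  jcont U F /\
  if k is k'.+1 then
    forall i : 'I_d, (forall t u, U u -> derivable (F t) u (e_ i)) /\
      jC k' U (fun t => pd i (F t))
  else True.

Lemma jC_cont k U F : jC k U F -> jcont U F.
Proof. by case: k => [|k] []. Qed.

Lemma jC_derivable k U F t u (i : 'I_d) : jC k.+1 U F -> U u ->
  derivable (F t) u (e_ i).
Proof. by move=> [_ /(_ i)[+ _]]; exact. Qed.

Lemma jC_pd k U F (i : 'I_d) : jC k.+1 U F -> jC k U (fun t => pd i (F t)).
Proof. by move=> [_ /(_ i)[_ +]]. Qed.

Lemma jCW k U F : jC k.+1 U F -> jC k U F.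
Proof.
elim: k F => [|k IH] F; first by move=> [].
by move=> [cF dF]; split=> // i; have [di ji] := dF i; split => //; exact: IH.
Qed.

Lemma jC_le k l U F : (l <= k)%N -> jC k U F -> jC l U F.
Proof. by move=> /subnK <-; elim: (k - l)%N => // n IH /jCW. Qed.

Lemma jcont_at U F t u : jcont U F -> U u -> {for u, continuous (F t)}.
Proof.
move=> cF Uu; apply: (@continuous_comp _ _ _ (fun v : Rd => (t, v)) (fun x : R * Rd => F x.1 x.2)).
  by apply: (@cvg_pair _ _ _ (nbhs u) (nbhs t) (nbhs u)); [exact: cvg_cst|exact: cvg_id].
exact: cF.
Qed.

Lemma jcont_ext U F G : open U -> (forall t u, U u -> F t u = G t u) ->
  jcont U F -> jcont U G.
Proof.
move=> oU FG cF t u Uu.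
rewrite /prop_for /continuous_at /= -FG//.
apply: cvg_trans (cF t u Uu); apply: near_eq_cvg.
exists (setT, U) => /=; first by split; [exact: filterT|exact: open_nbhs_nbhs].
by move=> [s v] /= [_ Uv]; rewrite FG.
Qed.

Lemma pd_eq_near (f g : Rd -> W) (i : 'I_d) u : (\near u, f u = g u) ->
  pd i f u = pd i g u.
Proof. exact: near_eq_derive. Qed.

Lemma pd_eq_on (U : set Rd) (f g : Rd -> W) (i : 'I_d) u : open U -> U u ->
  (forall v, U v -> f v = g v) -> pd i f u = pd i g u.
Proof.
move=> oU Uu fg; apply: pd_eq_near.
by apply: filterS (open_nbhs_nbhs (conj oU Uu)) => v /fg.
Qed.

Lemma derivable_eq_on (U : set Rd) (f g : Rd -> W) u v : open U -> U u ->
  (forall v, U v -> f v = g v) -> derivable f u v -> derivable g u v.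
Proof.
move=> oU Uu fg; apply: near_eq_derivable.
by apply: filterS (open_nbhs_nbhs (conj oU Uu)) => w /fg.
Qed.

Lemma jC_ext k U F G : open U -> (forall t u, U u -> F t u = G t u) ->
  jC k U F -> jC k U G.
Proof.
move=> oU; elim: k F G => [|k IH] F G FG.
  by move=> [cF _]; split => //; exact: jcont_ext cF.
move=> [cF dF]; split; first exact: jcont_ext cF.
move=> i; have [di ji] := dF i; split=> [t u Uu|].
  apply: (derivable_eq_on oU Uu _ (di t u Uu)) => v Uv; exact: FG.
apply: IH ji => t u Uu; apply: (pd_eq_on i oU Uu) => v Uv; exact: FG.
Qed.

Lemma pds_rcons s (i : 'I_d) (f : Rd -> W) : pds (rcons s i) f = pds s (pd i f).
Proof. by rewrite /pds foldr_rcons. Qed.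

(** The recursion in [jC] peels off the derivative taken first, which is the last entry of the list
    since [pds] is a right fold; hence [rcons]. *)
Lemma jC_pds k U F :
  (forall s : seq 'I_d, (size s <= k)%N -> jcont U (fun t => pds s (F t))) ->
  (forall (s : seq 'I_d) (i : 'I_d) t u, (size s < k)%N -> U u ->
     derivable (pds s (F t)) u (e_ i)) ->
  jC k U F.
Proof.
elim: k F => [|k IH] F cF dF; first by split => //; exact: (cF [::]).
split; first exact: (cF [::]).
move=> i; split; first by move=> t u Uu; exact: (dF [::] i).
apply: IH => [s sk|s j t u sk Uu].
  have := cF (rcons s i); rewrite size_rcons => /(_ sk).
  by have -> : (fun t => pds (rcons s i) (F t)) = (fun t => pds s (pd i (F t)))
    by apply/funext => t; exact: pds_rcons.
by have := dF (rcons s i) j t u; rewrite size_rcons pds_rcons; apply.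
Qed.

End JointClass.

Lemma jC_coord m n k U (F : R -> Rd -> 'M[R]_(m, n)) i j : open U ->
  jC k U F -> jC k U (fun t u => F t u i j).
Proof.
move=> oU.
elim: k F => [|k IH] F [cF dF]; have cf : jcont U (fun t u => F t u i j).
- move=> t u Uu; apply: (@continuous_comp _ _ _ (fun x : R * Rd => F x.1 x.2) (fun M : 'M[R]_(m, n) => M i j)); [exact: cF|exact: coord_continuous].
- by split.
- move=> t u Uu; apply: (@continuous_comp _ _ _ (fun x : R * Rd => F x.1 x.2) (fun M : 'M[R]_(m, n) => M i j)); [exact: cF|exact: coord_continuous].
- split => // l; have [dl jl] := dF l; split=> [t u Uu|].
    by apply: (derivable_mxP (F t) u (e_ l)).1; exact: dl.
  apply: jC_ext (IH _ jl) => // t u Uu.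
  by rewrite /pd derive_mx ?mxE//; exact: dl.
Qed.

Section Scalar.
Variable U : set Rd.
Hypothesis oU : open U.
Implicit Types F G : R -> Rd -> R.

Lemma pdD (f g : Rd -> R) (i : 'I_d) u :
  derivable f u (e_ i) -> derivable g u (e_ i) ->
  pd i (fun v => f v + g v) u = pd i f u + pd i g u.
Proof. by move=> df dg; exact: (deriveD df dg). Qed.

Lemma pdN (f : Rd -> R) (i : 'I_d) u : derivable f u (e_ i) ->
  pd i (fun v => - f v) u = - pd i f u.
Proof. by move=> df; exact: (deriveN df). Qed.

Lemma pdM (f g : Rd -> R) (i : 'I_d) u :
  derivable f u (e_ i) -> derivable g u (e_ i) ->
  pd i (fun v => f v * g v) u = f u * pd i g u + g u * pd i f u.
Proof. by move=> df dg; exact: (deriveM df dg). Qed.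

Lemma pd_cst (a : R) (i : 'I_d) u : pd i (fun _ => a) u = 0.
Proof. exact: derive_cst. Qed.

Lemma pd_sum (I : Type) (r : seq I) (f : I -> Rd -> R) (i : 'I_d) u :
  (forall a, derivable (f a) u (e_ i)) ->
  derivable (fun v => \sum_(a <- r) f a v) u (e_ i) /\
  pd i (fun v => \sum_(a <- r) f a v) u = \sum_(a <- r) pd i (f a) u.
Proof.
move=> df; elim: r => [|a r [dr pr]].
  rewrite big_nil; have -> : (fun v : Rd => \sum_(a <- [::]) f a v) = cst 0.
    by apply/funext => v; rewrite big_nil.
  by split; [exact: derivable_cst|exact: derive_cst].
have -> : (fun v : Rd => \sum_(b <- a :: r) f b v) = (fun v => f a v + \sum_(b <- r) f b v).
  by apply/funext => v; rewrite big_cons.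
split; first exact: (derivableD (df a) dr).
by rewrite pdD// big_cons pr.
Qed.

Lemma jC_cst k (a : R) : jC k U (fun _ _ => a).
Proof.
elim: k a => [|k IH] a; first by split => // t u _; exact: cst_continuous.
split=> [t u _|i]; first exact: cst_continuous.
split=> [t u _|]; first exact: derivable_cst.
by apply: jC_ext (IH 0) => // t u _; rewrite pd_cst.
Qed.

Lemma jC_D k F G : jC k U F -> jC k U G -> jC k U (fun t u => F t u + G t u).
Proof.
elim: k F G => [|k IH] F G [cF dF] [cG dG].
  by split => // t u Uu; exact: cvgD (cF t u Uu) (cG t u Uu).
split=> [t u Uu|i]; first exact: cvgD (cF t u Uu) (cG t u Uu).
have [dFi jF] := dF i; have [dGi jG] := dG i; split=> [t u Uu|].
  exact: (derivableD (dFi t u Uu) (dGi t u Uu)).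
apply: jC_ext (IH _ _ jF jG) => // t u Uu.
by rewrite pdD//; [exact: dFi|exact: dGi].
Qed.

Lemma jC_M k F G : jC k U F -> jC k U G -> jC k U (fun t u => F t u * G t u).
Proof.
elim: k F G => [|k IH] F G jF jG; have cM : jcont U (fun t u => F t u * G t u).
- by move=> t u Uu; exact: cvgM (jC_cont jF Uu) (jC_cont jG Uu).
- by split.
- by move=> t u Uu; exact: cvgM (jC_cont jF Uu) (jC_cont jG Uu).
- split => // i; split=> [t u Uu|].
    have -> : (fun v => F t v * G t v) = F t * G t by [].
    by apply: derivableM; [exact: jC_derivable jF Uu|exact: jC_derivable jG Uu].
  have H := jC_D (IH _ _ (jCW jF) (jC_pd i jG)) (IH _ _ (jCW jG) (jC_pd i jF)).
  apply: jC_ext H => // t u Uu.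
  by rewrite pdM//; [exact: jC_derivable jF Uu|exact: jC_derivable jG Uu].
Qed.

Lemma jC_N k F : jC k U F -> jC k U (fun t u => - F t u).
Proof.
move=> jF; have := jC_M (jC_cst k (-1)) jF.
by apply: jC_ext => // t u _; rewrite mulN1r.
Qed.

Lemma jC_sum k (I : Type) (r : seq I) (F : I -> R -> Rd -> R) :
  (forall a, jC k U (F a)) -> jC k U (fun t u => \sum_(a <- r) F a t u).
Proof.
move=> jF; elim: r => [|a r IH].
  by apply: jC_ext (jC_cst k 0) => // t u _; rewrite big_nil.
by apply: jC_ext (jC_D (jF a) IH) => // t u _; rewrite big_cons.
Qed.

Lemma jC_differentiable F t u : jC 1 U F -> U u -> differentiable (F t) u.
Proof.
move=> jF Uu; apply: C1_differentiable => i.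
  apply: filterS (open_nbhs_nbhs (conj oU Uu)) => v Uv; exact: jC_derivable jF Uv.
exact: jcont_at (jC_cont (jC_pd i jF)) Uu.
Qed.

Lemma jC_mixed_partials F t u (i j : 'I_d) : jC 2 U F -> U u ->
  pd j (pd i (F t)) u = pd i (pd j (F t)) u.
Proof.
move=> jF Uu; apply: mixed_partials.
- apply: filterS (open_nbhs_nbhs (conj oU Uu)) => v Uv; split.
  + exact: jC_derivable jF Uv.
  + exact: jC_derivable jF Uv.
  + exact: jC_derivable (jC_pd i jF) Uv.
  + exact: jC_derivable (jC_pd j jF) Uv.
- exact: jcont_at (jC_cont (jC_pd j (jC_pd i jF))) Uu.
- exact: jcont_at (jC_cont (jC_pd i (jC_pd j jF))) Uu.
Qed.

End Scalar.
End JointlySmooth.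

(** * Linear algebra *)

Section LinearAlgebra.
Variable R : realType.

Lemma mulmx_tr_ge0 n (v : 'rV[R]_n) : 0 <= (v *m v^T) 0 0.
Proof. by rewrite mxE sumr_ge0// => i _; rewrite mxE -expr2 sqr_ge0. Qed.

Lemma mulmx_tr_eq0 n (v : 'rV[R]_n) : ((v *m v^T) 0 0 == 0) = (v == 0).
Proof.
apply/eqP/eqP => [|->]; last by rewrite mul0mx mxE.
rewrite mxE => /eqP; rewrite psumr_eq0; last first.
  by move=> i _; rewrite mxE -expr2 sqr_ge0.
move=> /allP h; apply/rowP => i; have := h i (mem_index_enum i).
by rewrite !mxE mulf_eq0 orbb => /eqP.
Qed.

Lemma gram_unitmx m n (J : 'M[R]_(m, n)) : row_free J -> J *m J^T \in unitmx.
Proof.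
move=> Jf; rewrite -row_free_unit; apply: inj_row_free => v vJ.
have e : (v *m J) *m (v *m J)^T = 0 by rewrite trmx_mul mulmxA -(mulmxA v) vJ mul0mx.
have : ((v *m J) *m (v *m J)^T) 0 0 == 0 by rewrite e mxE.
by rewrite mulmx_tr_eq0 mulmx_free_eq0// => /eqP.
Qed.

(* The columns of J^T (J J^T)^-1 and n^T form a right inverse of the square
   matrix with rows J and n, hence also a left inverse. *)
Lemma tangent_normal_decomposition d (J : 'M[R]_(d, d.+1)) (n : 'rV[R]_d.+1) :
  row_free J -> J *m n^T = 0 -> n *m n^T = 1%:M ->
  J^T *m invmx (J *m J^T) *m J + n^T *m n = 1%:M.
Proof.
move=> Jf Jn nn; have Gu := gram_unitmx Jf.
set S := J^T *m invmx (J *m J^T).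
have nJ : n *m J^T = 0 by rewrite -[LHS]trmxK trmx_mul trmxK Jn trmx0.
have JS : J *m S = 1%:M by rewrite /S mulmxA mulmxV.
have nS : n *m S = 0 by rewrite /S mulmxA nJ mul0mx.
have E : col_mx J n *m row_mx S n^T = 1%:M.
  by rewrite mul_col_row JS nS Jn nn [RHS]scalar_mx_block.
have free : row_free (col_mx J n) by apply/row_freeP; exists (row_mx S n^T).
have full : row_full (col_mx J n) by rewrite /row_full (eqP free) addn1.
apply: (row_full_inj full); rewrite mulmx1 mulmxDr !mulmxA !mul_col_mx.
by rewrite mulmxV// nJ !mul0mx mul1mx Jn nn mul0mx mul1mx add_col_mx addr0 add0r.
Qed.

(** By cyclicity the trace is the sum of the form of [F] over the rows of [W]. With a factorization
    of the coefficient matrix this gives the sign of the second-order term at a minimum. *)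
Lemma psd_trace m n (W : 'M[R]_(m, n)) (F : 'M[R]_n) :
  (forall xi : 'rV[R]_n, 0 <= (xi *m F *m xi^T) 0 0) ->
  0 <= \tr (W^T *m W *m F).
Proof.
move=> hF; rewrite -mulmxA mxtrace_mulC; apply: sumr_ge0 => k _.
suff -> : (W *m F *m W^T) k k = (row k W *m F *m (row k W)^T) 0 0 by exact: hF.
by rewrite -row_mul tr_row !mxE; apply: eq_bigr => j _; rewrite !mxE.
Qed.

(** Induction through the Schur complement [B] of the upper left entry; no spectral theorem is
    involved. *)
Lemma cholesky n (A : 'M[R]_n) : A^T = A -> posdef A ->
  exists W : 'M[R]_n, A = W^T *m W.
Proof.
elim: n A => [|n IH] A sA pA; first by exists 0; apply/matrixP => -[].
pose a := A 0 0; pose b := ursubmx (A : 'M[R]_(1 + n)); pose D := drsubmx (A : 'M[R]_(1 + n)).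
have bE : dlsubmx (A : 'M[R]_(1 + n)) = b^T by rewrite /b trmx_ursub sA.
have AE : (A : 'M[R]_(1 + n)) = block_mx a%:M b b^T D.
  rewrite -[LHS](@submxK _ 1 n 1 n) bE; congr block_mx.
  by apply/matrixP => i j; rewrite !mxE !ord1 eqxx mulr1n; congr (A _ _); exact: val_inj.
have DT : D^T = D by rewrite /D trmx_drsub sA.
have a0 : 0 < a.
  have d0 : delta_mx 0 0 != 0 :> 'rV[R]_n.+1.
    by apply/eqP => /matrixP/(_ 0 0)/eqP; rewrite !mxE eqxx oner_eq0.
  by have := pA _ d0; rewrite /dot -rowE trmx_delta -colE !mxE.
pose B := D - a^-1 *: (b^T *m b).
have sB : B^T = B by rewrite /B linearB linearZ /= trmx_mul trmxK DT.
have pB : posdef B.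
  (* This first coordinate completes the square: the form of [A] at [row_mx x0 xi] is the form of
     [B] at [xi]. *)
  move=> xi xi0; pose x0 : 'M[R]_1 := - a^-1 *: (xi *m b^T).
  have Q : row_mx x0 xi *m block_mx a%:M b b^T D *m (row_mx x0 xi)^T = xi *m B *m xi^T.
    rewrite mul_row_block tr_row_mx mul_row_col.
    have -> : x0 *m a%:M + xi *m b^T = 0.
      by rewrite mul_mx_scalar /x0 scalerA mulrN mulfV ?gt_eqF// scaleN1r addNr.
    have -> : x0 *m b + xi *m D = xi *m B.
      by rewrite /B mulmxBr -scalemxAr mulmxA /x0 -scalemxAl scaleNr addrC.
    by rewrite mul0mx add0r.
  rewrite /dot -Q -AE; apply: (pA (row_mx x0 xi)).
  apply: contra_neq xi0 => e.
  by rewrite -[xi](@row_mxKr _ _ 1 _ x0) [X in rsubmx X]e linear0.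
have [W' BE] := IH B sB pB.
pose s := Num.sqrt a.
have ss : s * s = a by rewrite -expr2 sqr_sqrtr// ltW.
have s0 : s != 0 by rewrite gt_eqF// sqrtr_gt0.
exists (block_mx s%:M (s^-1 *: b) 0 W' : 'M[R]_(1 + n)).
suff -> : A = (block_mx s%:M (s^-1 *: b) 0 W')^T *m block_mx s%:M (s^-1 *: b) 0 W' :> 'M[R]_(1 + n) by [].
rewrite AE tr_block_mx mulmx_block trmx0 !mul0mx !mulmx0 !addr0 tr_scalar_mx.
congr block_mx.
- by rewrite -scalar_mxM ss.
- by rewrite mul_scalar_mx scalerA mulfV// scale1r.
- by rewrite linearZ /= mul_mx_scalar scalerA mulfV// scale1r.
- rewrite -BE -scalemxAr [(_ *: b)^T]linearZ /= -scalemxAl scalerA /B -invfM ss.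
  by rewrite addrC subrK.
Qed.

End LinearAlgebra.

(** * Limits of difference quotients *)

Section DifferenceQuotients.
Context {R : realType} {P : Type} (F : set_system P) {FF : Filter F} (c : P -> R).

(* l is the derivative along F of a function tending to a; c x is the inverse of
   the increment of the parameter. *)
Definition has_dq (f : P -> R) (a l : R) : Prop :=
  f x @[x --> F] --> a /\ c x * (f x - a) @[x --> F] --> l.

Lemma has_dq_near f g a l : (\forall x \near F, f x = g x) ->
  has_dq f a l -> has_dq g a l.
Proof.
move=> fg [fa fl]; split; first by apply: cvg_trans fa; apply: near_eq_cvg.
by apply: cvg_trans fl; apply: near_eq_cvg; apply: filterS fg => x ->.
Qed.

Lemma dqD f g a b l k : has_dq f a l -> has_dq g b k ->
  has_dq (fun x => f x + g x) (a + b) (l + k).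
Proof.
move=> [fa fl] [gb gk]; split; first exact: cvgD.
have -> : (fun x => c x * (f x + g x - (a + b))) = (fun x => c x * (f x - a) + c x * (g x - b)).
  by apply/funext => x; ring.
exact: cvgD.
Qed.

Lemma dqM f g a b l k : has_dq f a l -> has_dq g b k ->
  has_dq (fun x => f x * g x) (a * b) (l * b + a * k).
Proof.
move=> [fa fl] [gb gk]; split; first exact: cvgM.
have -> : (fun x => c x * (f x * g x - a * b)) =
    (fun x => c x * (f x - a) * g x + a * (c x * (g x - b))).
  by apply/funext => x; ring.
by apply: cvgD; apply: cvgM => //; exact: cvg_cst.
Qed.

Lemma dqN f a l : has_dq f a l -> has_dq (fun x => - f x) (- a) (- l).
Proof.
move=> [fa fl]; split; first exact: cvgN.
have -> : (fun x => c x * (- f x - - a)) = (fun x => - (c x * (f x - a))).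
  by apply/funext => x; ring.
exact: cvgN.
Qed.

Lemma dq_sum (I : Type) (r : seq I) (f : I -> P -> R) (a l : I -> R) :
  (forall i, has_dq (f i) (a i) (l i)) ->
  has_dq (fun x => \sum_(i <- r) f i x) (\sum_(i <- r) a i) (\sum_(i <- r) l i).
Proof.
move=> H; split; first by apply: cvgr_sum => i _; have [] := H i.
have -> : (fun x => c x * (\sum_(i <- r) f i x - \sum_(i <- r) a i)) =
    (fun x => \sum_(i <- r) c x * (f i x - a i)).
  by apply/funext => x; rewrite -sumrB mulr_sumr.
by apply: cvgr_sum => i _; have [] := H i.
Qed.

Definition mcvg m n (f : P -> 'M[R]_(m, n)) (A : 'M[R]_(m, n)) : Prop :=
  forall i j, f x i j @[x --> F] --> A i j.

Definition mdq m n (f : P -> 'M[R]_(m, n)) (A L : 'M[R]_(m, n)) : Prop :=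
  forall i j, has_dq (fun x => f x i j) (A i j) (L i j).

Lemma mdq_cvg m n (f : P -> 'M[R]_(m, n)) A L : mdq f A L -> mcvg f A.
Proof. by move=> H i j; have [] := H i j. Qed.

Lemma mcvg_mul m n p (f : P -> 'M[R]_(m, n)) (g : P -> 'M[R]_(n, p)) A B :
  mcvg f A -> mcvg g B -> mcvg (fun x => f x *m g x) (A *m B).
Proof.
move=> fA gB i j; under eq_cvg do rewrite mxE.
by rewrite mxE; apply: cvgr_sum => k _; apply: cvgM; [exact: fA|exact: gB].
Qed.

Lemma mcvg_tr m n (f : P -> 'M[R]_(m, n)) A :
  mcvg f A -> mcvg (fun x => (f x)^T) A^T.
Proof. by move=> fA i j; under eq_cvg do rewrite mxE; rewrite mxE; exact: fA. Qed.

Lemma mcvgD m n (f g : P -> 'M[R]_(m, n)) A B :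
  mcvg f A -> mcvg g B -> mcvg (fun x => f x + g x) (A + B).
Proof.
move=> fA gB i j; under eq_cvg do rewrite mxE.
by rewrite mxE; apply: cvgD; [exact: fA|exact: gB].
Qed.

Lemma mcvg_cst m n (A : 'M[R]_(m, n)) : mcvg (fun _ => A) A.
Proof. by move=> i j; exact: cvg_cst. Qed.

Lemma mcvgN m n (f : P -> 'M[R]_(m, n)) A :
  mcvg f A -> mcvg (fun x => - f x) (- A).
Proof. by move=> fA i j; under eq_cvg do rewrite mxE; rewrite mxE; apply: cvgN; exact: fA. Qed.

Lemma mdq_tr m n (f : P -> 'M[R]_(m, n)) A L :
  mdq f A L -> mdq (fun x => (f x)^T) A^T L^T.
Proof.
move=> H i j; rewrite !mxE; have -> : (fun x => (f x)^T i j) = (fun x => f x j i).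
  by apply/funext => x; rewrite mxE.
exact: H.
Qed.

Lemma mdqM m n p (f : P -> 'M[R]_(m, n)) (g : P -> 'M[R]_(n, p)) A B L K :
  mdq f A L -> mdq g B K ->
  mdq (fun x => f x *m g x) (A *m B) (L *m B + A *m K).
Proof.
move=> fA gB i j; rewrite !mxE -big_split.
have -> : (fun x => (f x *m g x) i j) = (fun x => \sum_k f x i k * g x k j).
  by apply/funext => x; rewrite mxE.
by apply: dq_sum => k; apply: dqM; [exact: fA|exact: gB].
Qed.

Lemma dq_trace n (f : P -> 'M[R]_n) A L :
  mdq f A L -> has_dq (fun x => \tr (f x)) (\tr A) (\tr L).
Proof. by move=> H; apply: dq_sum => i; exact: H. Qed.

Lemma cvg_det n (f : P -> 'M[R]_n) A : mcvg f A -> \det (f x) @[x --> F] --> \det A.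
Proof.
move=> fA; apply: cvgr_sum => s _; apply: cvgM; first exact: cvg_cst.
by apply: cvgr_prod => i _; exact: fA.
Qed.

Lemma mcvg_adj n (f : P -> 'M[R]_n) A :
  mcvg f A -> mcvg (fun x => \adj (f x)) (\adj A).
Proof.
move=> fA i j; under eq_cvg do rewrite mxE.
rewrite mxE; apply: cvgM; first exact: cvg_cst.
apply: cvg_det => k l; under eq_cvg do rewrite !mxE.
by rewrite !mxE; exact: fA.
Qed.

Lemma near_unitmx n (f : P -> 'M[R]_n) A : mcvg f A -> A \in unitmx ->
  \forall x \near F, f x \in unitmx.
Proof.
move=> /cvg_det fA; rewrite unitmxE unitfE => A0.
by apply: filterS (cvgr_neq0 _ fA A0) => x; rewrite unitmxE unitfE.
Qed.

(** Cramer's rule: adjugate and determinant are polynomials in the entries, and the determinant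
    stays nonzero near the limit. *)
Lemma mcvg_inv n (f : P -> 'M[R]_n) A : mcvg f A -> A \in unitmx ->
  mcvg (fun x => invmx (f x)) (invmx A).
Proof.
move=> fA Au i j.
have H : (\det (f x))^-1 * \adj (f x) i j @[x --> F] --> invmx A i j.
  rewrite /invmx Au mxE; apply: cvgM; last exact: mcvg_adj.
  by apply: cvgV; [move: Au; rewrite unitmxE unitfE|exact: cvg_det].
apply: cvg_trans H; apply: near_eq_cvg.
by apply: filterS (near_unitmx fA Au) => x xu; rewrite /invmx xu [RHS]mxE.
Qed.

(** The difference of two inverses is [- X^-1 (X - A) A^-1] for [X = f x], so its quotient is a
    product of convergent factors. *)
Lemma mdq_inv n (f : P -> 'M[R]_n) A L : mdq f A L -> A \in unitmx ->
  mdq (fun x => invmx (f x)) (invmx A) (- (invmx A *m L *m invmx A)).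
Proof.
move=> fA Au i j; have fc := mdq_cvg fA; split; first exact: mcvg_inv.
have H : mcvg (fun x => - (invmx (f x) *m (c x *: (f x - A)) *m invmx A))
    (- (invmx A *m L *m invmx A)).
  apply/mcvgN/mcvg_mul; last exact: mcvg_cst.
  apply: mcvg_mul; first exact: mcvg_inv.
  by move=> k l; under eq_cvg do rewrite !mxE; have [] := fA k l.
apply: cvg_trans (H i j); apply: near_eq_cvg.
apply: filterS (near_unitmx fc Au) => x xu.
rewrite -scalemxAr -scalemxAl mulmxBr mulVmx// mulmxBl mul1mx.
by rewrite -(mulmxA (invmx (f x))) mulmxV// mulmx1 -scalerN opprB !mxE.
Qed.

(* Differentiating J n^T = 0 gives the tangential part of n'; the normal part
   vanishes because n is a unit vector. *)
Lemma mdq_normal d (J : P -> 'M[R]_(d, d.+1)) (n : P -> 'rV[R]_d.+1) A nu L :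
  mdq J A L -> mcvg n nu -> row_free A ->
  A *m nu^T = 0 -> nu *m nu^T = 1%:M ->
  (\forall x \near F, J x *m (n x)^T = 0 /\ n x *m (n x)^T = 1%:M) ->
  mdq n nu (- (nu *m L^T *m invmx (A *m A^T) *m A)).
Proof.
move=> JA nnu Af Anu nunu near_n.
set S := A^T *m invmx (A *m A^T).
have dec : S *m A + nu^T *m nu = 1%:M := tangent_normal_decomposition Af Anu nunu.
pose dl x := n x - nu.
(* This is [1 - n x . nu]; with the tangential part [ta] the increment is [ta - a nu]. *)
pose a x := - (dl x *m nu^T) 0 0.
pose ta x := dl x *m S *m A.
have dlE x : dl x = ta x - a x *: nu.
  rewrite -[LHS]mulmx1 -dec mulmxDr; congr (_ + _); rewrite mulmxA//.
  by rewrite [dl x *m nu^T]mx11_scalar mul_scalar_mx /a scaleNr opprK.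
have dl0 : mcvg dl 0.
  by have := mcvgD nnu (@mcvg_cst _ _ (- nu)); rewrite subrr.
have a0 : a x @[x --> F] --> (0 : R).
  have /(_ 0 0) := mcvgN (mcvg_mul dl0 (@mcvg_cst _ _ nu^T)); rewrite mul0mx mxE mxE oppr0.
  by under eq_cvg do rewrite mxE.
have ta0 : mcvg ta 0.
  have := mcvg_mul (mcvg_mul dl0 (@mcvg_cst _ _ S)) (@mcvg_cst _ _ A).
  by rewrite !mul0mx.
(* Since [n x] is orthogonal to [J x] and [nu] to [A], the tangential components of the increment of
   the normal are minus those of [n x] against the increment of [J]. *)
have cta : mcvg (fun x => c x *: ta x) (- (nu *m L^T *m invmx (A *m A^T) *m A)).
  have H : mcvg (fun x => - (n x *m (c x *: (J x - A))^T *m invmx (A *m A^T) *m A))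
      (- (nu *m L^T *m invmx (A *m A^T) *m A)).
    apply/mcvgN/mcvg_mul; last exact: mcvg_cst.
    apply: mcvg_mul; last exact: mcvg_cst.
    apply: mcvg_mul => //; apply: mcvg_tr => k l; under eq_cvg do rewrite !mxE.
    by have [] := JA k l.
  move=> i j; apply: cvg_trans (H i j); apply: near_eq_cvg.
  apply: filterS near_n => x [Jn nn].
  have nJ : n x *m (J x)^T = 0 by rewrite -[LHS]trmxK trmx_mul trmxK Jn trmx0.
  have nuA : nu *m A^T = 0 by rewrite -[LHS]trmxK trmx_mul trmxK Anu trmx0.
  rewrite [(_ *: _)^T]linearZ /= [(_ - _)^T]linearB /= -scalemxAr mulmxBr nJ sub0r.
  rewrite /ta /dl /S mulmxA mulmxBl nuA subr0 scalerN !mulNmx opprK.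
  by rewrite -!scalemxAl.
(* The normal part is of second order. Both vectors being unit gives [|dl|^2 = 2 a], and
   orthogonality gives [|dl|^2 = |ta|^2 + a^2]; hence [a = |ta|^2 / (2 - a)], and [c |ta|^2] tends
   to 0. *)
have ca : c x * a x @[x --> F] --> (0 : R).
  have H : ((c x *: ta x) *m (ta x)^T) 0 0 * (2 - a x)^-1 @[x --> F] --> (0 : R).
    rewrite -[X in _ --> X](mul0r ((2 - 0)^-1)); apply: cvgM.
      by have /(_ 0 0) := mcvg_mul cta (mcvg_tr ta0); rewrite trmx0 mulmx0 mxE.
    apply: cvgV; first by rewrite subr0 pnatr_eq0.
    by apply: cvgB => //; exact: cvg_cst.
  apply: cvg_trans H; apply: near_eq_cvg.
  have a1 : \forall x \near F, a x < 1 by exact: cvgr_lt a0 _ ltr01.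
  apply: filterS2 near_n a1 => x [Jn nn] ax.
  have a2 : 2 - a x != 0 by rewrite gt_eqF// subr_gt0 (lt_trans ax)// ltr1n.
  have E1 : (dl x *m (dl x)^T) 0 0 = 2 * a x.
    have : (nu + dl x) *m (nu + dl x)^T = 1%:M by rewrite /dl addrC subrK.
    rewrite /a; move: (dl x) => D /(congr1 (fun M : 'M[R]_1 => M 0 0)).
    rewrite [(_ + _)^T]linearD /= mulmxDr !mulmxDl nunu.
    have -> : nu *m D^T = D *m nu^T.
      have tr11 (M : 'M[R]_1) : M^T = M by apply/matrixP => i j; rewrite mxE !ord1.
      by rewrite -[RHS]tr11 trmx_mul trmxK.
    have ad (M N : 'M[R]_1) : (M + N) 0 0 = M 0 0 + N 0 0 by rewrite mxE.
    have one1 : (1%:M : 'M[R]_1) 0 0 = 1 by rewrite mxE eqxx.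
    rewrite !ad one1.
    by move: ((D *m nu^T) 0 0) ((D *m D^T) 0 0) => p q e; lra.
  have tn : ta x *m nu^T = 0 by rewrite /ta -mulmxA Anu mulmx0.
  have E2 : (ta x *m (ta x)^T) 0 0 = a x * (2 - a x).
    have : (dl x *m (dl x)^T) 0 0 = (ta x *m (ta x)^T) 0 0 + a x * a x.
      rewrite {1 2}dlE [(_ - _)^T]linearB /= [(_ *: nu)^T]linearZ /= mulmxBr !mulmxBl.
      rewrite -!scalemxAr -!scalemxAl tn nunu.
      have -> : nu *m (ta x)^T = 0 by rewrite -[LHS]trmxK trmx_mul trmxK tn trmx0.
      by rewrite !scaler0 subr0 sub0r opprK !mxE eqxx mulr1.
    by rewrite E1 => e; lra.
  by rewrite -scalemxAl mxE E2 mulrA mulfK.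
move=> i j; split; first exact: nnu.
have H : c x * ta x i j - c x * a x * nu i j @[x --> F] -->
    (- (nu *m L^T *m invmx (A *m A^T) *m A)) i j - 0 * nu i j.
  apply: cvgB; last by apply: cvgM => //; exact: cvg_cst.
  by have := cta i j; under eq_cvg do rewrite mxE.
move: H; rewrite mul0r subr0.
have -> : (fun x => c x * ta x i j - c x * a x * nu i j) = (fun x => c x * (n x i j - nu i j)).
  apply/funext => x; have := dlE x => /matrixP/(_ i j); rewrite !mxE => ->; ring.
by [].
Qed.

End DifferenceQuotients.

(** * Smooth families of matrices *)

Section MatrixSmooth.
Variables (R : realType) (d : nat) (U : set 'rV[R]_d).
Hypothesis oU : open U.
Notation Rd := 'rV[R]_d.
Notation e_ i := (delta_mx 0 i : Rd).

Definition mjC k m n (F : R -> Rd -> 'M[R]_(m, n)) : Prop :=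
  forall i j, jC k U (fun t u => F t u i j).

Definition mpd m n (k : 'I_d) (F : Rd -> 'M[R]_(m, n)) (u : Rd) : 'M[R]_(m, n) :=
  \matrix_(i, j) pd k (fun v => F v i j) u.

Lemma mjCW k m n (F : R -> Rd -> 'M[R]_(m, n)) : mjC k.+1 F -> mjC k F.
Proof. by move=> H i j; apply: jCW; exact: H. Qed.

Lemma mjC_le k l m n (F : R -> Rd -> 'M[R]_(m, n)) : (l <= k)%N -> mjC k F -> mjC l F.
Proof. by move=> lk H i j; apply: (jC_le lk); exact: H. Qed.

Lemma mjC_mpd k m n (F : R -> Rd -> 'M[R]_(m, n)) l :
  mjC k.+1 F -> mjC k (fun t => mpd l (F t)).
Proof.
move=> H i j; apply: jC_ext (jC_pd l (H i j)) => // t u Uu.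
by rewrite mxE.
Qed.

Lemma mjC_mul k m n p (F : R -> Rd -> 'M[R]_(m, n)) (G : R -> Rd -> 'M[R]_(n, p)) :
  mjC k F -> mjC k G -> mjC k (fun t u => F t u *m G t u).
Proof.
move=> jF jG i j.
apply: (@jC_ext _ _ _ _ _ (fun t u => \sum_l F t u i l * G t u l j)) => //.
  by move=> t u _; rewrite mxE.
by apply: (jC_sum oU) => l; exact: (jC_M oU (jF i l) (jG l j)).
Qed.

Lemma mjC_tr k m n (F : R -> Rd -> 'M[R]_(m, n)) :
  mjC k F -> mjC k (fun t u => (F t u)^T).
Proof.
by move=> jF i j; apply: jC_ext (jF j i) => // t u _; rewrite mxE.
Qed.

Lemma mjC_N k m n (F : R -> Rd -> 'M[R]_(m, n)) :
  mjC k F -> mjC k (fun t u => - F t u).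
Proof.
by move=> jF i j; apply: jC_ext (jC_N oU (jF i j)) => // t u _; rewrite mxE.
Qed.

Lemma mjC_D k m n (F G : R -> Rd -> 'M[R]_(m, n)) :
  mjC k F -> mjC k G -> mjC k (fun t u => F t u + G t u).
Proof.
by move=> jF jG i j; apply: jC_ext (jC_D oU (jF i j) (jG i j)) => // t u _; rewrite mxE.
Qed.

Lemma jC_trace k n (F : R -> Rd -> 'M[R]_n) : mjC k F -> jC k U (fun t u => \tr (F t u)).
Proof. by move=> jF; apply: (jC_sum oU) => i; exact: jF. Qed.

Lemma cvg_line (k : 'I_d) (u : Rd) : (fun h : R => h *: e_ k + u) @ (0 : R) --> u.
Proof.
have : (fun h : R => h *: e_ k + u) @ (0 : R) --> (0 : R) *: e_ k + u.
  by apply: cvgD; [apply: cvgZr_tmp; exact: cvg_id|exact: cvg_cst].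
by rewrite scale0r add0r.
Qed.

Lemma cvg_along_line (f : Rd -> R) (k : 'I_d) (u : Rd) : {for u, continuous f} ->
  f (h *: e_ k + u) @[h --> (0 : R)^'] --> f u.
Proof.
move=> cf; apply: (@cvg_within_filter _ _ _ (nbhs (0 : R))).
apply: (@cvg_comp _ _ _ (fun h : R => h *: e_ k + u) f _ (nbhs u)) cf. exact: cvg_line.
Qed.

Lemma pd_dq (f : Rd -> R) (i : 'I_d) (u : Rd) : derivable f u (e_ i) ->
  {for u, continuous f} ->
  has_dq (0 : R)^' (fun h : R => h^-1) (fun h : R => f (h *: e_ i + u)) (f u) (pd i f u).
Proof.
move=> df cf; split; last exact: df.
exact: cvg_along_line.
Qed.

Lemma dq_pd (f : Rd -> R) (i : 'I_d) (u : Rd) l :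
  has_dq (0 : R)^' (fun h : R => h^-1) (fun h : R => f (h *: e_ i + u)) (f u) l ->
  derivable f u (e_ i) /\ pd i f u = l.
Proof.
move=> [_ fl]; split; first by apply/cvg_ex; exists l.
exact: cvg_lim fl.
Qed.

Lemma mpd_dq m n (F : Rd -> 'M[R]_(m, n)) (k : 'I_d) (u : Rd) :
  (forall i j, derivable (fun v => F v i j) u (e_ k)) ->
  (forall i j, {for u, continuous (fun v => F v i j)}) ->
  mdq (0 : R)^' (fun h : R => h^-1) (fun h : R => F (h *: e_ k + u)) (F u) (mpd k F u).
Proof. by move=> dF cF i j; rewrite mxE; exact: pd_dq. Qed.

Lemma mjC_dq m n (F : R -> Rd -> 'M[R]_(m, n)) t (k : 'I_d) (u : Rd) :
  mjC 1 F -> U u ->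
  mdq (0 : R)^' (fun h : R => h^-1) (fun h : R => F t (h *: e_ k + u)) (F t u) (mpd k (F t) u).
Proof.
move=> jF Uu; apply: mpd_dq => i j.
  exact: jC_derivable (jF i j) Uu.
exact: jcont_at (jC_cont (jF i j)) Uu.
Qed.

Lemma dq_mpd m n (F : Rd -> 'M[R]_(m, n)) (k : 'I_d) (u : Rd) L :
  mdq (0 : R)^' (fun h : R => h^-1) (fun h : R => F (h *: e_ k + u)) (F u) L ->
  (forall i j, derivable (fun v => F v i j) u (e_ k)) /\ mpd k F u = L.
Proof.
move=> H; split=> [i j|]; first by have [] := @dq_pd (fun v => F v i j) k u _ (H i j).
by apply/matrixP => i j; rewrite mxE; have [] := @dq_pd (fun v => F v i j) k u _ (H i j).
Qed.

Lemma mpdM m n p (F : R -> Rd -> 'M[R]_(m, n)) (G : R -> Rd -> 'M[R]_(n, p)) t (k : 'I_d) (u : Rd) :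
  mjC 1 F -> mjC 1 G -> U u ->
  mpd k (fun v => F t v *m G t v) u = mpd k (F t) u *m G t u + F t u *m mpd k (G t) u.
Proof. by move=> jF jG Uu; have [] := @dq_mpd _ _ (fun v => F t v *m G t v) k u _
  (mdqM (mjC_dq t k jF Uu) (mjC_dq t k jG Uu)). Qed.

Lemma mpd_tr m n (F : Rd -> 'M[R]_(m, n)) (k : 'I_d) (u : Rd) :
  mpd k (fun v => (F v)^T) u = (mpd k F u)^T.
Proof.
apply/matrixP => i j; rewrite !mxE; congr (pd k _ u).
by apply/funext => v; rewrite mxE.
Qed.

Lemma mpd_eq_on m n (F G : Rd -> 'M[R]_(m, n)) (k : 'I_d) (u : Rd) : U u ->
  (forall v, U v -> F v = G v) -> mpd k F u = mpd k G u.
Proof.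
move=> Uu FG; apply/matrixP => i j; rewrite !mxE; apply: (pd_eq_on _ oU Uu).
by move=> v /FG ->.
Qed.

Lemma near_line (k : 'I_d) (u : Rd) : U u -> \forall h \near (0 : R)^', U (h *: e_ k + u).
Proof.
move=> Uu.
have H : (fun h : R => h *: e_ k + u) @ (0 : R)^' --> u.
  by apply: (@cvg_within_filter _ _ _ (nbhs (0 : R))); exact: cvg_line.
exact: (H U (open_nbhs_nbhs (conj oU Uu))).
Qed.

(** Bootstrapping: the derivative of the inverse is a product of the inverse itself and the
    derivative of [G], so each class known for the inverse yields the next one. *)
Lemma mjC_inv k n (G : R -> Rd -> 'M[R]_n) :
  mjC k G -> (forall t u, U u -> G t u \in unitmx) ->
  mjC k (fun t u => invmx (G t u)).
Proof.
move=> jG Gu; elim: k jG => [|k IH] jG.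
  move=> i j; split=> // t u Uu.
  apply: (@mcvg_inv _ _ (nbhs (t, u)) _ _ (fun x : R * Rd => G x.1 x.2) (G t u)); last exact: Gu.
  by move=> a b; exact: (jC_cont (jG a b)).
have jI := IH (mjCW jG).
have jG1 : mjC 1 G by exact: mjC_le jG.
have dG t u (l : 'I_d) : U u -> (forall i j, derivable (fun v => invmx (G t v) i j) u (e_ l)) /\
    mpd l (fun v => invmx (G t v)) u = - (invmx (G t u) *m mpd l (G t) u *m invmx (G t u)).
  by move=> Uu; apply: dq_mpd; apply: mdq_inv; [exact: mjC_dq|exact: Gu].
move=> i j; split; first exact: jC_cont (jI i j).
move=> l; split=> [t u Uu|]; first exact: (dG t u l Uu).1.
have H : mjC k (fun t u => - (invmx (G t u) *m mpd l (G t) u *m invmx (G t u))).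
  by apply/mjC_N/mjC_mul => //; apply: mjC_mul => //; exact: mjC_mpd.
apply: jC_ext (H i j) => // t u Uu.
by rewrite -(dG t u l Uu).2 mxE.
Qed.

Section Normal.
Variables (J : R -> Rd -> 'M[R]_(d, d.+1)) (n : R -> Rd -> 'rV[R]_d.+1).
Hypothesis Jf : forall t u, U u -> row_free (J t u).
Hypothesis Jn : forall t u, U u -> J t u *m (n t u)^T = 0.
Hypothesis nn : forall t u, U u -> n t u *m (n t u)^T = 1%:M.

Lemma mpd_normal t u (l : 'I_d) : mjC 1 J -> mjC 0 n -> U u ->
  (forall i j, derivable (fun v => n t v i j) u (e_ l)) /\
  mpd l (n t) u = - (n t u *m (mpd l (J t) u)^T *m invmx (J t u *m (J t u)^T) *m J t u).
Proof.
move=> jJ jn Uu; apply: dq_mpd; apply: (mdq_normal (J := fun h => J t (h *: e_ l + u))).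
- exact: mjC_dq.
- move=> i j; apply: (@cvg_along_line (fun v => n t v i j)).
  exact: jcont_at (jC_cont (jn i j)) Uu.
- exact: Jf.
- exact: Jn.
- exact: nn.
- by apply: filterS (near_line l Uu) => h Uh; split; [exact: Jn|exact: nn].
Qed.

(** The same bootstrapping: derivatives of [n] are expressed by [n], [J] and first derivatives of
    [J]. A normal assumed merely continuous thus becomes as regular as the tangent vectors. *)
Lemma mjC_normal k : mjC k J -> mjC 0 n -> mjC k n.
Proof.
move=> + jn; elim: k => [//|k IH] jJ.
have jnk := IH (mjCW jJ).
have jJ1 : mjC 1 J by exact: mjC_le jJ.
have jI : mjC k (fun t u => invmx (J t u *m (J t u)^T)).
  apply: mjC_inv => [|t u Uu]; last by apply: gram_unitmx; exact: Jf.
  by apply: mjC_mul; [exact: mjCW|apply: mjC_tr; exact: mjCW].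
move=> i j; split; first exact: jC_cont (jnk i j).
move=> l; split=> [t u Uu|]; first exact: (mpd_normal t l jJ1 jn Uu).1.
have H : mjC k (fun t u => - (n t u *m (mpd l (J t) u)^T *m invmx (J t u *m (J t u)^T) *m J t u)).
  apply/mjC_N/mjC_mul; last exact: mjCW.
  apply: mjC_mul => //; apply: mjC_mul => //; apply: mjC_tr; exact: mjC_mpd.
apply: jC_ext (H i j) => // t u Uu.
by rewrite -(mpd_normal t l jJ1 jn Uu).2 mxE.
Qed.

End Normal.

End MatrixSmooth.

(** * Changes of charts *)

Section Transition.
Variables (R : realType) (d : nat).
Notation Rd := 'rV[R]_d.
Notation Rd1 := 'rV[R]_d.+1.
Notation e_ i := (delta_mx 0 i : Rd).

Lemma normr_le_mulmx_tr n (k : 'rV[R]_n) : `|k| ^+ 2 <= (k *m k^T) 0 0.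
Proof.
have H i : `|k 0 i| ^+ 2 <= (k *m k^T) 0 0.
  rewrite mxE (bigD1 i)//= mxE -expr2 real_normK ?num_real// lerDl.
  by apply: sumr_ge0 => j _; rewrite mxE -expr2 sqr_ge0.
have k0 : 0 <= (k *m k^T) 0 0 by exact: mulmx_tr_ge0.
rewrite -[leRHS]sqr_sqrtr// ler_pXn2r ?nnegrE ?sqrtr_ge0//.
apply: normr_mx_le; first exact: sqrtr_ge0.
by move=> i j; rewrite ord1 -[leLHS]ger0_norm// -sqrtr_sqr ler_wsqrtr.
Qed.

(** An exact product replaces the little-o expansion, so that inserting an increment not known in
    closed form only requires a product of limits. *)
Lemma caratheodory (g : Rd -> R) (u : Rd) : differentiable g u ->
  exists m : Rd -> Rd,
    (forall k, g (k + u) - g u = (k *m (m k)^T) 0 0) /\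
    mcvg (nbhs (0 : Rd)) m (\row_i pd i g u).
Proof.
move=> dg.
pose er k := g (k + u) - g u - \sum_i k 0 i * pd i g u.
have er_o : forall e : R, 0 < e -> \forall k \near (0 : Rd), `|er k| <= e * `|k|.
  move=> e e0; have /diff_locally /eqaddoP/(_ e e0) := dg.
  apply: filterS => k; congr (`|_| <= _).
  rewrite /er -diff_row// deriveE// opprD addrA; congr (_ - _).
(* The remainder is spread along [k] itself; at [k = 0] the added term is 0. *)
pose m (k : Rd) : Rd := \row_i (pd i g u + er k * k 0 i / (k *m k^T) 0 0).
exists m; split=> [k|].
  have mE i : m k 0 i = pd i g u + er k * k 0 i / (k *m k^T) 0 0 by rewrite /m mxE.
  rewrite mxE; under eq_bigr do rewrite [(m k)^T _ _]mxE mE mulrDr.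
  rewrite big_split /=.
  have -> : \sum_i k 0 i * (er k * k 0 i / (k *m k^T) 0 0) = er k.
    have [->|k0] := eqVneq k 0.
      rewrite big1; last by move=> i _; rewrite mxE mul0r.
      by rewrite /er add0r subrr sub0r big1 ?oppr0// => i _; rewrite mxE mul0r.
    have kk : (k *m k^T) 0 0 != 0 by rewrite mulmx_tr_eq0.
    have kkE : (k *m k^T) 0 0 = \sum_i k 0 i * k 0 i.
      by rewrite mxE; apply: eq_bigr => i _; rewrite mxE.
    move: kk; rewrite kkE => kk.
    transitivity (er k * (\sum_i k 0 i * k 0 i) / \sum_i k 0 i * k 0 i); last by rewrite mulfK.
    rewrite mulr_sumr mulr_suml; apply: eq_bigr => i _.
    by rewrite mulrA mulrCA mulrA.
  by rewrite /er addrC subrK.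
move=> a i; rewrite mxE; have -> : (fun k => m k a i) = (fun k => pd i g u + er k * k 0 i / (k *m k^T) 0 0).
  by apply/funext => k; rewrite mxE.
rewrite -[X in _ --> X]addr0; apply: cvgD; first exact: cvg_cst.
apply/cvgr0Pnorm_le => e e0; apply: filterS (er_o e e0) => k ek.
have [->|k0] := eqVneq k 0; first by rewrite !mxE mulr0 mul0r normr0 ltW.
have kk : 0 < (k *m k^T) 0 0 by rewrite lt_neqAle eq_sym mulmx_tr_eq0 k0 mulmx_tr_ge0.
rewrite normrM normfV (gtr0_norm kk) ler_pdivrMr// normrM.
apply: (@le_trans _ _ (e * `|k| * `|k|)).
  by apply: ler_pM => //; exact: normr_coord.
by rewrite -mulrA; apply: ler_wpM2l; [exact: ltW|exact: normr_le_mulmx_tr].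
Qed.

Lemma Ck_jC (W : normedModType R) k U (f : Rd -> W) : Ck k U f -> jC k U (fun _ => f).
Proof.
move=> [cf df]; apply: jC_pds => [s sk t u Uu|s i t u sk Uu]; last exact: df.
apply: (@continuous_comp _ _ _ (@snd R Rd) (pds s f)); first exact: cvg_snd.
exact: cf.
Qed.

Lemma Ck_le (W : normedModType R) k l U (f : Rd -> W) : (l <= k)%N -> Ck k U f -> Ck l U f.
Proof.
move=> lk [cf df]; split=> [s u sl Uu|s i u sl Uu].
  by apply: cf => //; exact: leq_trans lk.
by apply: df => //; exact: leq_trans lk.
Qed.

Lemma is_chart_le r l (M : set Rd1) U (phi : Rd -> Rd1) : (l <= r)%N ->
  is_chart r M U phi -> is_chart l M U phi.
Proof. by move=> lr [oU cphi Jphi inj op]; split => //; exact: Ck_le cphi. Qed.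

Lemma chart_image r (M : set Rd1) U (phi : Rd -> Rd1) u :
  is_chart r M U phi -> U u -> M (phi u).
Proof.
move=> [oU _ _ _ op] Uu; have [D _ e] := op U oU (fun _ => id).
by have [] : (M `&` D) (phi u) by rewrite -e; exists u.
Qed.

Lemma chart_coord r (M : set Rd1) U (phi : Rd -> Rd1) :
  is_chart r M U phi -> mjC U r (fun _ => phi).
Proof. by move=> [oU cphi _ _ _] i j; apply: jC_coord => //; exact: Ck_jC. Qed.

Lemma tangentsE n (psi : Rd -> 'rV[R]_n) u :
  (forall i j, derivable (fun v => psi v 0 j) u (e_ i)) ->
  tangents psi u = \matrix_(i, j) pd i (fun v => psi v 0 j) u.
Proof.
move=> dpsi; apply/matrixP => i j; rewrite !mxE /pd derive_mx ?mxE//.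
by apply/derivable_mxP => a b; rewrite ord1; exact: dpsi.
Qed.

(* The transition map need not be named: only the limit of its difference
   quotients is used. *)
Lemma chart_transition (M : set Rd1) U V (phi chi : Rd -> Rd1) u v :
  is_chart 1 M U phi -> U u -> is_chart 1 M V chi -> V v -> phi u = chi v ->
  exists2 L : 'M[R]_d, L \in unitmx & forall f : Rd1 -> R,
    differentiable (f \o chi) v -> forall i : 'I_d,
      derivable (f \o phi) u (e_ i) /\
      pd i (f \o phi) u = \sum_k L i k * pd k (f \o chi) v.
Proof.
move=> cphi Uu cchi Vv e.
have [oU Cphi Jphi iphi pphi] := cphi; have [oV Cchi Jchi ichi pchi] := cchi.
pose J := tangents chi v.
have dchi : forall j, differentiable (fun w => chi w 0 j) v.
  by move=> j; exact: (@jC_differentiable _ _ _ oV (fun _ w => chi w 0 j) 0 v (chart_coord cchi 0 j) Vv).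
have JE : J = \matrix_(i, j) pd i (fun w => chi w 0 j) v.
  by rewrite /J tangentsE// => i j; apply: diff_derivable; exact: dchi.
have /choice[m Hm] : forall j, exists m : Rd -> Rd,
    (forall k, chi (k + v) 0 j - chi v 0 j = (k *m (m k)^T) 0 0) /\
    mcvg (nbhs (0 : Rd)) m (\row_i pd i (fun w => chi w 0 j) v).
  by move=> j; have := caratheodory (dchi j).
(* The increment of [chi] is exactly [k *m Mm k], and [Mm] tends to the tangent matrix [J]. *)
pose Mm (k : Rd) : 'M[R]_(d, d.+1) := \matrix_(a, j) m j k 0 a.
have MmE k : chi (k + v) - chi v = k *m Mm k.
  apply/rowP => j; rewrite !mxE; have [h _] := Hm j; rewrite h mxE.
  by apply: eq_bigr => a _; rewrite !mxE.
have Mm0 : mcvg (nbhs (0 : Rd)) Mm J.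
  move=> a j; have [_ h] := Hm j; have := h 0 a; rewrite JE !mxE.
  by apply: cvg_trans; apply: near_eq_cvg; apply: nearW => k; rewrite mxE.
pose S := J^T *m invmx (J *m J^T).
pose L := tangents phi u *m S.
have Jfree : row_free J by exact: Jchi.
have dphi (i : 'I_d) j : derivable (fun w => phi w 0 j) u (e_ i).
  by apply: diff_derivable; exact: (@jC_differentiable _ _ _ oU (fun _ w => phi w 0 j) 0 u (chart_coord cphi 0 j) Uu).
have main (i : 'I_d) : exists k : R -> Rd,
   [/\ \forall h \near (0 : R)^', chi (k h + v) = phi (h *: e_ i + u),
     k @ (0 : R)^' --> (0 : Rd) & mcvg (0 : R)^' (fun h => h^-1 *: k h) (row i L)].
  (* [k h] is the increment of the transition map along direction [i]; the default [v] gives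
     increment 0 when the point is outside the image of [chi]. *)
  pose T (h : R) : set Rd := [set w | V w /\ chi w = phi (h *: e_ i + u)].
  pose k (h : R) : Rd := xget v (T h) - v.
  (* Openness of [chi] onto its image makes preimages exist for small [h] and forces them into any
     neighbourhood of [v]; injectivity identifies the chosen one. *)
  have Tk W : nbhs v W -> \forall h \near (0 : R)^', T h (k h + v) /\ W (k h + v).
    move=> nW; move: (nW); rewrite nbhsE => -[W' [oW' W'v] W'W].
    have [D oO eO] := pchi (W' `&` V) (openI oW' oV) (@subIsetr _ _ _).
    have Ophi : nbhs u (phi @^-1` D).
      have cphiu : {for u, continuous phi} by apply: (Cphi.1 [::]).
      apply: cphiu; apply: open_nbhs_nbhs; split => //.
      by have [] : (M `&` D) (phi u) by rewrite -eO e; exists v.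
    have nO : \forall h \near (0 : R)^', (phi @^-1` D) (h *: e_ i + u).
      have H : (fun h : R => h *: e_ i + u) @ (0 : R)^' --> u.
        by apply: (@cvg_within_filter _ _ _ (nbhs (0 : R))); exact: cvg_line.
      exact: (H _ Ophi).
    apply: filterS2 (near_line oU i Uu) nO => h Uh Oh.
    have : (M `&` D) (phi (h *: e_ i + u)) by split => //; exact: (chart_image cphi Uh).
    rewrite -eO => -[w [W'w Vw] ew].
    have Tw : T h w by [].
    have Tx : T h (xget v (T h)) by exact: (xgetPex v (ex_intro _ w Tw)).
    rewrite /k subrK; split => //; apply: W'W.
    by rewrite (ichi _ w _ _ (etrans Tx.2 (esym ew))) ?inE//; exact: Tx.1.
  have k0 : k @ (0 : R)^' --> (0 : Rd).
    have kv : (fun h => k h + v) @ (0 : R)^' --> v.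
      by move=> W nW; apply: filterS (Tk W nW) => h [].
    have kc : (fun _ : R => v) @ (0 : R)^' --> v by exact: cvg_cst.
    have kB : (fun h => k h + v - v) @ (0 : R)^' --> v - v by exact: cvgB.
    rewrite subrr in kB; apply: cvg_trans kB; apply: near_eq_cvg.
    by apply: nearW => h; rewrite addrK.
  have nk : \forall h \near (0 : R)^', chi (k h + v) = phi (h *: e_ i + u).
    by apply: filterS (Tk setT filterT) => h [[]].
  exists k; split => //.
  (* Since [phi] moves by [k *m Mm k], multiplying by the right inverse of [Mm k] recovers [k],
     hence the limit of its quotients. *)
  have GJ : mcvg (0 : R)^' (fun h => Mm (k h)) J.
    by move=> a j; exact: cvg_comp k0 (Mm0 a j).
  have Gu := gram_unitmx Jfree.
  have GG : mcvg (0 : R)^' (fun h => Mm (k h) *m (Mm (k h))^T) (J *m J^T).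
    by apply: mcvg_mul => //; exact: mcvg_tr.
  have H : mcvg (0 : R)^' (fun h => h^-1 *: (phi (h *: e_ i + u) - phi u) *m (Mm (k h))^T
       *m invmx (Mm (k h) *m (Mm (k h))^T)) (row i (tangents phi u) *m J^T *m invmx (J *m J^T)).
    apply: mcvg_mul; last exact: mcvg_inv.
    apply: mcvg_mul; last exact: mcvg_tr.
    move=> a j; rewrite ord1 tangentsE// !mxE.
    have : h^-1 * (phi (h *: e_ i + u) 0 j - phi u 0 j) @[h --> (0 : R)^'] -->
        pd i (fun w => phi w 0 j) u by exact: dphi.
    by apply: cvg_trans; apply: near_eq_cvg; apply: nearW => h; rewrite !mxE.
  have -> : row i L = row i (tangents phi u) *m J^T *m invmx (J *m J^T).
    by rewrite /L row_mul /S mulmxA.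
  move=> a j; apply: cvg_trans (H a j); apply: near_eq_cvg.
  apply: filterS2 nk (near_unitmx GG Gu) => h eh uh.
  rewrite -eh e MmE -!scalemxAl -!(mulmxA (k h)).
  by rewrite mulmxV// mulmx1.
have main2 : forall f : Rd1 -> R, differentiable (f \o chi) v -> forall i : 'I_d,
      derivable (f \o phi) u (e_ i) /\
      pd i (f \o phi) u = \sum_k L i k * pd k (f \o chi) v.
  move=> f df i; have [k [nk k0 kL]] := main i.
  have [mf [mfE mf0]] := caratheodory df.
  have H : mcvg (0 : R)^' (fun h => (h^-1 *: k h) *m (mf (k h))^T)
      (row i L *m (\row_i pd i (f \o chi) v)^T).
    apply: mcvg_mul => //; apply: mcvg_tr => a j; exact: cvg_comp k0 (mf0 a j).
  have {H} : h^-1 * ((f \o phi) (h *: e_ i + u) - (f \o phi) u) @[h --> (0 : R)^'] -->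
      \sum_k L i k * pd k (f \o chi) v.
    have <- : (row i L *m (\row_i pd i (f \o chi) v)^T) 0 0 = \sum_k L i k * pd k (f \o chi) v.
      by rewrite mxE; apply: eq_bigr => a _; rewrite !mxE.
    apply: cvg_trans (H 0 0); apply: near_eq_cvg; apply: filterS nk => h eh.
    by rewrite /= -eh e -[f (chi _)]/((f \o chi) (k h + v)) mfE -scalemxAl mxE.
  move=> H; split; first by apply/cvg_ex; eexists; exact: H.
  exact: cvg_lim H.
exists L => //.
(* Applied to the coordinate functions, the chain rule factors the tangents of [phi] through [L];
   their rank [d] forces [L] to be invertible. *)
have E : tangents phi u = L *m J.
  apply/matrixP => i j; rewrite tangentsE// JE !mxE.
  have [_ h] := main2 (fun p : Rd1 => p 0 j) (dchi j) i.
  by rewrite [LHS]h; apply: eq_bigr => a _; rewrite !mxE.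
have := Jphi u Uu; rewrite E -row_free_unit /row_free => /eqP r.
by rewrite eqn_leq rank_leq_row /= -{1}r mxrankM_maxl.
Qed.

End Transition.

(** * Chart independence of the surface gradient *)

Section SurfaceGradient.
Variables (R : realType) (d : nat).
Notation Rd := 'rV[R]_d.
Notation Rd1 := 'rV[R]_d.+1.
Notation e_ i := (delta_mx 0 i : Rd).

Definition jac n (F : Rd -> 'rV[R]_n) (u : Rd) : 'M[R]_(d, n) :=
  \matrix_(i, j) pd i (fun v => F v 0 j) u.

Definition grad (f : Rd -> R) (u : Rd) : Rd := \row_i pd i f u.

Lemma row_jac n (F : Rd -> 'rV[R]_n) u k : row k (jac F u) = mpd k F u.
Proof. by apply/rowP => j; rewrite !mxE. Qed.

Lemma tangents_jac n (psi : Rd -> 'rV[R]_n) u :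
  (forall j, differentiable (fun v => psi v 0 j) u) -> tangents psi u = jac psi u.
Proof. by move=> dpsi; apply: tangentsE => i j; apply: diff_derivable; exact: dpsi. Qed.

Lemma invmx_uniq n (A X : 'M[R]_n) : A *m X = 1%:M -> invmx A = X.
Proof.
by move=> e; have [Au _] := mulmx1_unit e; rewrite -[RHS](mulKmx Au) e mulmx1.
Qed.

(** As [surf_grad] chooses a vector valid in every chart, the formula of one chart must be shown to
    hold in all. Another chart replaces [J] by [L J] and the gradient by its product with [L^T]; the
    Gram matrix becomes [L (J J^T) L^T], whose inverse cancels both factors. *)
Lemma surf_gradE (M : set Rd1) (theta : Rd1 -> Rd1) (f : Rd1 -> R) V chi v :
  is_chart 1 M V chi -> V v -> immersion M theta ->
  (forall j, differentiable (fun w => theta (chi w) 0 j) v) ->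
  differentiable (f \o chi) v ->
  surf_grad M theta f (chi v) =
  grad (f \o chi) v *m invmx (jac (theta \o chi) v *m (jac (theta \o chi) v)^T)
    *m jac (theta \o chi) v.
Proof.
move=> cchi Vv imm dth df.
pose J := jac (theta \o chi) v.
have Jfree : row_free J by rewrite /J -tangents_jac; [exact: imm cchi Vv|exact: dth].
have Gu := gram_unitmx Jfree.
pose g := grad (f \o chi) v *m invmx (J *m J^T) *m J.
have Hg : chart_grad (theta \o chi) (f \o chi) v = g.
  by rewrite /chart_grad tangents_jac.
rewrite /surf_grad; case: xgetP => [y -> /(_ V chi v cchi Vv erefl)|/(_ g)[]].
  by rewrite Hg.
move=> U phi u cphi Uu e.
have [L Lu HL] := chart_transition cphi Uu cchi Vv e.
have dJ i j : derivable (fun w => theta (phi w) 0 j) u (e_ i).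
  exact: (HL (fun p => theta p 0 j) (dth j) i).1.
have EJ : tangents (theta \o phi) u = L *m J.
  apply/matrixP => i j; rewrite tangentsE// !mxE.
  have [_ h] := HL (fun p => theta p 0 j) (dth j) i.
  by rewrite [LHS]h; apply: eq_bigr => a _; rewrite !mxE.
have Eg : \row_i pd i (f \o phi) u = grad (f \o chi) v *m L^T.
  apply/rowP => i; rewrite !mxE; have [_ ->] := HL f df i.
  by apply: eq_bigr => a _; rewrite !mxE mulrC.
rewrite /chart_grad EJ Eg trmx_mul /g.
have LTu : L^T \in unitmx by rewrite unitmx_tr.
have -> : invmx (L *m J *m (J^T *m L^T)) = invmx L^T *m invmx (J *m J^T) *m invmx L.
  apply: invmx_uniq; rewrite !mulmxA -(mulmxA _ L^T) mulmxV// mulmx1.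
  by rewrite -(mulmxA L J) -(mulmxA L) mulmxV// mulmx1 mulmxV.
by rewrite !mulmxA mulmxKV// -(mulmxA _ L^T) mulmxV// mulmx1.
Qed.

Lemma surf_jacE (M : set Rd1) (theta F : Rd1 -> Rd1) V chi v :
  is_chart 1 M V chi -> V v -> immersion M theta ->
  (forall j, differentiable (fun w => theta (chi w) 0 j) v) ->
  (forall j, differentiable (fun w => F (chi w) 0 j) v) ->
  surf_jac M theta F (chi v) =
  (jac (F \o chi) v)^T *m invmx (jac (theta \o chi) v *m (jac (theta \o chi) v)^T)
    *m jac (theta \o chi) v.
Proof.
move=> cchi Vv imm dth dF; apply/row_matrixP => i.
rewrite rowK (surf_gradE cchi Vv imm dth (f := fun q => F q 0 i)); last exact: dF.
rewrite !row_mul; congr (_ *m _ *m _).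
by apply/rowP => k; rewrite !mxE.
Qed.

End SurfaceGradient.

(** * Evolution of the mean curvature *)

Section Frame.
Variables (R : realType) (d : nat).
Notation Rd := 'rV[R]_d.
Notation Rd1 := 'rV[R]_d.+1.

Lemma row_opp m n (M : 'M[R]_(m, n)) k : row k (- M) = - row k M.
Proof. by apply/rowP => j; rewrite !mxE. Qed.

Lemma row_add m n (M N : 'M[R]_(m, n)) k : row k (M + N) = row k M + row k N.
Proof. by apply/rowP => j; rewrite !mxE. Qed.

Lemma row_scale m n a (M : 'M[R]_(m, n)) k : row k (a *: M) = a *: row k M.
Proof. by apply/rowP => j; rewrite !mxE. Qed.

(* Columns: the basis of the tangent space dual to the coordinate tangent
   vectors. *)
Definition dual_frame (J : 'M[R]_(d, d.+1)) : 'M[R]_(d.+1, d) :=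
  J^T *m invmx (J *m J^T).

Definition curv (psi n : Rd -> Rd1) (u : Rd) : R :=
  - \tr (jac n u *m dual_frame (jac psi u)).

Definition sgrad (psi : Rd -> Rd1) (f : Rd -> R) (u : Rd) : Rd1 :=
  grad f u *m (dual_frame (jac psi u))^T.

Section Algebra.
Variables (J : 'M[R]_(d, d.+1)) (n : 'rV[R]_d.+1).
Hypothesis Jf : row_free J.
Notation Gi := (invmx (J *m J^T)).
Notation S := (dual_frame J).

Lemma gram_inv_sym : Gi^T = Gi.
Proof. by rewrite trmx_inv trmx_mul trmxK. Qed.

Lemma dual_frameT : S^T = Gi *m J.
Proof. by rewrite trmx_mul trmxK gram_inv_sym. Qed.

Lemma mul_frame_dual : J *m S = 1%:M.
Proof. by rewrite mulmxA mulmxV//; exact: gram_unitmx. Qed.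

Lemma gram_inv_dual : Gi *m J *m S = Gi.
Proof. by rewrite -mulmxA mul_frame_dual mulmx1. Qed.

Lemma dual_frame_proj : S^T *m S *m J = S^T.
Proof. by rewrite dual_frameT gram_inv_dual. Qed.

Lemma normal_dual_frame : J *m n^T = 0 -> n *m S = 0.
Proof.
move=> Jn; have nJ : n *m J^T = 0 by rewrite -[LHS]trmxK trmx_mul trmxK Jn trmx0.
by rewrite mulmxA nJ mul0mx.
Qed.

End Algebra.

(* First variation of the mean curvature: primes are derivatives along F, and D
   is the matrix of spatial derivatives of n'. *)
Lemma dq_curvature (P : Type) (F : set_system P) {FF : Filter F} (c : P -> R)
    (Jf : P -> 'M[R]_(d, d.+1)) (nf : P -> Rd1) (Pf : 'I_d -> P -> 'M[R]_(d, d.+1))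
    J n (Pk : 'I_d -> 'M[R]_(d, d.+1)) J' n' (Q : 'I_d -> 'M[R]_(d, d.+1)) N D :
  mdq F c Jf J J' -> mdq F c nf n n' -> (forall k, mdq F c (Pf k) (Pk k) (Q k)) ->
  row_free J ->
  (forall k, row k N *m J^T = - (n *m (Pk k)^T)) ->
  N *m dual_frame J *m J = N ->
  (forall k, row k D *m J^T = - (n' *m (Pk k)^T + n *m (Q k)^T + row k N *m J'^T)) ->
  has_dq F c (fun x => \tr ((\matrix_k (nf x *m (Pf k x)^T)) *m invmx (Jf x *m (Jf x)^T)))
    (- \tr (N *m dual_frame J))
    (- \tr (D *m dual_frame J) + \tr (N *m dual_frame J *m J' *m dual_frame J)).
Proof.
move=> JJ nn PQ Jfree NJ NSJ DJ.
(* The second fundamental form written with second derivatives of the position: along [F] only [n],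
   not its spatial derivative [N], has to be differentiated. *)
pose h := \matrix_k (n *m (Pk k)^T).
pose h' := \matrix_k (n' *m (Pk k)^T + n *m (Q k)^T).
have hh : mdq F c (fun x => \matrix_k (nf x *m (Pf k x)^T)) h h'.
  move=> k i; have H := mdqM (FF := FF) nn (mdq_tr (PQ k)).
  have := H 0 i; rewrite !mxE.
  have -> // : (fun x => (\matrix_k0 (nf x *m (Pf k0 x)^T)) k i) = (fun x => (nf x *m (Pf k x)^T) 0 i).
  by apply/funext => x; rewrite mxE.
have Gu := gram_unitmx Jfree.
have GI := mdq_inv (FF := FF) (mdqM (FF := FF) JJ (mdq_tr JJ)) Gu.
have hE : h = - (N *m J^T).
  by apply/row_matrixP => k; rewrite rowK row_opp row_mul NJ opprK.
have h'E : h' = - (D *m J^T) - N *m J'^T.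
  apply/row_matrixP => k.
  by rewrite rowK row_add !row_opp !row_mul DJ opprK addrK.
have := dq_trace (FF := FF) (mdqM (FF := FF) hh GI).
have hGi : h *m invmx (J *m J^T) = - (N *m dual_frame J) by rewrite hE mulNmx -mulmxA.
have SE : J^T *m invmx (J *m J^T) = dual_frame J by [].
rewrite hGi linearN /=.
suff -> : \tr (h' *m invmx (J *m J^T) + h *m (- (invmx (J *m J^T) *m (J' *m J^T + J *m J'^T) *m invmx (J *m J^T)))) =
    - \tr (D *m dual_frame J) + \tr (N *m dual_frame J *m J' *m dual_frame J) by [].
move: (invmx (J *m J^T)) (dual_frame J) SE hGi NSJ => Gi S SE hGi NSJ.
rewrite mulmxN !mulmxA hGi !mulNmx opprK h'E mulmxDr !mulmxDl !mulNmx !mulmxA.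
rewrite NSJ -(mulmxA D) SE -(mulmxA _ J^T Gi) SE !mxtraceD !linearN /=.
by rewrite [X in _ + X]addrC addrA subrK.
Qed.

End Frame.

Section JacobianCalculus.
Variables (R : realType) (d : nat) (U : set 'rV[R]_d).
Hypothesis oU : open U.
Notation Rd := 'rV[R]_d.

Lemma mjC_jac k m (F : R -> Rd -> 'rV[R]_m) : mjC U k.+1 F -> mjC U k (fun t => jac (F t)).
Proof.
move=> jF i j; apply: jC_ext (jC_pd i (jF 0 j)) => // t u Uu.
by rewrite mxE.
Qed.

Lemma mjC_grad k (f : R -> Rd -> R) : jC k.+1 U f -> mjC U k (fun t => grad (f t)).
Proof.
move=> jf i j; apply: jC_ext (jC_pd j jf) => // t u Uu.
by rewrite ord1 mxE.
Qed.

Lemma mjC_dual_frame k (J : R -> Rd -> 'M[R]_(d, d.+1)) :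
  (forall t u, U u -> row_free (J t u)) -> mjC U k J ->
  mjC U k (fun t u => dual_frame (J t u)).
Proof.
move=> Jf jJ; apply: mjC_mul => //; first exact: mjC_tr.
apply: mjC_inv => [//||t u Uu]; last by apply: gram_unitmx; exact: Jf.
by apply: mjC_mul => //; exact: mjC_tr.
Qed.

Lemma row_mpd_jac m (F : R -> Rd -> 'rV[R]_m) t u (k i : 'I_d) : mjC U 2 F -> U u ->
  row i (mpd k (jac (F t)) u) = row k (mpd i (jac (F t)) u).
Proof.
move=> jF Uu; apply/rowP => j; rewrite [LHS]mxE [RHS]mxE [LHS]mxE [RHS]mxE.
transitivity (pd k (pd i (fun v => F t v 0 j)) u).
  by congr (pd k _ u); apply/funext => v; rewrite mxE.
rewrite (jC_mixed_partials oU t i k (jF 0 j) Uu).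
by congr (pd i _ u); apply/funext => v; rewrite mxE.
Qed.

Lemma mjC_row k m (F : R -> Rd -> 'M[R]_(d, m)) i : mjC U k F -> mjC U k (fun t u => row i (F t u)).
Proof. by move=> jF a b; apply: jC_ext (jF i b) => // s v _; rewrite mxE. Qed.

Lemma mpd_row m (F : Rd -> 'M[R]_(d, m)) i k u :
  mpd k (fun v => row i (F v)) u = row i (mpd k F u).
Proof.
apply/matrixP => a b; rewrite [LHS]mxE [RHS]mxE [RHS]mxE; congr (pd k _ u).
by apply/funext => v; rewrite mxE.
Qed.

Lemma mpdN m m' (F : R -> Rd -> 'M[R]_(m, m')) t k u : mjC U 1 F -> U u ->
  mpd k (fun v => - F t v) u = - mpd k (F t) u.
Proof.
move=> jF Uu; apply/matrixP => a b; rewrite [LHS]mxE [RHS]mxE [X in - X]mxE.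
rewrite -pdN; last exact: jC_derivable (jF a b) Uu.
by congr (pd k _ u); apply/funext => v; rewrite mxE.
Qed.

Lemma mpdD m m' (F G : R -> Rd -> 'M[R]_(m, m')) t k u : mjC U 1 F -> mjC U 1 G -> U u ->
  mpd k (fun v => F t v + G t v) u = mpd k (F t) u + mpd k (G t) u.
Proof.
move=> jF jG Uu; apply/matrixP => a b; rewrite [LHS]mxE [RHS]mxE [X in X + _]mxE [X in _ + X]mxE.
rewrite -pdD; [|exact: jC_derivable (jF a b) Uu|exact: jC_derivable (jG a b) Uu].
by congr (pd k _ u); apply/funext => v; rewrite mxE.
Qed.

Lemma mul_mpd_jac m (F : R -> Rd -> 'rV[R]_m) t u k (x : Rd) : mjC U 2 F -> U u ->
  x *m mpd k (jac (F t)) u = \sum_l x 0 l *: row k (mpd l (jac (F t)) u).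
Proof.
move=> jF Uu; rewrite mulmx_sum_row; apply: eq_bigr => l _.
by rewrite (@row_mpd_jac _ F t u l k jF Uu).
Qed.

End JacobianCalculus.

Lemma mpd_entry (R : realType) d m n (k : 'I_d) (F : 'rV[R]_d -> 'M[R]_(m, n)) u i j :
  mpd k F u i j = pd k (fun v => F v i j) u.
Proof. exact: mxE. Qed.

Lemma grad_entry (R : realType) d (f : 'rV[R]_d -> R) u i j : grad f u i j = pd j f u.
Proof. exact: mxE. Qed.

Lemma mjC_entry (R : realType) d (U : set 'rV[R]_d) k m n
    (F : R -> 'rV[R]_d -> 'M[R]_(m, n)) i j :
  mjC U k F -> jC k U (fun t u => F t u i j).
Proof. by apply. Qed.

Lemma dual_frameE (R : realType) d (J : 'M[R]_(d, d.+1)) :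
  dual_frame J = J^T *m invmx (J *m J^T).
Proof. by []. Qed.

Local Opaque mpd jac grad jC mjC dual_frame.

Section Evolution.
Variables (R : realType) (d : nat) (U : set 'rV[R]_d).
Hypothesis oU : open U.
Notation Rd := 'rV[R]_d.
Notation Rd1 := 'rV[R]_d.+1.
Notation e_ i := (delta_mx 0 i : Rd).

Variables (psi n w : R -> Rd -> Rd1).
Hypothesis jpsi : mjC U 4 psi.
Hypothesis jn0 : mjC U 0 n.
Hypothesis jw : mjC U 2 w.
Notation J t u := (jac (psi t) u).
Notation N t u := (jac (n t) u).
Notation S t u := (dual_frame (J t u)).
Hypothesis Jf : forall t u, U u -> row_free (J t u).
Hypothesis Jn : forall t u, U u -> J t u *m (n t u)^T = 0.
Hypothesis nn : forall t u, U u -> n t u *m (n t u)^T = 1%:M.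

Let jJ : mjC U 3 (fun t => jac (psi t)).
Proof. exact: (mjC_jac oU). Qed.

Lemma mjC_unit_normal : mjC U 3 n.
Proof. exact: (mjC_normal oU Jf Jn nn jJ jn0). Qed.

Let jn := mjC_unit_normal.
Let jN : mjC U 2 (fun t => jac (n t)).
Proof. exact: (mjC_jac oU). Qed.

Let jS : mjC U 3 (fun t u => S t u).
Proof. exact: (mjC_dual_frame oU Jf jJ). Qed.

Lemma jC_curv : jC 2 U (fun t => curv (psi t) (n t)).
Proof.
exact: (jC_N oU (jC_trace oU (mjC_mul oU jN (mjC_le _ jS)))).
Qed.

Let rowN t u k : U u -> row k (N t u) = - (n t u *m (mpd k (jac (psi t)) u)^T *m (S t u)^T).
Proof.
move=> Uu; rewrite row_jac (mpd_normal oU Jf Jn nn t k _ jn0 Uu).2; last exact: mjC_le jJ.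
by rewrite dual_frameT !mulmxA.
Qed.

Lemma weingarten t u k : U u -> row k (N t u) *m (J t u)^T = - (n t u *m (mpd k (jac (psi t)) u)^T).
Proof.
move=> Uu; rewrite rowN// mulNmx -(mulmxA _ _ (J t u)^T) -trmx_mul mul_frame_dual.
  by rewrite trmx1 mulmx1.
exact: Jf.
Qed.

(** [S J] is the orthogonal projection onto the tangent space, which contains the derivatives of a
    unit normal. *)
Let NSJ t u : U u -> N t u *m S t u *m J t u = N t u.
Proof.
move=> Uu; apply/row_matrixP => k; rewrite !row_mul rowN// !mulNmx; congr (- _).
by rewrite -2!(mulmxA (n t u *m _)) dual_frame_proj//; exact: Jf.
Qed.

Let curvE t u : U u -> curv (psi t) (n t) u =
  \tr ((\matrix_k (n t u *m (mpd k (jac (psi t)) u)^T)) *m invmx (J t u *m (J t u)^T)).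
Proof.
move=> Uu; rewrite /curv dual_frameE mulmxA -linearN -mulNmx /=; congr (\tr (_ *m _)).
by apply/row_matrixP => k; rewrite rowK row_opp row_mul weingarten// opprK.
Qed.

Let hess_sym t u : U u -> (N t u *m (J t u)^T)^T = N t u *m (J t u)^T.
Proof.
move=> Uu; apply/matrixP => i k; rewrite mxE.
have E a b : (N t u *m (J t u)^T) a b = - (n t u *m (row b (mpd a (jac (psi t)) u))^T) 0 0.
  have := weingarten t a Uu; rewrite -row_mul => /rowP/(_ b).
  rewrite [LHS]mxE => ->; rewrite !mxE; congr (- _).
  by apply: eq_bigr => l _; rewrite !mxE.
have psi2 : mjC U 2 psi by exact: mjC_le jpsi.
by rewrite !E (@row_mpd_jac _ _ _ oU _ psi t u i k psi2 Uu).
Qed.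

(** This is the second fundamental form, symmetric because mixed partials agree, conjugated by the
    dual frame. The symmetry turns the sum of squares of the entries into the trace of a square. *)
Lemma shape_sym t u : U u -> (S t u *m N t u)^T = S t u *m N t u.
Proof.
move=> Uu.
have E : S t u *m (N t u *m (J t u)^T) *m (S t u)^T = S t u *m N t u.
  rewrite dual_frameT !mulmxA -(mulmxA _ (J t u)^T) -dual_frameE.
  by rewrite -(mulmxA (S t u) (N t u)) -(mulmxA (S t u)) NSJ.
by rewrite -E (trmx_mul (S t u *m _)) (trmx_mul (S t u)) trmxK hess_sym// mulmxA.
Qed.

Let jN1 : mjC U 1 (fun t => jac (n t)).
Proof. exact: (mjC_le _ jN). Qed.
Let jJ2 : mjC U 2 (fun t => jac (psi t)).
Proof. exact: (mjC_le _ jJ). Qed.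
Let jJ1 : mjC U 1 (fun t => jac (psi t)).
Proof. exact: (mjC_le _ jJ). Qed.
Let jP1 k : mjC U 1 (fun t => mpd k (jac (psi t))).
Proof. exact: (@mjC_mpd _ _ U oU 1 _ _ (fun t => jac (psi t)) k jJ2). Qed.
Let n1 : mjC U 1 n.
Proof. exact: (mjC_le _ jn). Qed.

(** The first variation formula taken along a coordinate line instead of time; the common shape of
    the two derivatives lets the transport terms be recognized later. *)
Let gradN t u (l : 'I_d) : U u ->
  has_dq (0 : R)^' (fun h => h^-1) (fun h => curv (psi t) (n t) (h *: e_ l + u))
    (curv (psi t) (n t) u)
    (- \tr (mpd l (jac (n t)) u *m S t u)
      + \tr (N t u *m S t u *m mpd l (jac (psi t)) u *m S t u)).
Proof.
move=> Uu.
have H : has_dq (0 : R)^' (fun h : R => h^-1)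
   (fun h : R => \tr ((\matrix_k (n t (h *: e_ l + u) *m (mpd k (jac (psi t)) (h *: e_ l + u))^T))
      *m invmx (J t (h *: e_ l + u) *m (J t (h *: e_ l + u))^T)))
   (- \tr (N t u *m dual_frame (J t u)))
   (- \tr (mpd l (jac (n t)) u *m S t u)
      + \tr (N t u *m S t u *m mpd l (jac (psi t)) u *m S t u)).
  apply: (@dq_curvature _ _ _ _ _ (fun h : R => h^-1) (fun h => J t (h *: e_ l + u))
    (fun h => n t (h *: e_ l + u)) (fun k h => mpd k (jac (psi t)) (h *: e_ l + u))
    (J t u) (n t u) (fun k => mpd k (jac (psi t)) u) (mpd l (jac (psi t)) u) (mpd l (n t) u)
    (fun k => mpd l (fun v => mpd k (jac (psi t)) v) u)).
  - exact: (@mjC_dq _ _ _ _ _ (fun t => jac (psi t)) t l u jJ1 Uu).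
  - exact: (@mjC_dq _ _ _ _ _ n t l u n1 Uu).
  - move=> k; exact: (@mjC_dq _ _ _ _ _ (fun t => mpd k (jac (psi t))) t l u (jP1 k) Uu).
  - exact: (Jf t Uu).
  - by move=> k; exact: (weingarten t k Uu).
  - exact: (NSJ t Uu).
  - move=> k.
    have E : mpd l (fun v => row k (jac (n t) v) *m (jac (psi t) v)^T) u =
        mpd l (fun v => - (n t v *m (mpd k (jac (psi t)) v)^T)) u.
      by apply: (mpd_eq_on oU l Uu) => v Uv; exact: (weingarten t k Uv).
    move: E.
    rewrite (@mpdM _ _ _ _ _ _ (fun t v => row k (jac (n t) v)) (fun t v => (jac (psi t) v)^T)
      t l u (mjC_row oU k jN1) (mjC_tr oU jJ1) Uu).
    rewrite (@mpdN _ _ U _ _ (fun t v => n t v *m (mpd k (jac (psi t)) v)^T) t l u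
      (mjC_mul oU n1 (mjC_tr oU (jP1 k))) Uu).
    rewrite (@mpdM _ _ _ _ _ _ n (fun t v => (mpd k (jac (psi t)) v)^T) t l u n1
       (mjC_tr oU (jP1 k)) Uu).
    rewrite mpd_row !mpd_tr => /eqP; rewrite eq_sym -subr_eq => /eqP <-.
    exact/esym/opprD.
apply: (@has_dq_near _ _ _ _ (fun h : R => h^-1) _ _ _ _ _ H).
by apply: filterS (near_line oU l Uu) => h Uh; rewrite curvE.
Qed.

Let jw1 : mjC U 1 (fun t => jac (w t)).
Proof. exact: (mjC_jac oU). Qed.
Let jX : mjC U 2 (fun t u => w t u *m S t u).
Proof. exact: (mjC_mul oU jw (mjC_le _ jS)). Qed.
Let jwn : mjC U 2 (fun t u => w t u *m (n t u)^T).
Proof. exact: (mjC_mul oU jw (mjC_tr oU (mjC_le _ jn))). Qed.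

Notation V t := (fun u => (w t u *m (n t u)^T) 0 0).

Lemma jC_normal_speed : jC 2 U (fun t => V t).
Proof. exact: mjC_entry jwn. Qed.

Let grad_speed t u : U u -> grad (V t) u = n t u *m (jac (w t) u)^T + w t u *m (N t u)^T.
Proof.
move=> Uu; apply/rowP => k; rewrite grad_entry.
have w1 : mjC U 1 w by exact: (mjC_le _ jw).
have := @mpdM _ _ _ _ _ _ w (fun t u => (n t u)^T) t k u w1 (mjC_tr oU n1) Uu.
move=> /matrixP/(_ 0 0); rewrite mpd_entry => ->; rewrite mpd_tr -!row_jac [LHS]mxE [RHS]mxE.
by congr (_ + _); rewrite [LHS]mxE [RHS]mxE; apply: eq_bigr => j _; rewrite !mxE mulrC.
Qed.

(** The left side is the time derivative of the normal. Differentiating [V = w . n] in space and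
    using the symmetry of the shape operator separates it into the surface gradient of the speed and
    a tangential transport term. *)
Let normal_rate t u : U u ->
  - (n t u *m (jac (w t) u)^T *m (S t u)^T) =
  - sgrad (psi t) (V t) u + w t u *m S t u *m N t u.
Proof.
move=> Uu; rewrite /sgrad grad_speed// mulmxDl opprD.
by rewrite -(mulmxA (w t u) (S t u)) -shape_sym// (trmx_mul (S t u)) (mulmxA (w t u)) subrK.
Qed.

(** Split the velocity as [w = V n + X J] with [X = w S]. In the first variation the normal part
    produces the Laplacian and the quadratic term, the derivatives of [X] cancel, and the terms
    linear in [X] assemble to the derivative of the curvature along [X]. *)
Theorem curvature_evolution t u (F : set_system R) {FF : Filter F} (c : R -> R) :
  U u ->
  mdq F c (fun s => J s u) (J t u) (jac (w t) u) ->
  (forall k, mdq F c (fun s => mpd k (jac (psi s)) u) (mpd k (jac (psi t)) u)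
      (mpd k (jac (w t)) u)) ->
  mcvg F (fun s => n s u) (n t u) ->
  has_dq F c (fun s => curv (psi s) (n s) u) (curv (psi t) (n t) u)
    (\tr (jac (sgrad (psi t) (V t)) u *m S t u)
     + V t u * \tr (N t u *m S t u *m (N t u *m S t u))
     + \sum_m (w t u *m S t u) 0 m * pd m (curv (psi t) (n t)) u).
Proof.
move=> Uu TJ TP Tn.
pose dn s v := - (n s v *m (jac (w s) v)^T *m (S s v)^T).
have n' : mdq F c (fun s => n s u) (n t u) (dn t u).
  have := mdq_normal (FF := FF) TJ Tn (Jf t Uu) (Jn t Uu) (nn t Uu).
  rewrite /dn dual_frameT mulmxA; apply; apply: nearW => s.
  by split; [exact: Jn|exact: nn].
have jdn : mjC U 1 dn.
  exact: (mjC_N oU (mjC_mul oU (mjC_mul oU n1 (mjC_tr oU jw1)) (mjC_tr oU (mjC_le _ jS)))).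
(* The identity [dn J^T = - n (jac w)^T] holds on all of [U]; its spatial derivative is the relation
   that the first variation asks for. *)
have DJ k : row k (jac (dn t) u) *m (J t u)^T =
    - (dn t u *m (mpd k (jac (psi t)) u)^T + n t u *m (mpd k (jac (w t)) u)^T
       + row k (N t u) *m (jac (w t) u)^T).
  have E : mpd k (fun v => dn t v *m (jac (psi t) v)^T) u =
      mpd k (fun v => - (n t v *m (jac (w t) v)^T)) u.
    apply: (mpd_eq_on oU k Uu) => v Uv.
    rewrite /dn mulNmx -(mulmxA _ _ (J t v)^T) -trmx_mul mul_frame_dual; last exact: Jf.
    by rewrite trmx1 mulmx1.
  move: E.
  rewrite (@mpdM _ _ _ _ _ _ dn (fun t v => (jac (psi t) v)^T) t k u jdn (mjC_tr oU jJ1) Uu).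
  rewrite (@mpdN _ _ U _ _ (fun t v => n t v *m (jac (w t) v)^T) t k u
     (mjC_mul oU n1 (mjC_tr oU jw1)) Uu).
  rewrite (@mpdM _ _ _ _ _ _ n (fun t v => (jac (w t) v)^T) t k u n1 (mjC_tr oU jw1) Uu).
  rewrite !mpd_tr -!row_jac => /eqP; rewrite eq_sym -subr_eq => /eqP <-.
  rewrite addrC -opprD; congr (- _).
  by rewrite -addrA; congr (_ + _); exact: addrC.
have H := dq_curvature (FF := FF) TJ n' TP (Jf t Uu) (fun k => weingarten t k Uu) (NSJ t Uu) DJ.
have {}H : has_dq F c (fun s => curv (psi s) (n s) u) (curv (psi t) (n t) u)
    (- \tr (jac (dn t) u *m S t u) + \tr (N t u *m S t u *m jac (w t) u *m S t u)).
  apply: has_dq_near H; apply: nearW => s; exact/esym/curvE.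
suff -> : \tr (jac (sgrad (psi t) (V t)) u *m S t u)
     + V t u * \tr (N t u *m S t u *m (N t u *m S t u))
     + \sum_m (w t u *m S t u) 0 m * pd m (curv (psi t) (n t)) u =
   - \tr (jac (dn t) u *m S t u) + \tr (N t u *m S t u *m jac (w t) u *m S t u) by [].
have X1 : mjC U 1 (fun t u => w t u *m S t u) by exact: (mjC_le _ jX).
have wn1 : mjC U 1 (fun t u => w t u *m (n t u)^T) by exact: (mjC_le _ jwn).
have n2 : mjC U 2 n by exact: (mjC_le _ jn).
have psi2 : mjC U 2 psi by exact: (mjC_le _ jpsi).
pose Y := jac (fun v => w t v *m S t v) u.
pose X := w t u *m S t u.
have sg1 : mjC U 1 (fun t => sgrad (psi t) (V t)).
  exact: (mjC_mul oU (mjC_grad oU jC_normal_speed) (mjC_tr oU (mjC_le _ jS))).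
(* Used with [f = n] for the rate of the normal and with [f = psi] for the tangential velocity;
   symmetry of second derivatives puts [X] on the outer derivative. *)
have XN k (f : R -> Rd -> Rd1) : mjC U 2 f ->
    mpd k (fun v => w t v *m S t v *m jac (f t) v) u =
    row k (Y *m jac (f t) u + \sum_m X 0 m *: mpd m (jac (f t)) u).
  move=> f2; have f1 : mjC U 1 (fun t => jac (f t)) by exact: (mjC_jac oU f2).
  rewrite (@mpdM _ _ _ _ _ _ (fun t v => w t v *m S t v) (fun t => jac (f t)) t k u X1 f1 Uu).
  rewrite row_add row_mul row_jac (mul_mpd_jac oU t k _ f2 Uu); congr (_ + _).
  by rewrite raddf_sum; apply: eq_bigr => m _; rewrite /= linearZ.
have DE : jac (dn t) u *m S t u = - (jac (sgrad (psi t) (V t)) u *m S t u)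
    + Y *m (N t u *m S t u) + \sum_m X 0 m *: (mpd m (jac (n t)) u *m S t u).
  have -> : jac (dn t) u = - jac (sgrad (psi t) (V t)) u
      + (Y *m N t u + \sum_m X 0 m *: mpd m (jac (n t)) u).
    apply/row_matrixP => k.
    rewrite row_jac row_add row_opp row_jac -(XN k n n2).
    transitivity (mpd k (fun v => - sgrad (psi t) (V t) v + w t v *m S t v *m N t v) u).
      by apply: (mpd_eq_on oU k Uu) => v Uv; exact: normal_rate.
    rewrite (@mpdD _ _ _ _ _ (fun t v => - sgrad (psi t) (V t) v)
      (fun t v => w t v *m S t v *m N t v) t k u (mjC_N oU sg1) (mjC_mul oU X1 jN1) Uu).
    by rewrite (@mpdN _ _ _ _ _ (fun t => sgrad (psi t) (V t)) t k u sg1 Uu).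
  rewrite addrA !mulmxDl mulNmx mulmx_suml mulmxA; congr (_ + _).
  by apply: eq_bigr => m _; rewrite scalemxAl.
(* The derivative of the speed multiplies [n], which the dual frame annihilates. *)
have WE : jac (w t) u *m S t u = V t u *: (N t u *m S t u) + Y
    + \sum_m X 0 m *: (mpd m (jac (psi t)) u *m S t u).
  have -> : jac (w t) u = (\matrix_k mpd k (fun v => w t v *m (n t v)^T) u) *m n t u
      + V t u *: N t u + (Y *m J t u + \sum_m X 0 m *: mpd m (jac (psi t)) u).
    apply/row_matrixP => k.
    rewrite row_jac !row_add row_mul rowK -row_add -(XN k psi psi2).
    transitivity (mpd k (fun v => w t v *m (n t v)^T *m n t v + w t v *m S t v *m J t v) u).
      apply: (mpd_eq_on oU k Uu) => v Uv.
      rewrite -!(mulmxA (w t v)) -mulmxDr [X in _ *m X]addrC dual_frameE.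
      by rewrite (tangent_normal_decomposition (Jf t Uv) (Jn t Uv) (nn t Uv)) mulmx1.
    rewrite (@mpdD _ _ _ _ _ (fun t v => w t v *m (n t v)^T *m n t v)
      (fun t v => w t v *m S t v *m J t v) t k u (mjC_mul oU wn1 n1) (mjC_mul oU X1 jJ1) Uu).
    rewrite (@mpdM _ _ _ _ _ _ (fun t v => w t v *m (n t v)^T) n t k u wn1 n1 Uu).
    congr (_ + _ + _); rewrite -row_jac row_scale -mul_scalar_mx.
    by congr (_ *m _); exact: mx11_scalar.
  rewrite !mulmxDl -mulmxA normal_dual_frame; last exact: Jn.
  rewrite mulmx0 add0r -scalemxAl -(mulmxA Y) mul_frame_dual; last exact: Jf.
  rewrite mulmx1 addrA mulmx_suml; congr (_ + _).
  by apply: eq_bigr => m _; rewrite scalemxAl.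
have GE m : pd m (curv (psi t) (n t)) u = - \tr (mpd m (jac (n t)) u *m S t u)
      + \tr (N t u *m S t u *m (mpd m (jac (psi t)) u *m S t u)).
  by rewrite mulmxA; have [_] := dq_pd (gradN t m Uu).
rewrite DE -(mulmxA _ (jac (w t) u)) WE; under eq_bigr do rewrite GE.
move: (N t u *m S t u) (jac (sgrad (psi t) (V t)) u *m S t u) (V t u) => K A v.
have -> : \sum_m X 0 m * (- \tr (mpd m (jac (n t)) u *m S t u)
      + \tr (K *m (mpd m (jac (psi t)) u *m S t u))) =
    - \tr (\sum_m X 0 m *: (mpd m (jac (n t)) u *m S t u))
    + \tr (K *m \sum_m X 0 m *: (mpd m (jac (psi t)) u *m S t u)).
  have trs (E : 'I_d -> 'M[R]_d) : \tr (\sum_m E m) = \sum_m \tr (E m) by exact: raddf_sum.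
  rewrite mulmx_sumr !trs -sumrN -big_split; apply: eq_bigr => m _.
  by rewrite /= -scalemxAr !mxtraceZ mulrDr mulrN.
(* The two traces containing [Y] are equal by cyclicity and enter with opposite signs. *)
rewrite !mulmxDr !mxtraceD linearN /= -scalemxAr mxtraceZ (mxtrace_mulC Y).
move: (\tr A) (\tr (K *m K)) (\tr (K *m Y)) => a b c'.
by move: (\tr (\sum_m _)) (\tr (K *m _)) => s1 s2; ring.
Qed.

End Evolution.

Local Transparent mpd jac grad jC mjC dual_frame.

(** * Maximum principle in a chart *)

Section Coordinates.
Variables (R : realType) (d : nat) (U : set 'rV[R]_d).
Hypothesis oU : open U.
Notation Rd := 'rV[R]_d.
Notation e_ i := (delta_mx 0 i : Rd).

Lemma jC_time k (g : R -> R) : continuous g -> jC k U (fun t _ => g t).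
Proof.
move=> cg; have c0 : jcont U (fun t (_ : Rd) => g t).
  move=> t u Uu; apply: (@continuous_comp _ _ _ (@fst R Rd) g); first exact: cvg_fst.
  exact: cg.
case: k => [|k]; split=> // i; split=> [t u _|]; first exact: derivable_cst.
by apply: jC_ext (jC_cst oU k 0) => // t u _; rewrite pd_cst.
Qed.

Lemma derivable_coord (u : Rd) i j : derivable (fun v : Rd => v 0 j) u (e_ i).
Proof. by apply: diff_derivable; exact: differentiable_coord. Qed.

Lemma pd_coord (u : Rd) i j : pd i (fun v : Rd => v 0 j) u = (j == i)%:R.
Proof.
rewrite /pd deriveE; last exact: differentiable_coord.
have @f : {linear Rd -> R}.
  by exists (fun N : Rd => N 0 j); do 2![eexists]; do ?[constructor];
     rewrite ?mxE// => ? *; rewrite ?mxE//; move=> ?; rewrite !mxE.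
rewrite (_ : (fun v : Rd => v 0 j) = f)// diff_lin; last exact: coord_continuous.
by rewrite /= mxE eqxx /=.
Qed.

Lemma jC_coordinate k j : jC k U (fun _ (u : Rd) => u 0 j).
Proof.
have c0 : jcont U (fun (_ : R) (u : Rd) => u 0 j).
  move=> t u Uu; apply: (@continuous_comp _ _ _ (@snd R Rd) (fun u => u 0 j)); first exact: cvg_snd.
  exact: coord_continuous.
case: k => [|k]; split=> // i; split=> [t u _|]; first exact: derivable_coord.
by apply: jC_ext (jC_cst oU k (j == i)%:R) => // t u _; rewrite pd_coord.
Qed.

Definition hess (f : Rd -> R) (u : Rd) : 'M[R]_d := jac (grad f) u.

Lemma hess_entry (f : Rd -> R) u i j : hess f u i j = pd i (pd j f) u.
Proof. by rewrite mxE; congr (pd i _ u); apply/funext => v; rewrite mxE. Qed.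

Lemma row_hess (f : Rd -> R) u k : row k (hess f u) = mpd k (grad f) u.
Proof. exact: row_jac. Qed.

End Coordinates.

Local Opaque jC mjC mpd jac grad hess.

Lemma dq_left_derive (R : realType) (f : R -> R) (t l : R) : is_derive t (1 : R) f l ->
  has_dq t^'- (fun s => (s - t)^-1) f (f t) l.
Proof.
move=> [df dl]; split.
  apply: (@cvg_within_filter _ _ f (nbhs t)).
  by apply/differentiable_continuous/derivable1_diffP.
have H : (fun h : R => h^-1 *: (f (h *: 1 + t) - f t)) @ 0^' --> l by rewrite -dl.
have B : (fun s : R => s - t) @ t^'- --> (0 : R)^'.
  move=> A /nbhs_ballP[e /= e0 Ae]; apply/nbhs_ballP; exists e => //= s se st.
  apply: Ae; last by rewrite subr_eq0 lt_eqF.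
  by move: se; rewrite /ball /= sub0r opprB.
have := cvg_comp _ _ B H; apply: cvg_trans.
by apply: near_eq_cvg; apply: nearW => s /=; rewrite /GRing.scale /= mulr1 subrK.
Qed.

(** * The comparison function and its derivatives *)

Section Barrier.
Variables (R : realType) (d : nat) (x : 'rV[R]_d) (rho kap s0 lam eps : R).
Notation Rd := 'rV[R]_d.
Notation e_ i := (delta_mx 0 i : Rd).

(** The Euclidean square is a polynomial, hence smooth, unlike the sup norm of row vectors. *)
Definition dist2 (y : Rd) : R := \sum_k (y 0 k - x 0 k) * (y 0 k - x 0 k).

(** [rho] is the squared radius of the ball at time [s0] and [kap] the growth rate of the squared
    radius. *)
Definition paraboloid (t : R) (y : Rd) : R := rho + kap * (t - s0) - dist2 y.

(** Also serves as the factor exp(- L t) of the weak maximum principle, with [s0 = 0] and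
    [eps = 1]. *)
Definition amplitude (t : R) : R := eps * expR (- lam * (t - s0)).

Definition barrier (t : R) (y : Rd) : R :=
  amplitude t * (paraboloid t y * paraboloid t y).

Section Smooth.
Variable U : set Rd.
Hypothesis oU : open U.

Lemma jC_paraboloid k : jC k U paraboloid.
Proof.
have jx j : jC k U (fun (_ : R) (y : Rd) => y 0 j - x 0 j).
  exact: (jC_D oU (jC_coordinate oU k j) (jC_cst oU k (- x 0 j))).
have jd : jC k U (fun (_ : R) => dist2) by apply: (jC_sum oU) => j; exact: (jC_M oU (jx j) (jx j)).
apply: (jC_D oU _ (jC_N oU jd)); apply: (jC_time oU) => t.
by apply: cvgD; [exact: cvg_cst|apply: cvgM; [exact: cvg_cst|apply: cvgB; [exact: cvg_id|exact: cvg_cst]]].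
Qed.

Lemma continuous_amplitude : continuous amplitude.
Proof.
move=> t; apply: cvgM; first exact: cvg_cst.
apply: (@continuous_comp _ _ _ (fun s => - lam * (s - s0)) expR); last exact: continuous_expR.
by apply: cvgM; [exact: cvg_cst|apply: cvgB; [exact: cvg_id|exact: cvg_cst]].
Qed.

Lemma jC_barrier k : jC k U barrier.
Proof.
exact: (jC_M oU (jC_time oU k continuous_amplitude) (jC_M oU (jC_paraboloid k) (jC_paraboloid k))).
Qed.

End Smooth.

Lemma dist2_ge0 (y : Rd) : 0 <= dist2 y.
Proof. by apply: sumr_ge0 => k _; rewrite -expr2 sqr_ge0. Qed.

Lemma coord_dist2 (y : Rd) k : (y 0 k - x 0 k) ^+ 2 <= dist2 y.
Proof.
rewrite /dist2 (bigD1 k)//= expr2 lerDl.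
by apply: sumr_ge0 => j _; rewrite -expr2 sqr_ge0.
Qed.

Lemma continuous_dist2 : continuous (dist2 : Rd -> R).
Proof.
move=> y; have := @jcont_at _ _ _ setT (fun _ => dist2) 0 y _ I; apply.
apply: jC_cont; apply: (jC_sum openT) => k.
have jk := jC_D openT (jC_coordinate openT 0 k) (jC_cst openT 0 (- x 0 k)).
exact: (jC_M openT jk jk).
Qed.

Lemma compact_dist2_ball r : compact [set y | dist2 y <= r].
Proof.
(* The half-width [1 + |r|] dominates the square root of [r] without taking roots. *)
have -> : [set y | dist2 y <= r] =
    [set y : Rd | forall k, `[x 0 k - (1 + `|r|), x 0 k + (1 + `|r|)]%classic (y ord0 k)]
    `&` [set y | dist2 y <= r].
  apply/seteqP; split => [y yr|y []//]; split => // k /=; rewrite in_itv /=.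
  have := le_trans (coord_dist2 y k) (le_trans yr (ler_norm r)).
  have : 0 <= `|r| by [].
  rewrite -[y ord0 k]/(y 0 k); move: (y 0 k) (x 0 k) `|r| => p q a a0 h.
  by apply/andP; split; nra.
apply: compact_closedI.
  apply: (@rV_compact _ _ (fun k => `[x 0 k - (1 + `|r|), x 0 k + (1 + `|r|)]%classic)) => k.
  exact: segment_compact.
apply: (@closed_comp _ _ dist2 [set a | a <= r]); last exact: closed_le.
by move=> y _; exact: continuous_dist2.
Qed.

Lemma derivable_shifted (u : Rd) k i : derivable (fun y : Rd => y 0 k - x 0 k) u (e_ i).
Proof.
apply: (@derivableD _ _ _ (fun y : Rd => y 0 k) (cst (- x 0 k))).
  exact: derivable_coord.
exact: derivable_cst.
Qed.

Lemma pd_shifted (u : Rd) k i : pd i (fun y : Rd => y 0 k - x 0 k) u = (k == i)%:R.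
Proof.
rewrite (@pdD _ _ (fun y : Rd => y 0 k) (fun _ => - x 0 k)).
  by rewrite pd_coord pd_cst addr0.
  exact: derivable_coord.
exact: derivable_cst.
Qed.

Lemma derivable_paraboloid t u (i : 'I_d) : derivable (paraboloid t) u (e_ i).
Proof. exact: (@jC_derivable _ _ _ _ _ _ t u i (jC_paraboloid openT 1) I). Qed.

Lemma pd_paraboloid t u i : pd i (paraboloid t) u = - (2 * (u 0 i - x 0 i)).
Proof.
have dx k := @derivable_shifted u k i; have px k := pd_shifted u k i.
have [ds ps] := @pd_sum _ _ _ (index_enum 'I_d)
  (fun k (y : Rd) => (y 0 k - x 0 k) * (y 0 k - x 0 k)) i u (fun k => derivableM (dx k) (dx k)).
have -> : pd i (paraboloid t) u = - pd i dist2 u.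
  rewrite (@pdD _ _ (fun _ => rho + kap * (t - s0)) (fun y => - dist2 y)); [|exact: derivable_cst|exact: (derivableN ds)].
  by rewrite pd_cst add0r pdN.
congr (- _); rewrite [LHS]ps (bigD1 i)//= big1 ?addr0 => [|k ki].
  by rewrite (pdM (dx i) (dx i)) !px eqxx /=; ring.
by rewrite (pdM (dx k) (dx k)) !px (negbTE ki) !mulr0 addr0.
Qed.

Lemma pd_barrier t u i :
  pd i (barrier t) u = - (4 * amplitude t) * (paraboloid t u * (u 0 i - x 0 i)).
Proof.
have dp := @derivable_paraboloid t u i.
have dpp := derivableM dp dp.
rewrite (@pdM _ _ (fun _ => amplitude t) (fun y => paraboloid t y * paraboloid t y)); [|exact: derivable_cst|exact: dpp].
rewrite pd_cst (@pdM _ _ (paraboloid t) (paraboloid t)) // !pd_paraboloid; ring.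
Qed.

Lemma pd2_barrier t u i j : pd i (pd j (barrier t)) u =
  amplitude t * (8 * ((u 0 i - x 0 i) * (u 0 j - x 0 j)) - 4 * paraboloid t u * (j == i)%:R).
Proof.
have -> : pd j (barrier t) = fun y => - (4 * amplitude t) * (paraboloid t y * (y 0 j - x 0 j)).
  by apply/funext => y; exact: pd_barrier.
have dp := @derivable_paraboloid t u i.
have dx k := @derivable_shifted u k i; have px k := pd_shifted u k i.
rewrite (@pdM _ _ (fun _ => - (4 * amplitude t)) (fun y => paraboloid t y * (y 0 j - x 0 j)));
  [|exact: derivable_cst|exact: (derivableM dp (dx j))].
rewrite pd_cst (@pdM _ _ (paraboloid t) (fun y : Rd => y 0 j - x 0 j)); [|exact: dp|exact: dx].
rewrite pd_paraboloid px; ring.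
Qed.

Lemma dq_amplitude t :
  has_dq t^'- (fun s => (s - t)^-1) amplitude (amplitude t) (- lam * amplitude t).
Proof.
apply: dq_left_derive; rewrite /amplitude.
have dl : is_derive t 1 (fun s => - lam * (s - s0)) (- lam).
  by apply: is_derive_eq; rewrite /GRing.scale /=; ring.
have de := @is_derive1_comp _ expR _ t _ _ (is_derive_expR _) dl.
by apply: is_derive_eq; rewrite /GRing.scale /=; ring.
Qed.

Lemma dq_barrier t u :
  has_dq t^'- (fun s => (s - t)^-1) (fun s => barrier s u) (barrier t u)
    (amplitude t * (2 * kap * paraboloid t u - lam * (paraboloid t u * paraboloid t u))).
Proof.
have da := dq_amplitude t.
have dp : has_dq t^'- (fun s => (s - t)^-1) (fun s => paraboloid s u) (paraboloid t u) kap.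
  apply: dq_left_derive; rewrite /paraboloid.
  by apply: is_derive_eq; rewrite /GRing.scale /=; ring.
suff -> : amplitude t * (2 * kap * paraboloid t u - lam * (paraboloid t u * paraboloid t u)) =
    - lam * amplitude t * (paraboloid t u * paraboloid t u) +
    amplitude t * (kap * paraboloid t u + paraboloid t u * kap) by exact: (dqM da (dqM dp dp)).
by move: (amplitude t) (paraboloid t u) => a p; ring.
Qed.

End Barrier.

Section Compactness.
Variables (R : realType) (X : topologicalType) (K : set X) (f : X -> R).
Hypothesis cK : compact K.
Hypothesis cf : forall z, K z -> {for z, continuous f}.

Lemma compact_min : K !=set0 -> exists2 z, K z & forall y, K y -> f z <= f y.
Proof.
move=> K0; have cfK : {within K, continuous f}.
  by apply: continuous_in_subspaceT => z; rewrite inE; exact: cf.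
have [z Kz zmin] := compact_EVT_min K0 cK cfK.
by exists z => [|y Ky]; [rewrite inE in Kz|apply: zmin; rewrite inE].
Qed.

Lemma compact_max : K !=set0 -> exists2 z, K z & forall y, K y -> f y <= f z.
Proof.
move=> K0; have cfK : {within K, continuous f}.
  by apply: continuous_in_subspaceT => z; rewrite inE; exact: cf.
have [z Kz zmax] := compact_EVT_max K0 cK cfK.
by exists z => [|y Ky]; [rewrite inE in Kz|apply: zmax; rewrite inE].
Qed.

Lemma compact_pos_lb : (forall z, K z -> 0 < f z) ->
  exists2 m, 0 < m & forall z, K z -> m <= f z.
Proof.
move=> fpos; have [K0|/set0P/negP] := pselect (K !=set0).
  have [z Kz zmin] := compact_min K0; by exists (f z) => //; exact: fpos.
by rewrite negbK => /eqP ->; exists 1.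
Qed.

End Compactness.

Lemma compact_abs_ub (R : realType) (X : topologicalType) (K : set X) (f : X -> R) :
  compact K -> (forall z, K z -> {for z, continuous f}) ->
  exists2 m, 0 <= m & forall z, K z -> `|f z| <= m.
Proof.
move=> cK cf; have cn z : K z -> {for z, continuous (fun y => `|f y|)}.
  by move=> Kz; exact: cvg_norm (cf z Kz).
have [K0|/set0P/negP] := pselect (K !=set0).
  by have [z Kz zmax] := compact_max cK cn K0; exists `|f z|.
by rewrite negbK => /eqP ->; exists 0.
Qed.

(** * Comparison with subsolutions and spreading of positivity *)

Section MaximumPrinciple.
Variables (R : realType) (d : nat) (U : set 'rV[R]_d).
Hypothesis oU : open U.
Notation Rd := 'rV[R]_d.

Variables (T : R) (v : R -> Rd -> R).
Variables (al : R -> Rd -> 'M[R]_d) (be : R -> Rd -> Rd) (c : R -> Rd -> R).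
Hypothesis jv : jC 2 U v.

Definition elliptic (f : Rd -> R) t u : R :=
  \tr (al t u *m hess f u) + (grad f u *m (be t u)^T) 0 0 + c t u * f u.

Hypothesis al_psd : forall t u F, U u ->
  (forall xi : Rd, 0 <= (xi *m F *m xi^T) 0 0) -> 0 <= \tr (al t u *m F).
Hypothesis equation : forall t u, 0 < t <= T -> U u ->
  has_dq t^'- (fun s => (s - t)^-1) (fun s => v s u) (v t u) (elliptic (v t) t u).
Hypothesis c_lt0 : forall t u, U u -> c t u < 0.

Lemma grad_sub (f g : R -> Rd -> R) t u : jC 1 U f -> jC 1 U g -> U u ->
  grad (fun y => f t y - g t y) u = grad (f t) u - grad (g t) u.
Proof.
move=> jf jg Uu; apply/rowP => i; rewrite [RHS]mxE [X in _ + X]mxE !grad_entry.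
rewrite -pdN; last exact: jC_derivable jg Uu.
rewrite -pdD//; first exact: jC_derivable jf Uu.
by apply: derivableN; exact: jC_derivable jg Uu.
Qed.

Lemma sub_entry m n (A B : 'M[R]_(m, n)) i j : (A - B) i j = A i j - B i j.
Proof. by rewrite !mxE. Qed.

Lemma hess_sub (f g : R -> Rd -> R) t u : jC 2 U f -> jC 2 U g -> U u ->
  hess (fun y => f t y - g t y) u = hess (f t) u - hess (g t) u.
Proof.
move=> jf jg Uu; apply/matrixP => i j.
transitivity (hess (f t) u i j - hess (g t) u i j); last by symmetry; exact: sub_entry.
apply: (etrans (hess_entry (fun y => f t y - g t y) u i j)).
apply: (etrans _ (esym (congr2 (fun a b => a - b) (hess_entry (f t) u i j) (hess_entry (g t) u i j)))).
have djf := @jC_derivable _ _ _ _ _ _ t u i (jC_pd j jf) Uu.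
have djg := @jC_derivable _ _ _ _ _ _ t u i (jC_pd j jg) Uu.
transitivity (pd i (fun y => pd j (f t) y + - pd j (g t) y) u).
  apply: (pd_eq_on i oU Uu) => y Uy.
  have dg := @jC_derivable _ _ _ _ _ _ t y j jg Uy.
  rewrite -(pdN dg) -pdD; first by [].
    exact: (@jC_derivable _ _ _ _ _ _ t y j jf Uy).
  exact: (derivableN dg).
by rewrite (pdD djf (derivableN djg)) (pdN djg).
Qed.

Lemma elliptic_linear (a F G : 'M[R]_d) (b p q : Rd) (r x y : R) :
  \tr (a *m (F - G)) + ((p - q) *m b^T) 0 0 + r * (x - y) =
  \tr (a *m F) + (p *m b^T) 0 0 + r * x - (\tr (a *m G) + (q *m b^T) 0 0 + r * y).
Proof.
rewrite mulmxBr mulmxBl raddfB /= sub_entry.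
by move: (\tr _) (\tr _) ((p *m _) 0 0) ((q *m _) 0 0) => h k m n; ring.
Qed.

Lemma elliptic_sub (f g : R -> Rd -> R) t u : jC 2 U f -> jC 2 U g -> U u ->
  elliptic (fun y => f t y - g t y) t u = elliptic (f t) t u - elliptic (g t) t u.
Proof.
move=> jf jg Uu; rewrite /elliptic (hess_sub t jf jg Uu) (grad_sub t (jCW jf) (jCW jg) Uu).
exact: elliptic_linear.
Qed.

Lemma quadratic_form (xi : Rd) (F : 'M[R]_d) :
  (xi *m F *m xi^T) 0 0 = \sum_i \sum_j xi 0 i * xi 0 j * F j i.
Proof.
rewrite mxE; apply: eq_bigr => i _; rewrite [X in X * _]mxE [X in _ * X]mxE mulr_suml.
by apply: eq_bigr => j _; rewrite mulrC mulrA.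
Qed.

(* At a negative minimum of v - w the equation for v contradicts the
   inequality for w. *)
Lemma no_touching_from_below (w : R -> Rd -> R) t u w' :
  jC 2 U w -> 0 < t <= T -> U u ->
  has_dq t^'- (fun s => (s - t)^-1) (fun s => w s u) (w t u) w' ->
  w' <= elliptic (w t) t u ->
  (\forall y \near u, v t u - w t u <= v t y - w t y) ->
  (\forall s \near t^'-, v t u - w t u <= v s u - w s u) ->
  0 <= v t u - w t u.
Proof.
move=> jw t0 Uu dw w'le umin tmin; rewrite leNgt; apply/negP => zneg.
pose z s y := v s y - w s y.
have jz : jC 2 U z := jC_D oU jv (jC_N oU jw).
have [_ dz] := dqD (equation t0 Uu) (dqN dw).
(* Backward quotients of [z] have a nonnegative numerator and a negative denominator, so the left
   derivative of [z] is at most 0. *)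
have z'le : elliptic (v t) t u - w' <= 0.
  apply: (cvgr_to_le dz).
  have slt : \forall s \near t^'-, s < t by exact: nbhs_left_lt.
  apply: filterS2 slt tmin => s st zz.
  by rewrite mulr_le0_ge0// ?subr_ge0// invr_le0 subr_le0 ltW.
have zE : elliptic (z t) t u <= 0.
  apply: le_trans z'le; rewrite (elliptic_sub t jv jw Uu) lerD2l lerN2; exact: w'le.
have dzu : \near u, differentiable (z t) u.
  apply: filterS (open_nbhs_nbhs (conj oU Uu)) => y Uy.
  exact: (jC_differentiable oU t (jCW jz) Uy).
have g0 : grad (z t) u = 0.
  apply/rowP => i; rewrite grad_entry mxE.
  by apply: local_min_derive umin _; exact: nbhs_singleton dzu.
have hz (xi : Rd) : 0 <= (xi *m hess (z t) u *m xi^T) 0 0.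
  have ddz i : differentiable (pd i (z t)) u.
    exact: (@jC_differentiable _ _ _ oU (fun t => pd i (z t)) t u (jC_pd i jz) Uu).
  have := local_min_hessian dzu ddz umin xi; congr (0 <= _).
  rewrite quadratic_form; apply: eq_bigr => i _; apply: eq_bigr => j _.
  by congr (_ * _); rewrite (hess_entry (z t) u j i).
have cz : 0 < c t u * (v t u - w t u) by rewrite nmulr_rgt0// c_lt0.
have az := al_psd t Uu hz.
move: zE; rewrite /elliptic g0 mul0mx [X in _ + X + _]mxE addr0 leNgt => /negP; apply.
exact: ltr_wpDl az cz.
Qed.

(** The terms are ordered by powers of the paraboloid; only the one of order zero survives at its
    edge, and it has a sign. *)
Lemma elliptic_barrier x rho kap s0 lam eps t y : U y ->
  elliptic (barrier x rho kap s0 lam eps t) t y =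
  amplitude s0 lam eps t *
    (8 * ((y - x) *m al t y *m (y - x)^T) 0 0
     - paraboloid x rho kap s0 t y *
       (4 * \tr (al t y) + 4 * ((y - x) *m (be t y)^T) 0 0)
     + c t y * (paraboloid x rho kap s0 t y * paraboloid x rho kap s0 t y)).
Proof.
move=> Uy; rewrite /elliptic.
set a := amplitude _ _ _ _; set p := paraboloid _ _ _ _ _ _.
have -> : grad (barrier x rho kap s0 lam eps t) y = (- (4 * a) * p) *: (y - x).
  apply/rowP => i; rewrite (grad_entry _ y 0 i) pd_barrier [RHS]mxE sub_entry.
  by rewrite -/a -/p mulrA.
have -> : hess (barrier x rho kap s0 lam eps t) y =
    (8 * a) *: ((y - x)^T *m (y - x)) - (4 * a * p)%:M.
  apply/matrixP => i j; apply: (etrans (hess_entry _ y i j)).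
  rewrite pd2_barrier sub_entry [X in _ = X - _]mxE [X in _ = _ * X - _]mxE big_ord1.
  rewrite [X in _ = _ * (X * _) - _]mxE !sub_entry [X in _ = _ - X]mxE -(mulr_natr (4 * a * p)) eq_sym -/a -/p.
  rewrite -[y ord0 i]/(y 0 i) -[y ord0 j]/(y 0 j) -[x ord0 i]/(x 0 i) -[x ord0 j]/(x 0 j).
  by move: (y 0 i - _) (y 0 j - _) ((i == j)%:R) => r q k; ring.
rewrite mulmxBr raddfB /= -scalemxAr mxtraceZ mul_mx_scalar mxtraceZ -scalemxAl [X in _ + X + _]mxE.
rewrite mulmxA mxtrace_mulC mulmxA.
have -> : \tr ((y - x) *m al t y *m (y - x)^T) = ((y - x) *m al t y *m (y - x)^T) 0 0.
  by rewrite /mxtrace big_ord1.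
rewrite /barrier -/a -/p.
move: (_ 0 0) ((_ *m (be t y)^T) 0 0) (\tr _) (c t y) => q r k m; ring.
Qed.

Hypothesis jal : mjC U 0 al.
Hypothesis jbe : mjC U 0 be.
Hypothesis jc : jC 0 U c.
Hypothesis al_pos : forall t u (xi : Rd), U u -> xi != 0 -> 0 < (xi *m al t u *m xi^T) 0 0.

Section Spreading.
Variables (x : Rd) (rho kap s0 t1 : R).
Hypotheses (rho0 : 0 < rho) (kap0 : 0 <= kap) (s00 : 0 <= s0) (s0t1 : s0 < t1) (t1T : t1 <= T).
Hypothesis ballU : forall y, dist2 x y <= rho + kap * (t1 - s0) -> U y.

Let Z : set (R * Rd) :=
  [set z | s0 <= z.1 <= t1 /\ 0 <= paraboloid x rho kap s0 z.1 z.2].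

Let paraboloid_cont (z : R * Rd) :
  {for z, continuous (fun z : R * Rd => paraboloid x rho kap s0 z.1 z.2)}.
Proof. by case: z => t y; apply: (jC_cont (jC_paraboloid x rho kap s0 openT 0)). Qed.

Let ZU z : Z z -> U z.2.
Proof.
move=> [/andP[sz zt] e]; apply: ballU; move: e; rewrite /paraboloid subr_ge0 => /le_trans; apply.
by rewrite lerD2l ler_wpM2l// lerD2r.
Qed.

Let compactZ : compact Z.
Proof.
have -> : Z = (`[s0, t1]%classic `*` [set y | dist2 x y <= rho + kap * (t1 - s0)])
    `&` [set z | 0 <= paraboloid x rho kap s0 z.1 z.2].
  apply/seteqP; split => [z [/andP[sz zt] e]|z [[+ _] e]]; last by rewrite /= in_itv /=; split.
  split => //; split; first by rewrite /= in_itv /= sz zt.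
  move: e; rewrite /= /paraboloid subr_ge0 => /le_trans; apply.
  by rewrite lerD2l ler_wpM2l// lerD2r.
apply: compact_closedI.
  by apply: compact_setX; [exact: segment_compact|exact: compact_dist2_ball].
apply: (@closed_comp _ _ (fun z : R * Rd => paraboloid x rho kap s0 z.1 z.2) [set y | 0 <= y]).
  by move=> z _; exact: paraboloid_cont.
exact: closed_ge.
Qed.

Hypothesis v_ge0 : forall t y, s0 <= t <= t1 -> U y -> 0 <= v t y.
Hypothesis v_pos : forall y, dist2 x y <= rho -> 0 < v s0 y.

(** The minimum of [v - w] over the closed region [Z] is nonnegative: on the lateral boundary [w]
    vanishes, at time [s0] the choice of [eps] puts [w] below [v], and elsewhere the touching lemma
    applies. *)
Lemma positivity_spreads y : dist2 x y < rho + kap * (t1 - s0) -> 0 < v t1 y.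
Proof.
move=> ylt; pose eta := paraboloid x rho kap s0.
have jx : mjC U 0 (fun (_ : R) (y : Rd) => y - x).
  move=> i j; apply: (jC_ext oU _ (jC_D oU (jC_coordinate oU 0 j) (jC_cst oU 0 (- x 0 j)))) => t u _.
  by rewrite ord1 sub_entry.
have jq := mjC_entry 0 0 (mjC_mul oU (mjC_mul oU jx jal) (mjC_tr oU jx)).
have jb := mjC_entry 0 0 (mjC_mul oU jx (mjC_tr oU jbe)).
have jtr := jC_trace oU jal.
have jeta := jC_paraboloid x rho kap s0 oU 0.
(* [b] collects the coefficients of [eta], with [2 * kap] coming from the time derivative. As [q]
   vanishes only at the center [x], where [eta] is positive, [Q] has a positive lower bound on
   [Z]. *)
pose q t y := 8 * ((y - x) *m al t y *m (y - x)^T) 0 0.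
pose b t y := 4 * \tr (al t y) + 4 * ((y - x) *m (be t y)^T) 0 0 + 2 * kap.
pose Q t y := q t y + eta t y * eta t y.
have jQ : jC 0 U Q.
  exact: (jC_D oU (jC_M oU (jC_cst oU 0 8) jq) (jC_M oU jeta jeta)).
have jB : jC 0 U b.
  exact: (jC_D oU (jC_D oU (jC_M oU (jC_cst oU 0 4) jtr) (jC_M oU (jC_cst oU 0 4) jb)) (jC_cst oU 0 (2 * kap))).
have contZ (f : R -> Rd -> R) : jC 0 U f -> forall z : R * Rd, Z z -> {for z, continuous (fun z => f z.1 z.2)}.
  by move=> jf [t u] /ZU Uu; exact: (jC_cont jf Uu).
have [mu mu0 muP] : exists2 mu, 0 < mu & forall z, Z z -> mu <= Q z.1 z.2.
  apply: (compact_pos_lb compactZ (contZ Q jQ)) => -[t u] Zz; have Uu := ZU Zz.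
  rewrite /Q /q /=; have [ux|ux] := eqVneq (u - x) 0.
    rewrite ux !mul0mx [X in 8 * X]mxE mulr0 add0r.
    have u_x : u = x by apply/eqP; rewrite -subr_eq0 ux.
    have e0 : 0 < eta t u.
      rewrite /eta /paraboloid u_x /dist2 big1 ?subr0; last by move=> k _; rewrite subrr mul0r.
      apply: ltr_wpDr => //; rewrite mulr_ge0// subr_ge0; by case: Zz => /andP[].
    exact: mulr_gt0.
  have h := al_pos t Uu ux; apply: ltr_pwDl; first exact: mulr_gt0.
  by rewrite -expr2 sqr_ge0.
have [N1 N10 N1P] := compact_abs_ub compactZ (contZ b jB).
have [N2 N20 N2P] := compact_abs_ub compactZ (contZ c jc).
have [m0 m00 m0P] : exists2 m0, 0 < m0 & forall u, dist2 x u <= rho -> m0 <= v s0 u.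
  have cP : compact [set u : Rd | dist2 x u <= rho] by exact: compact_dist2_ball.
  apply: (compact_pos_lb cP) => u /=; last exact: v_pos.
  move=> ur; have Uu : U u.
    by apply: ballU; apply: le_trans ur _; rewrite lerDl mulr_ge0// subr_ge0 ltW.
  exact: (@jcont_at _ _ _ U v s0 u (jC_cont jv) Uu).
(* The last summand completes a square: mu - N1 p + N1^2 p^2 / (4 mu) >= 0. *)
pose lam := 1 + N2 + N1 * N1 / (4 * mu).
(* At time [s0] the paraboloid is at most [rho], so there the barrier is at most
   [eps * rho^2 = m0]. *)
pose eps := m0 / (rho * rho).
have eps0 : 0 < eps by rewrite divr_gt0// mulr_gt0.
pose w := barrier x rho kap s0 lam eps.
have jw : jC 2 U w := jC_barrier x rho kap s0 lam eps oU 2.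
pose z t u := v t u - w t u.
have jz : jC 2 U z := jC_D oU jv (jC_N oU jw).
have ZN : Z !=set0.
  exists (s0, x); split => /=; first by rewrite lexx ltW.
  rewrite /paraboloid subrr mulr0 addr0 /dist2 big1 ?subr0 ?(ltW rho0)// => k _.
  by rewrite subrr mul0r.
have [[t u] Zp zmin] := compact_min compactZ (contZ z (jC_le (leq0n 2) jz)) ZN.
have Uu := ZU Zp.
have amp_gt0 t' : 0 < amplitude s0 lam eps t' by rewrite mulr_gt0// expR_gt0.
suff zpos : 0 <= v t u - w t u.
  have Zy : Z (t1, y).
    by split; [rewrite /= lexx ltW|rewrite /= /paraboloid subr_ge0 ltW].
  have := le_trans zpos (zmin _ Zy); rewrite /z /= subr_ge0; apply: lt_le_trans.
  by rewrite mulr_gt0// mulr_gt0// /paraboloid subr_gt0.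
rewrite leNgt; apply/negP => zneg.
have [/= /andP[st tt1] e_ge0] := Zp.
have eta_gt0 : 0 < eta t u.
  rewrite lt_neqAle e_ge0 andbT; apply/eqP => e0; move: zneg; rewrite ltNge => /negP; apply.
  rewrite /w /barrier -/(eta t u) -e0 mul0r mulr0 subr0; apply: v_ge0 => //; exact/andP.
have s0t : s0 < t.
  rewrite lt_neqAle st andbT; apply/eqP => e0; move: zneg; rewrite ltNge => /negP; apply.
  rewrite subr_ge0; move: e_ge0; rewrite /w /barrier /amplitude /paraboloid -e0 subrr !mulr0 expR0 addr0 mulr1.
  rewrite subr_ge0 => dr; apply: le_trans (m0P _ dr); rewrite /eps -mulrA ler_piMr//; first exact: ltW.
  rewrite mulrC ler_pdivrMr ?mul1r; last exact: mulr_gt0.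
  by apply: ler_pM; rewrite ?subr_ge0// lerBlDr lerDl dist2_ge0.
have t0 : 0 < t <= T by rewrite (le_lt_trans s00 s0t) (le_trans tt1).
suff : 0 <= v t u - w t u by rewrite leNgt zneg.
apply: (no_touching_from_below jw t0 Uu (dq_barrier x rho kap s0 lam eps t u)).
(* After division by the amplitude the subsolution inequality is quadratic in [eta]. In [lam] the
   summand 1 pays for the [eta^2] added in [Q], and [N2] for the zeroth-order term. *)
- rewrite elliptic_barrier// ler_pM2l// -/(eta t u).
  have := muP _ Zp; have := N1P _ Zp; have := N2P _ Zp; rewrite /= /Q /b /q /lam.
  move: (4 * \tr _) (4 * _ 0 0) (8 * _ 0 0) (c t u) (eta t u) eta_gt0 => a1 a2 q' c' e' e'0.
  rewrite !ler_norml => /andP[c1 _] /andP[_ b2] m1.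
  have sq : mu - N1 * e' + N1 * N1 / (4 * mu) * (e' * e') = (2 * mu - N1 * e') ^+ 2 / (4 * mu).
    by field; rewrite gt_eqF.
  have : 0 <= mu - N1 * e' + N1 * N1 / (4 * mu) * (e' * e').
    by rewrite sq divr_ge0 ?sqr_ge0// mulr_ge0// ltW.
  move: (N1 * N1 / (4 * mu)) => K h.
  have h1 : 0 <= e' * (N1 - (a1 + a2 + 2 * kap)) by apply: mulr_ge0; lra.
  have h2 : 0 <= (e' * e') * (c' + N2) by apply: mulr_ge0; [exact: mulr_ge0 (ltW e'0) (ltW e'0)|lra].
  have E : q' - e' * (a1 + a2) + c' * (e' * e') - (2 * kap * e' - (1 + N2 + K) * (e' * e')) =
    (q' + e' * e' - mu) + (mu - N1 * e' + K * (e' * e')) + e' * (N1 - (a1 + a2 + 2 * kap))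
     + (e' * e') * (c' + N2) by ring.
  by rewrite -subr_ge0 E; lra.
- have ce := @jcont_at _ _ _ U eta t u (jC_cont jeta) Uu.
  apply: filterS (cvgr_gt _ ce _ eta_gt0) => y' ey; apply: (zmin (t, y')).
  by split; [exact/andP|exact: ltW].
(* Only earlier times are compared, so [t = t1] is allowed; [s0 < t] leaves room for them. *)
- have cs : eta s u @[s --> t^'-] --> eta t u.
    apply: (@cvg_within_filter _ _ _ (nbhs t)).
    apply: (@continuous_comp _ _ _ (fun s : R => (s, u)) (fun z : R * Rd => eta z.1 z.2)).
      by apply: (@cvg_pair _ _ _ (nbhs t) (nbhs t) (nbhs u)); [exact: cvg_id|exact: cvg_cst].
    exact: paraboloid_cont (t, u).
  have es0 : \forall s \near t^'-, 0 < eta s u by exact: (cvgr_gt _ cs _ eta_gt0).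
  apply: filterS3 (nbhs_left_gt s0t) (nbhs_left_lt t) es0 => s ss st' es.
  apply: (zmin (s, u)); split; last exact: ltW.
  by rewrite /= (ltW ss) (le_trans (ltW st') tt1).
Qed.

End Spreading.
End MaximumPrinciple.

Local Transparent jC mjC mpd jac grad hess.

(** * Material charts *)

Section TimeClamp.
Variables (R : realType) (T : R).
Hypothesis T0 : 0 < T.

(* Extends functions on [0, T] to all times by constants, so that joint
   continuity can be expressed on an open set. *)
Definition clamp (t : R) : R := Num.max 0 (Num.min t T).

Lemma clamp_itv t : clamp t \in `[0, T].
Proof. by rewrite in_itv /= /clamp le_max lexx /= ge_max ge_min lexx (ltW T0) orbT. Qed.

Lemma clampE t : t \in `[0, T] -> clamp t = t.
Proof.
rewrite in_itv /= => /andP[t0 tT]; rewrite /clamp.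
by rewrite (min_idPl tT) (max_idPr t0).
Qed.

Lemma continuous_clamp : continuous clamp.
Proof.
move=> t; apply/cvgrPdist_lt => e e0; apply/nbhs_ballP; exists e => //= s.
rewrite /ball /= /clamp => st; apply: le_lt_trans st.
rewrite !minEle !maxEle.
have := ler_norm (t - s); have := ler_norm (s - t); rewrite distrC ler_norml.
move: `|t - s| => n h1 h2; have := T0.
case: (leP t T) => a; case: (leP s T) => b; rewrite ?(ltW T0); case: (leP 0 t) => c;
  case: (leP 0 s) => f Tp; apply/andP; split; lra.
Qed.

Lemma within_clamp t (P : set R) : (within `[0, T] (nbhs (clamp t))) P ->
  \forall s \near t, P (clamp s).
Proof.
move=> wP; have H : nbhs (clamp t) (fun s => s \in `[0, T] -> P s) := wP.
have {}H : nbhs t (fun s => clamp s \in `[0, T] -> P (clamp s)) := continuous_clamp H.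
by apply: filterS H => s; apply; exact: clamp_itv.
Qed.

Lemma left_of_within t (P : set R) : 0 < t <= T ->
  (within `[0, T] t^') P -> t^'- P.
Proof.
move=> /andP[t0 tT] wP.
have H : \forall s \near t^'-, s != t -> s \in `[0, T] -> P s.
  have wP' : nbhs t (fun s => s != t -> s \in `[0, T] -> P s) := wP.
  exact: (@cvg_within _ (nbhs t) _ _ _ wP').
apply: filterS3 (nbhs_left_gt t0) (nbhs_left_lt t) H => s s0 st; apply.
  by rewrite lt_eqF.
by rewrite in_itv /= (ltW s0) (le_trans (ltW st) tT).
Qed.

(** Properness makes the [lim] in [time_deriv] unique. *)
Lemma within_itv_proper t : 0 < t <= T -> ProperFilter (within `[0, T] t^').
Proof.
move=> tT; split; last exact: within_filter.
move=> /(left_of_within tT) h; have /filter_ex[] : t^'- (set0 : set R) by [].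
by [].
Qed.

End TimeClamp.

Section ParameterizedFamilies.
Variables (R : realType) (d : nat) (T : R).
Hypothesis T0 : 0 < T.
Notation Rd := 'rV[R]_d.
Notation Rd1 := 'rV[R]_d.+1.
Notation clamp := (clamp T).

Lemma box_nbhs (U : set Rd) u : open U -> U u ->
  exists K : set Rd, [/\ compact K, K `<=` U & nbhs u K].
Proof.
move=> oU Uu; have /nbhs_ballP[r /= r0 rU] := open_nbhs_nbhs (conj oU Uu).
pose K := [set v : Rd | forall k, `[u 0 k - r / 2, u 0 k + r / 2]%classic (v ord0 k)].
exists K; split.
- apply: (@rV_compact _ _ (fun k => `[u 0 k - r / 2, u 0 k + r / 2]%classic)) => k.
  exact: segment_compact.
- move=> v Kv; apply: rU; rewrite -ball_normE /=.
  apply: (@le_lt_trans _ _ (r / 2)); last by lra.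
  apply: normr_mx_le; first by rewrite divr_ge0// ltW.
  move=> i j; rewrite ord1 sub_entry; have := Kv j; rewrite /= in_itv /=.
  by rewrite -[v ord0 j]/(v 0 j) ler_norml => /andP[a b]; apply/andP; split; lra.
- apply/nbhs_ballP; exists (r / 2) => /=; first by rewrite divr_gt0.
  move=> v; rewrite -ball_normE /= => uv k; rewrite /= in_itv /= -[v ord0 k]/(v 0 k).
  have := le_lt_trans (normr_coord (u - v) 0 k) uv; rewrite sub_entry ltr_norml => /andP[a b].
  by apply/andP; split; lra.
Qed.

Lemma jcont_chart (W : normedModType R) (M : set Rd1) r U phi (f : R -> Rd1 -> W) :
  is_chart r M U phi ->
  {within `[0, T] `*` M, continuous (fun x : R * Rd1 => f x.1 x.2)} ->
  jcont U (fun t u => f (clamp t) (phi u)).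
Proof.
move=> cphi cf t u Uu; have [_ Cphi _ _ _] := cphi.
have [oU _ _ _ _] := cphi.
have c1 : {for (t, u), continuous (fun z : R * Rd => clamp z.1)}.
  by apply: (@continuous_comp _ _ _ (@fst R Rd) clamp); [exact: cvg_fst|exact: continuous_clamp].
have c2 : {for (t, u), continuous (fun z : R * Rd => phi z.2)}.
  by apply: (@continuous_comp _ _ _ (@snd R Rd) phi); [exact: cvg_snd|exact: (Cphi.1 [::])].
have cp : {for (t, u), continuous (fun z : R * Rd => (clamp z.1, phi z.2))} 
  by exact: (cvg_pair c1 c2).
have Up : nbhs (t, u) [set z : R * Rd | U z.2].
  exists (setT, U) => /=; first by split; [exact: filterT|exact: open_nbhs_nbhs].
  by move=> [s v] /= [].
have Mp : (`[0, T]%classic `*` M) (clamp t, phi u).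
  by split; [exact: clamp_itv|exact: (chart_image cphi Uu)].
have /subspace_continuousP/(_ _ Mp) H := cf.
move=> P /H HP.
have := cp _ HP; apply: filterS2 Up => -[s v] /= Uv; apply.
by split; [exact: clamp_itv|exact: (chart_image cphi Uv)].
Qed.

(** Uniform convergence on a compact neighbourhood of [u] controls the change of time, and
    continuity at one fixed time the change of point. *)
Lemma jC_chart (W : normedModType R) (M : set Rd1) r k U phi (f : R -> Rd1 -> W) :
  is_chart r M U phi ->
  (forall t, t \in `[0, T] ->
     CkM r k M (f t) /\ CkM_cvg r k M (within `[0, T] (nbhs t)) f (f t)) ->
  jC k U (fun t => f (clamp t) \o phi).
Proof.
move=> cphi Hf; have [oU _ _ _ _] := cphi.
apply: jC_pds => [s sk t u Uu|s i t u sk Uu]; last first.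
  by have [cf _] := Hf _ (clamp_itv T0 t); apply: (cf _ _ cphi).2.
have [cf vf] := Hf _ (clamp_itv T0 t).
have [K [cK KU uK]] := box_nbhs oU Uu.
apply/cvgrPdist_lt => e e0; have e2 : 0 < e / 2 by rewrite divr_gt0.
have H1 := vf U phi K cphi cK KU s sk _ e2.
have H2 : \forall t' \near t, forall v, K v ->
   `|pds s (f (clamp t') \o phi) v - pds s (f (clamp t) \o phi) v| < e / 2.
  exact: (within_clamp T0 H1).
have H3 : \forall v \near u, `|pds s (f (clamp t) \o phi) u - pds s (f (clamp t) \o phi) v| < e / 2.
  have := (cf _ _ cphi).1 s u sk Uu; move=> /cvgrPdist_lt; exact.
exists ([set t' | forall v, K v ->
   `|pds s (f (clamp t') \o phi) v - pds s (f (clamp t) \o phi) v| < e / 2],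
   K `&` [set v | `|pds s (f (clamp t) \o phi) u - pds s (f (clamp t) \o phi) v| < e / 2]).
  by split => //; exact: filterI.
move=> [t' v] /= [h [Kv h3]]; have h2 := h v Kv.
have -> : pds s (f (clamp t) \o phi) u - pds s (f (clamp t') \o phi) v =
  (pds s (f (clamp t) \o phi) u - pds s (f (clamp t) \o phi) v) -
  (pds s (f (clamp t') \o phi) v - pds s (f (clamp t) \o phi) v).
  by rewrite opprB addrA subrK.
by apply: le_lt_trans (ler_normB _ _) _; lra.
Qed.

Lemma pds_coord n k U (F : Rd -> 'rV[R]_n) s u j : open U -> Ck k U F ->
  (size s <= k)%N -> U u -> pds s (fun v => F v 0 j) u = pds s F u 0 j.
Proof.
move=> oU [cF dF]; elim: s u => // i s IH u sk Uu.
rewrite /= (@pd_eq_on _ _ _ _ _ (fun v => pds s F v 0 j) i u oU Uu).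
  rewrite /pd [in RHS]derive_mx ?mxE//; exact: dF.
by move=> v Uv; apply: IH => //; exact: ltnW.
Qed.

Lemma pds_quotient (W : normedModType R) k U (f g : Rd -> W) (a : R) s u :
  open U -> Ck k U f -> Ck k U g -> (size s <= k)%N -> U u ->
  pds s (fun v => a *: (f v - g v)) u = a *: (pds s f u - pds s g u).
Proof.
move=> oU [cf df] [cg dg]; elim: s u => // i s IH u sk Uu.
rewrite /= (@pd_eq_on _ _ _ _ _ (fun v => a *: (pds s f v - pds s g v)) i u oU Uu).
  have h1 := df s i u sk Uu; have h2 := dg s i u sk Uu.
  rewrite /pd; have := deriveZ a (derivableB h1 h2).
  by rewrite (deriveB h1 h2).
by move=> v Uv; apply: IH => //; exact: ltnW.
Qed.

(** The quotients converge together with their spatial derivatives, and spatial differentiation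
    commutes with the quotient of two fixed times, so no limits are interchanged. *)
Lemma dq_chart (M : set Rd1) r k l U phi (f g : R -> Rd1 -> Rd1) :
  (l <= k)%N -> is_chart r M U phi ->
  (forall t, t \in `[0, T] ->
     CkM r k M (f t) /\ CkM_cvg r k M (within `[0, T] (nbhs t)) f (f t)) ->
  (forall t, t \in `[0, T] -> CkM_cvg r l M (within `[0, T] t^')
     (fun s p => (s - t)^-1 *: (f s p - f t p)) (g t)) ->
  (forall t, t \in `[0, T] -> CkM r l M (g t)) ->
  forall t u s j, 0 < t <= T -> U u -> (size s <= l)%N ->
  has_dq t^'- (fun s => (s - t)^-1)
    (fun t' => pds s (fun v => f (clamp t') (phi v) 0 j) u)
    (pds s (fun v => f (clamp t) (phi v) 0 j) u)
    (pds s (fun v => g (clamp t) (phi v) 0 j) u).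
Proof.
move=> lk cphi Hf Hg Cg t u s j tT Uu sl; have [oU _ _ _ _] := cphi.
have tI : t \in `[0, T] by move: tT; rewrite in_itv /= => /andP[/ltW-> ->].
have ct := clampE tI.
have Cf t' : Ck k U (f (clamp t') \o phi) by apply: (Hf _ (clamp_itv T0 t')).1 cphi.
have pE t' : pds s (fun v => f (clamp t') (phi v) 0 j) u = pds s (f (clamp t') \o phi) u 0 j.
  exact: (@pds_coord _ _ _ (f (clamp t') \o phi) s u j oU (Cf t') (leq_trans sl lk) Uu).
have qE : pds s (fun v => g (clamp t) (phi v) 0 j) u = pds s (g (clamp t) \o phi) u 0 j.
  exact: (@pds_coord _ _ _ (g (clamp t) \o phi) s u j oU (Cg _ (clamp_itv T0 t) _ _ cphi) sl Uu).
have slope : (fun s0 => (s0 - t)^-1 *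
    (pds s (f (clamp s0) \o phi) u 0 j - pds s (f t \o phi) u 0 j)) @ t^'- --> pds s (g t \o phi) u 0 j.
  have su : [set u] `<=` U by move=> _ ->.
  apply/cvgrPdist_lt => e e0.
  have H := Hg t tI U phi [set u] cphi (@compact_set1 _ u) su s sl e e0.
  have I : (within `[0, T] t^') (fun s0 : R => s0 \in `[0, T]) by exact: withinT.
  apply: filterS2 (left_of_within tT H) (left_of_within tT I) => s0 /(_ u erefl) h s0I.
  have Ql : Ck l U (f s0 \o phi) by apply: Ck_le lk _; apply: (Hf _ s0I).1 cphi.
  have Qt : Ck l U (f t \o phi) by apply: Ck_le lk _; apply: (Hf _ tI).1 cphi.
  have := @pds_quotient _ l U _ _ (s0 - t)^-1 s u oU Ql Qt sl Uu => E.
  rewrite clampE// distrC; apply: le_lt_trans h.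
  have := normr_coord (pds s (fun v => (s0 - t)^-1 *: ((f s0 \o phi) v - (f t \o phi) v)) u
    - pds s (g t \o phi) u) 0 j.
  by rewrite sub_entry {1}E [X in `|X - _|]mxE sub_entry.
apply: (@has_dq_near _ _ _ _ _ (fun t' => pds s (f (clamp t') \o phi) u 0 j)).
  by apply: nearW => t'; rewrite pE.
rewrite qE pE ct; split; last exact: slope.
(* Convergence of the values follows from that of the quotients, multiplied by an increment tending
   to 0. *)
have st : (fun s0 : R => s0 - t) @ t^'- --> (0 : R).
  rewrite -(subrr t); apply: (@cvg_within_filter _ _ _ (nbhs t)).
  by apply: cvgB; [exact: cvg_id|exact: cvg_cst].
have H : (fun s0 : R => pds s (f t \o phi) u 0 j + (s0 - t) * ((s0 - t)^-1 *
    (pds s (f (clamp s0) \o phi) u 0 j - pds s (f t \o phi) u 0 j))) @ t^'- -->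
    pds s (f t \o phi) u 0 j + 0 * pds s (g t \o phi) u 0 j.
  by apply: cvgD; [exact: cvg_cst|exact: cvgM].
rewrite mul0r addr0 in H; apply: cvg_trans H; apply: near_eq_cvg.
apply: filterS (nbhs_left_lt t) => s0 s0t /=.
rewrite mulrA divff ?mul1r; first by rewrite addrC subrK.
by rewrite subr_eq0 lt_eqF.
Qed.

End ParameterizedFamilies.

Section ChartTools.
Variables (R : realType) (d : nat).
Notation Rd := 'rV[R]_d.

Lemma mxdot_trace m (A X : 'M[R]_m) : mxdot A X = \tr (A *m X^T).
Proof.
apply: eq_bigr => i _; rewrite mxE; apply: eq_bigr => j _.
by rewrite mxE.
Qed.

Lemma jC_at (W : normedModType R) k (V : set Rd) (f : R -> Rd -> W) t :
  jC k V f -> jC k V (fun _ => f t).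
Proof.
elim: k f => [|k IH] f [cf df]; have cft : jcont V (fun _ => f t).
- move=> s u Vu; apply: (@continuous_comp _ _ _ (@snd R Rd) (f t)); first exact: cvg_snd.
  exact: (jcont_at cf Vu).
- by split.
- move=> s u Vu; apply: (@continuous_comp _ _ _ (@snd R Rd) (f t)); first exact: cvg_snd.
  exact: (jcont_at cf Vu).
- split => // i; have [di ji] := df i; split=> [s u Vu|]; first exact: di.
  exact: (IH _ ji).
Qed.

Lemma jcont_jC (W : normedModType R) (V : set Rd) (f : R -> Rd -> W) :
  jcont V f -> jC 0 V f.
Proof. by split. Qed.

Lemma jac_entry m (F : Rd -> 'rV[R]_m) u i j :
  jac F u i j = pds [:: i] (fun v => F v 0 j) u.
Proof. exact: mxE. Qed.

Lemma mpd_jac_entry m (F : Rd -> 'rV[R]_m) u k i j :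
  mpd k (jac F) u i j = pds [:: k; i] (fun v => F v 0 j) u.
Proof.
rewrite mpd_entry; congr (pd k _ u); apply/funext => v; exact: jac_entry.
Qed.

Lemma has_dq_eq (P : Type) (F : set_system P) {FF : Filter F} (c f g : P -> R) a b l k :
  (forall x, f x = g x) -> a = b -> l = k -> has_dq F c f a l -> has_dq F c g b k.
Proof. by move=> fg -> ->; apply: has_dq_near; exact: nearW. Qed.

Lemma jcont_time (W : normedModType R) (V : set Rd) (f : R -> Rd -> W) t u :
  jcont V f -> V u -> f s u @[s --> t] --> f t u.
Proof.
move=> cf Vu; apply: (@continuous_comp _ _ _ (fun s : R => (s, u)) (fun z : R * Rd => f z.1 z.2)).
  by apply: (@cvg_pair _ _ _ (nbhs t) (nbhs t) (nbhs u)); [exact: cvg_id|exact: cvg_cst].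
exact: cf.
Qed.

(** Cyclicity of the trace exposes the principal part; what is linear in [g] is rewritten as a drift
    term. *)
Lemma second_order_terms p (A : 'M[R]_p) (S : 'M[R]_(p, d)) (F : 'M[R]_d) (g : Rd)
    (P : 'I_d -> 'M[R]_(d, p)) :
  \tr (A *m (S *m (F *m S^T + \matrix_k (g *m P k)))) =
  \tr (S^T *m A *m S *m F) + (g *m (\row_m \sum_k (P k *m (A *m S)) m k)^T) 0 0.
Proof.
rewrite !mulmxDr raddfD /=; congr (_ + _).
  by rewrite mulmxA mulmxA mxtrace_mulC !mulmxA.
rewrite mulmxA mxtrace_mulC [RHS]mxE /mxtrace.
transitivity (\sum_k \sum_m g 0 m * (P k *m (A *m S)) m k).
  apply: eq_bigr => k _; move: (A *m S) => X.
  transitivity (row k (\matrix_k (g *m P k) *m X) 0 k); first by rewrite [RHS]mxE.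
  by rewrite row_mul rowK -mulmxA [LHS]mxE.
rewrite exchange_big; apply: eq_bigr => m _.
by rewrite [X in _ = _ * X]mxE [X in _ = _ * X]mxE mulr_sumr.
Qed.

Lemma mulmx_tr00 p (g b : 'rV[R]_p) : (g *m b^T) 0 0 = (b *m g^T) 0 0.
Proof. by rewrite !mxE; apply: eq_bigr => k _; rewrite !mxE mulrC. Qed.

Lemma mulmx_trD00 (g x y z : Rd) :
  (g *m (x + y + z)^T) 0 0 = (g *m x^T) 0 0 + (g *m y^T) 0 0 + (g *m z^T) 0 0.
Proof.
rewrite (mulmx_tr00 g x) (mulmx_tr00 g y) (mulmx_tr00 g z) (mulmx_tr00 g (x + y + z)).
by rewrite !mulmxDl [LHS]mxE [X in X + _]mxE.
Qed.

End ChartTools.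

Local Opaque jC mjC mpd jac grad hess dual_frame.

(** * The parabolic equation for the curvature in a chart of [M] that does not move in time *)

Section MaterialChart.
Variables (R : realType) (d : nat) (T : R).
Hypothesis T0 : 0 < T.
Notation Rd := 'rV[R]_d.
Notation Rd1 := 'rV[R]_d.+1.
Notation clamp := (clamp T).
Variables (M : set Rd1) (theta nu theta' : R -> Rd1 -> Rd1).
Hypothesis theta_C4 : forall t, t \in `[0, T] ->
  CkM 4 4 M (theta t) /\ CkM_cvg 4 4 M (within `[0, T] (nbhs t)) theta (theta t).
Hypothesis theta'_slope : forall t, t \in `[0, T] ->
  CkM_cvg 4 2 M (within `[0, T] t^')
    (fun s p => (s - t)^-1 *: (theta s p - theta t p)) (theta' t).
Hypothesis theta'_C2 : forall t, t \in `[0, T] ->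
  CkM 4 2 M (theta' t) /\ CkM_cvg 4 2 M (within `[0, T] (nbhs t)) theta' (theta' t).
Hypothesis theta_imm : forall t, t \in `[0, T] -> immersion M (theta t).
Hypothesis nu_normal : evolving_normal T M theta nu.
Variables (U : set Rd) (phi : Rd -> Rd1).
Hypothesis cphi : is_chart 4 M U phi.

Let oU : open U. Proof. by case: cphi. Qed.
Let cphi1 : is_chart 1 M U phi. Proof. exact: is_chart_le cphi. Qed.

Definition chart_map (f : R -> Rd1 -> Rd1) (t : R) : Rd -> Rd1 := f (clamp t) \o phi.

Notation psi := (chart_map theta).
Notation n := (chart_map nu).
Notation w := (chart_map theta').
Notation J t u := (jac (psi t) u).
Notation N t u := (jac (n t) u).
Notation S t u := (dual_frame (J t u)).

Lemma mjC_position : mjC U 4 psi.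
Proof. by move=> i j; exact: (jC_coord _ _ oU (jC_chart T0 cphi theta_C4)). Qed.

Lemma mjC_velocity : mjC U 2 w.
Proof. by move=> i j; exact: (jC_coord _ _ oU (jC_chart T0 cphi theta'_C2)). Qed.

Lemma mjC_normal0 : mjC U 0 n.
Proof.
move=> i j; apply: (@jC_coord _ _ _ _ 0 U n i j oU).
exact: (jcont_jC (jcont_chart T0 cphi nu_normal.1)).
Qed.

Let differentiable_position t u j : U u -> differentiable (fun v => psi t v 0 j) u.
Proof.
move=> Uu; have h := jC_le (isT : (1 <= 4)%N) (mjC_position 0 j).
exact: (@jC_differentiable _ _ _ oU (fun t u => psi t u 0 j) t u h Uu).
Qed.

Lemma jac_position_free t u : U u -> row_free (J t u).
Proof.
move=> Uu; rewrite -tangents_jac; first exact: (theta_imm (clamp_itv T0 t) cphi1 Uu).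
by move=> j; exact: differentiable_position.
Qed.

Lemma jac_position_normal t u : U u -> J t u *m (n t u)^T = 0.
Proof.
move=> Uu; have [_ h] := nu_normal.2 _ _ (clamp_itv T0 t) (chart_image cphi Uu).
rewrite -tangents_jac; last by move=> j; exact: differentiable_position.
apply/row_matrixP => i; rewrite row_mul rowK row0.
have := h U phi u cphi1 Uu erefl i.
rewrite /dot => e; apply/matrixP => a b; rewrite !ord1 [RHS]mxE -e.
by rewrite [LHS]mxE [RHS]mxE; apply: eq_bigr => k _; rewrite !mxE mulrC.
Qed.

Lemma unit_normal_chart t u : U u -> n t u *m (n t u)^T = 1%:M.
Proof.
move=> Uu; have [h _] := nu_normal.2 _ _ (clamp_itv T0 t) (chart_image cphi Uu).
by rewrite [LHS]mx11_scalar; congr (_%:M).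
Qed.

Let jn : mjC U 3 n := mjC_unit_normal oU mjC_position mjC_normal0 jac_position_free
  jac_position_normal unit_normal_chart.
Let jJ : mjC U 3 (fun t => jac (psi t)) := mjC_jac oU mjC_position.
Let jN : mjC U 2 (fun t => jac (n t)) := mjC_jac oU jn.
Let jS : mjC U 3 (fun t u => S t u) := mjC_dual_frame oU jac_position_free jJ.

Definition chart_curv t u := curv (psi t) (n t) u.
(* At a maximum of |psi|^2 the position is normal, and the trace of the Hessian
   of |psi|^2 is 2 d + 2 (psi . n) H. *)
Lemma curv_neq0_at_max t u : (0 < d)%N -> U u ->
  (\forall v \near u, (psi t v *m (psi t v)^T) 0 0 <= (psi t u *m (psi t u)^T) 0 0) ->
  chart_curv t u != 0.
Proof.
move=> d0 Uu umax; apply/eqP => H0.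
pose f s v := - (psi s v *m (psi s v)^T) 0 0.
have jp := mjC_position.
have jf : jC 2 U f := jC_le (isT : (2 <= 4)%N) (jC_N oU (mjC_entry 0 0 (mjC_mul oU jp (mjC_tr oU jp)))).
have p1 : mjC U 1 psi := mjC_le (isT : (1 <= 4)%N) jp.
have J1 : mjC U 1 (fun t => jac (psi t)) := mjC_le (isT : (1 <= 3)%N) jJ.
pose G s v := psi s v *m (J s v)^T.
have jG : mjC U 1 G := mjC_mul oU p1 (mjC_tr oU J1).
have gE v : U v -> grad (f t) v = - (G t v + G t v).
  move=> Uv; apply/rowP => k; rewrite (grad_entry (f t) v 0 k).
  transitivity (- mpd k (fun v => psi t v *m (psi t v)^T) v 0 0).
    rewrite mpd_entry; apply: pdN.
    exact: (@jC_derivable _ _ _ _ _ _ t v k (mjC_entry 0 0 (mjC_mul oU p1 (mjC_tr oU p1))) Uv).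
  rewrite (@mpdM _ _ _ _ _ _ psi (fun t v => (psi t v)^T) t k v p1 (mjC_tr oU p1) Uv) mpd_tr.
  rewrite [X in - X]mxE mulmx_tr00 [RHS]mxE [X in _ = - X]mxE -(row_jac (psi t) v k).
  have -> : G t v 0 k = (psi t v *m (row k (J t v))^T) 0 0.
    by rewrite /G !mxE; apply: eq_bigr => j _; rewrite !mxE.
  by [].
have umin : \forall v \near u, f t u <= f t v by apply: filterS umax => v; rewrite lerN2.
have df : \near u, differentiable (f t) u.
  apply: filterS (open_nbhs_nbhs (conj oU Uu)) => y Uy.
  exact: (jC_differentiable oU t (jCW jf) Uy).
have g0 : grad (f t) u = 0.
  apply/rowP => i; rewrite (grad_entry (f t) u 0 i) mxE.
  by apply: local_min_derive umin _; exact: nbhs_singleton df.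
have hz (xi : Rd) : 0 <= (xi *m hess (f t) u *m xi^T) 0 0.
  have ddf i : differentiable (pd i (f t)) u.
    exact: (@jC_differentiable _ _ _ oU (fun t => pd i (f t)) t u (jC_pd i jf) Uu).
  have := local_min_hessian df ddf umin xi; congr (0 <= _).
  rewrite quadratic_form; apply: eq_bigr => i _; apply: eq_bigr => j _.
  by congr (_ * _); rewrite (hess_entry (f t) u j i).
have Jf := jac_position_free t Uu; have Jn := jac_position_normal t Uu.
have nn := unit_normal_chart t Uu.
have G0 : psi t u *m (J t u)^T = 0.
  move: g0; rewrite gE// => /eqP; rewrite oppr_eq0 -mulr2n -scaler_nat scaler_eq0.
  by rewrite pnatr_eq0 /= => /eqP.
pose a := (psi t u *m (n t u)^T) 0 0.
have pn : psi t u = a *: n t u.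
  have := tangent_normal_decomposition Jf Jn nn.
  move=> /(congr1 (mulmx (psi t u))); rewrite mulmxDr !mulmxA G0 !mul0mx add0r mulmx1 => <-.
  by rewrite {1}[psi t u *m _]mx11_scalar mul_scalar_mx.
pose X := J t u *m (J t u)^T - a *: (N t u *m (J t u)^T).
have hE : hess (f t) u = - (X + X).
  apply/row_matrixP => k; rewrite (row_hess (f t) u k).
  transitivity (mpd k (fun v => - (G t v + G t v)) u).
    by apply: (mpd_eq_on oU k Uu) => v Uv; exact: gE.
  rewrite (@mpdN _ _ U _ _ (fun t v => G t v + G t v) t k u (mjC_D oU jG jG) Uu).
  rewrite (@mpdD _ _ U _ _ G G t k u jG jG Uu) row_opp row_add; congr (- (_ + _));
  rewrite (@mpdM _ _ _ _ _ _ psi (fun t v => (J t v)^T) t k u p1 (mjC_tr oU J1) Uu) mpd_tr;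
  rewrite row_add row_opp row_scale !row_mul -(row_jac (psi t) u k) {1}pn -scalemxAl;
  by rewrite (weingarten oU mjC_position mjC_normal0 jac_position_free jac_position_normal
    unit_normal_chart t k Uu) scalerN opprK.
(* Tracing the Hessian against [S^T S], the inverse Gram matrix, gives [0 <= - 2 d] once the
   curvature is 0, against [0 < d]. *)
have := psd_trace (S t u) hz; rewrite hE.
have -> : (S t u)^T *m S t u = invmx (J t u *m (J t u)^T).
  by rewrite dual_frameT gram_inv_dual.
have tX : \tr (invmx (J t u *m (J t u)^T) *m X) = d%:R.
  rewrite mulmxBr mulVmx ?gram_unitmx// -scalemxAr.
  have -> : \tr (1%:M - a *: (invmx (J t u *m (J t u)^T) *m (N t u *m (J t u)^T))) =
    d%:R - a * \tr (invmx (J t u *m (J t u)^T) *m (N t u *m (J t u)^T)).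
    by rewrite raddfB /= mxtrace1 mxtraceZ.
  have -> : \tr (invmx (J t u *m (J t u)^T) *m (N t u *m (J t u)^T)) = - chart_curv t u.
    by rewrite mxtrace_mulC /chart_curv /curv dual_frameE opprK mulmxA.
  by rewrite H0 oppr0 mulr0 subr0.
rewrite mulmxN mulmxDr raddfN raddfD /= tX oppr_ge0.
by rewrite -natrD lern0 addn_eq0 andbb eqn0Ngt d0.
Qed.

Definition chart_speed t u := (w t u *m (n t u)^T) 0 0.

Lemma jC_chart_curv : jC 2 U chart_curv.
Proof.
exact: (jC_curv oU mjC_position mjC_normal0 jac_position_free jac_position_normal unit_normal_chart).
Qed.

Lemma jC_chart_speed : jC 2 U chart_speed.
Proof. exact: mjC_entry (mjC_mul oU mjC_velocity (mjC_tr oU (mjC_le _ jn))). Qed.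

Lemma surf_grad_chart (f : Rd1 -> R) t u : U u -> differentiable (f \o phi) u ->
  surf_grad M (theta (clamp t)) f (phi u) = sgrad (psi t) (f \o phi) u.
Proof.
move=> Uu df; rewrite (surf_gradE cphi1 Uu (theta_imm (clamp_itv T0 t)) _ df).
  by rewrite /sgrad dual_frameT mulmxA.
by move=> j; exact: differentiable_position.
Qed.

Lemma surf_jac_chart (F : Rd1 -> Rd1) t u : U u ->
  (forall j, differentiable (fun v => F (phi v) 0 j) u) ->
  surf_jac M (theta (clamp t)) F (phi u) = (S t u *m jac (F \o phi) u)^T.
Proof.
move=> Uu dF; rewrite (surf_jacE cphi1 Uu (theta_imm (clamp_itv T0 t)) _ dF).
  by rewrite trmx_mul dual_frameT mulmxA.
by move=> j; exact: differentiable_position.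
Qed.

Lemma differentiable_normal t u j : U u -> differentiable (fun v => n t v 0 j) u.
Proof.
move=> Uu; have h := jC_le (isT : (1 <= 3)%N) (jn 0 j).
exact: (@jC_differentiable _ _ _ oU (fun t u => n t u 0 j) t u h Uu).
Qed.

Lemma surf_jac_normal_chart t u : U u ->
  surf_jac M (theta (clamp t)) (nu (clamp t)) (phi u) = S t u *m N t u.
Proof.
move=> Uu; rewrite surf_jac_chart//; last by move=> j; exact: differentiable_normal.
exact: (shape_sym oU mjC_position mjC_normal0 jac_position_free jac_position_normal unit_normal_chart).
Qed.

Lemma mean_curvature_chart t u : U u ->
  mean_curvature M (theta (clamp t)) (nu (clamp t)) (phi u) = chart_curv t u.
Proof.
move=> Uu; rewrite /mean_curvature /surf_div surf_jac_normal_chart// /chart_curv /curv.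
by rewrite mxtrace_mulC.
Qed.

Lemma mjC_sgrad (h : R -> Rd -> R) : jC 2 U h -> mjC U 1 (fun t => sgrad (psi t) (h t)).
Proof.
move=> jh; exact: (mjC_mul oU (mjC_grad oU jh) (mjC_tr oU (mjC_le _ jS))).
Qed.

(** [f] is known only through its chart values at one time; the family [h] supplies the regularity
    for differentiating its surface gradient. *)
Lemma surf_hess_chart (f : Rd1 -> R) (h : R -> Rd -> R) t u : jC 2 U h ->
  (forall v, U v -> f (phi v) = h t v) -> U u ->
  surf_hess M (theta (clamp t)) f (phi u) = (S t u *m jac (sgrad (psi t) (h t)) u)^T.
Proof.
move=> jh fh Uu.
have df v : U v -> differentiable (f \o phi) v.
  move=> Vv; have H := jC_ext oU (fun (_ : R) y Uy => esym (fh y Uy)) (jC_at t (jCW jh)).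
  exact: (@jC_differentiable _ _ _ oU (fun _ => f \o phi) 0 v H Vv).
have gE v : U v -> surf_grad M (theta (clamp t)) f (phi v) = sgrad (psi t) (h t) v.
  move=> Uv; rewrite surf_grad_chart//; last exact: df.
  rewrite /sgrad; congr (_ *m _); apply/rowP => i; rewrite !grad_entry.
  by apply: (pd_eq_on i oU Uv) => y Uy; exact: fh.
rewrite /surf_hess surf_jac_chart//.
  congr (_ *m _)^T; apply/matrixP => i j; rewrite [LHS]mxE [RHS]mxE.
  by apply: (pd_eq_on i oU Uu) => y Uy /=; rewrite gE.
move=> j; have js := jC_at t (mjC_sgrad jh 0 j).
have H := @jC_ext _ _ _ 1 U _ (fun _ v => surf_grad M (theta (clamp t)) f (phi v) 0 j) oU _ js.
apply: (@jC_differentiable _ _ _ oU (fun _ v => surf_grad M (theta (clamp t)) f (phi v) 0 j) 0 u _ Uu).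
by apply: H => _ y Uy; rewrite gE.
Qed.

Lemma laplace_beltrami_chart (f : Rd1 -> R) (h : R -> Rd -> R) t u : jC 2 U h ->
  (forall v, U v -> f (phi v) = h t v) -> U u ->
  laplace_beltrami M (theta (clamp t)) f (phi u) = \tr (jac (sgrad (psi t) (h t)) u *m S t u).
Proof.
move=> jh fh Uu; rewrite /laplace_beltrami /surf_div -/(surf_hess _ _ _).
by rewrite (surf_hess_chart jh fh Uu) mxtrace_tr mxtrace_mulC.
Qed.

Lemma dq_curv t u : 0 < t <= T -> U u ->
  has_dq t^'- (fun s => (s - t)^-1) (fun s => chart_curv s u) (chart_curv t u)
    (\tr (jac (sgrad (psi t) (chart_speed t)) u *m S t u)
     + chart_speed t u * \tr (N t u *m S t u *m (N t u *m S t u))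
     + \sum_m (w t u *m S t u) 0 m * pd m (chart_curv t) u).
Proof.
move=> tT Uu.
have dq s j : (size s <= 2)%N -> has_dq t^'- (fun s => (s - t)^-1)
    (fun t' => pds s (fun v => psi t' v 0 j) u) (pds s (fun v => psi t v 0 j) u)
    (pds s (fun v => w t v 0 j) u).
  have g2 t' : t' \in `[0, T] -> CkM 4 2 M (theta' t') by move=> /theta'_C2[].
  exact: (dq_chart T0 (isT : (2 <= 4)%N) cphi theta_C4 theta'_slope g2 j tT Uu).
apply: (curvature_evolution oU mjC_position mjC_normal0 mjC_velocity jac_position_free
  jac_position_normal unit_normal_chart Uu).
- move=> i j; have H := dq [:: i] j isT.
  exact: (has_dq_eq (fun s => esym (jac_entry (psi s) u i j)) (esym (jac_entry (psi t) u i j))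
    (esym (jac_entry (w t) u i j)) H).
- move=> k i j; have H := dq [:: k; i] j isT.
  exact: (has_dq_eq (fun s => esym (mpd_jac_entry (psi s) u k i j))
    (esym (mpd_jac_entry (psi t) u k i j)) (esym (mpd_jac_entry (w t) u k i j)) H).
- move=> i j; apply: (@cvg_within_filter _ _ _ (nbhs t)).
  have c0 := jC_cont (mjC_entry i j mjC_normal0).
  have c1 := @jcont_time _ _ _ U (fun s v => n s v i j) t u c0 Uu.
  exact: c1.
Qed.

Lemma jac_sgrad (h : R -> Rd -> R) t u : jC 2 U h -> U u ->
  jac (sgrad (psi t) (h t)) u =
  hess (h t) u *m (S t u)^T + \matrix_k (grad (h t) u *m mpd k (fun v => (S t v)^T) u).
Proof.
move=> jh Uu; apply/row_matrixP => k.
apply: (etrans (row_jac (sgrad (psi t) (h t)) u k)).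
have jST := mjC_tr oU (mjC_le (isT : (1 <= 3)%N) jS).
apply: (etrans (@mpdM _ _ _ _ _ _ (fun t => grad (h t)) (fun t v => (S t v)^T) t k u
  (mjC_grad oU jh) jST Uu)).
by rewrite row_add row_mul rowK (row_hess (h t) u k).
Qed.

Lemma time_deriv_chart t u : 0 < t <= T -> U u ->
  time_deriv T theta t (phi u) = theta' t (phi u).
Proof.
move=> tT Uu; have tI : t \in `[0, T] by move: tT; rewrite in_itv /= => /andP[/ltW-> ->].
have PF := within_itv_proper tT.
apply: cvg_lim => //; apply/cvgrPdist_lt => e e0.
have su : [set u] `<=` U by move=> _ ->.
have H := theta'_slope tI cphi (@compact_set1 _ u) su (isT : (size [::] <= 2)%N) e0.
by apply: filterS H => s /(_ u erefl); rewrite distrC.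
Qed.

Variables (H V : R -> Rd1 -> R).
Hypothesis HE : forall t p, t \in `[0, T] -> M p ->
  H t p = mean_curvature M (theta t) (nu t) p.
Hypothesis VE : forall t p, t \in `[0, T] -> M p -> V t p = normal_velocity T theta nu t p.
Variables (A : R -> Rd1 -> 'M[R]_d.+1) (B : R -> Rd1 -> Rd1) (C : R -> Rd1 -> R).
Hypothesis equation : forall t p, t \in `[0, T] -> M p ->
  laplace_beltrami M (theta t) (V t) p
    + V t p * mxdot (surf_jac M (theta t) (nu t) p) (surf_jac M (theta t) (nu t) p)
  = mxdot (A t p) (surf_hess M (theta t) (H t) p)
    + dot (B t p) (surf_grad M (theta t) (H t) p) + C t p * H t p.
Hypothesis A_sym : forall t p, t \in `[0, T] -> M p -> (A t p)^T = A t p.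

Notation Ac t u := (A (clamp t) (phi u)).
Notation Bc t u := (B (clamp t) (phi u)).

(* The equation reads d_t H = al : D^2 H + be . grad H + C H in the chart; the
   last summand of be comes from differentiating the frame in D_Gamma^2 H. *)
Definition chart_al (t : R) (u : Rd) : 'M[R]_d := (S t u)^T *m Ac t u *m S t u.

Definition chart_be (t : R) (u : Rd) : Rd :=
  w t u *m S t u + Bc t u *m S t u
  + \row_m \sum_k (mpd k (fun v => (S t v)^T) u *m (Ac t u *m S t u)) m k.

Lemma H_chart t u : U u -> H (clamp t) (phi u) = chart_curv t u.
Proof.
move=> Uu; rewrite (HE (clamp_itv T0 t) (chart_image cphi Uu)).
exact: mean_curvature_chart.
Qed.

Lemma V_chart t u : 0 < t <= T -> U u -> V t (phi u) = chart_speed t u.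
Proof.
move=> tT Uu; have tI : t \in `[0, T] by move: tT; rewrite in_itv /= => /andP[/ltW-> ->].
rewrite (VE tI (chart_image cphi Uu)) /normal_velocity time_deriv_chart//.
by rewrite /chart_speed /chart_map /= clampE.
Qed.

Lemma equation_chart t u : 0 < t <= T -> U u ->
  \tr (jac (sgrad (psi t) (chart_speed t)) u *m S t u)
     + chart_speed t u * \tr (N t u *m S t u *m (N t u *m S t u))
     + \sum_m (w t u *m S t u) 0 m * pd m (chart_curv t) u =
  elliptic chart_al chart_be (fun t u => C (clamp t) (phi u)) (chart_curv t) t u.
Proof.
move=> tT Uu; have tI : t \in `[0, T] by move: tT; rewrite in_itv /= => /andP[/ltW-> ->].
have ct := clampE tI.
have Vt v : U v -> V (clamp t) (phi v) = chart_speed t v by move=> Uv; rewrite ct V_chart.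
have E := equation (clamp_itv T0 t) (chart_image cphi Uu).
rewrite (laplace_beltrami_chart jC_chart_speed Vt Uu) Vt// in E.
rewrite (surf_hess_chart jC_chart_curv (fun v Uv => H_chart t Uv) Uu) H_chart// in E.
have dH : differentiable (H (clamp t) \o phi) u.
  have H1 := @jC_ext _ _ _ 1 U _ (fun _ v => H (clamp t) (phi v)) oU
    (fun _ v Uv => esym (H_chart t Uv)) (jC_at t (jCW jC_chart_curv)).
  exact: (@jC_differentiable _ _ _ oU (fun _ v => H (clamp t) (phi v)) 0 u H1 Uu).
rewrite (surf_grad_chart t Uu dH) surf_jac_normal_chart// in E.
rewrite !mxdot_trace trmxK in E.
have gE : sgrad (psi t) (H (clamp t) \o phi) u = grad (chart_curv t) u *m (S t u)^T.
  rewrite /sgrad; congr (_ *m _); apply/rowP => i; rewrite !grad_entry.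
  by apply: (pd_eq_on i oU Uu) => y Uy; exact: H_chart.
rewrite gE (jac_sgrad t jC_chart_curv Uu) second_order_terms in E.
(* Symmetry identifies the squared norm of the gradient of the normal with the trace of a square in
   the evolution equation. *)
have sym := shape_sym oU mjC_position mjC_normal0 jac_position_free
  jac_position_normal unit_normal_chart t Uu.
rewrite sym in E.
have -> : \tr (N t u *m S t u *m (N t u *m S t u)) = \tr (S t u *m N t u *m (S t u *m N t u)).
  by rewrite -mulmxA mxtrace_mulC !mulmxA.
have dB : dot (Bc t u) (grad (chart_curv t) u *m (S t u)^T) =
    (grad (chart_curv t) u *m (Bc t u *m S t u)^T) 0 0.
  by rewrite mulmx_tr00 /dot trmx_mul trmxK mulmxA.
have dX : \sum_m (w t u *m S t u) 0 m * pd m (chart_curv t) u =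
    (grad (chart_curv t) u *m (w t u *m S t u)^T) 0 0.
  rewrite mulmx_tr00 [RHS]mxE; apply: eq_bigr => m _; congr (_ * _).
  by rewrite [RHS]mxE grad_entry.
rewrite E dB dX /elliptic /chart_al /chart_be mulmx_trD00.
have sh (a r b c x : R) : a + r + b + c + x = a + (x + b + r) + c by ring.
exact: sh.
Qed.

Hypothesis A_cont : {within `[0, T] `*` M, continuous (fun x : R * Rd1 => A x.1 x.2)}.
Hypothesis B_cont : {within `[0, T] `*` M, continuous (fun x : R * Rd1 => B x.1 x.2)}.
Hypothesis C_cont : {within `[0, T] `*` M, continuous (fun x : R * Rd1 => C x.1 x.2)}.
Hypothesis A_posdef : forall t p, t \in `[0, T] -> M p -> posdef (A t p).

Let jA : mjC U 0 (fun t u => Ac t u).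
Proof.
move=> i j; apply: (@jC_coord _ _ _ _ 0 U (fun t u => Ac t u) i j oU).
exact: (jcont_jC (jcont_chart T0 cphi A_cont)).
Qed.

Let jB : mjC U 0 (fun t u => Bc t u).
Proof.
move=> i j; apply: (@jC_coord _ _ _ _ 0 U (fun t u => Bc t u) i j oU).
exact: (jcont_jC (jcont_chart T0 cphi B_cont)).
Qed.

Let jS0 : mjC U 0 (fun t u => S t u) := mjC_le (leq0n 3) jS.

Lemma mjC_chart_al : mjC U 0 chart_al.
Proof. exact: (mjC_mul oU (mjC_mul oU (mjC_tr oU jS0) jA) jS0). Qed.

Lemma mjC_chart_be : mjC U 0 chart_be.
Proof.
apply: (mjC_D oU (mjC_D oU (mjC_mul oU (mjC_le (leq0n 2) mjC_velocity) jS0) (mjC_mul oU jB jS0))).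
have jSk k : mjC U 0 (fun t u => mpd k (fun v => (S t v)^T) u *m (Ac t u *m S t u)).
  have jST := mjC_tr oU (mjC_le (isT : (1 <= 3)%N) jS).
  exact: (mjC_mul oU (mjC_mpd oU k jST) (mjC_mul oU jA jS0)).
move=> i m; apply: (jC_ext oU _ (jC_sum oU (index_enum 'I_d) (fun k => mjC_entry m k (jSk k)))).
by move=> t u _; rewrite ord1 [RHS]mxE.
Qed.

Lemma chart_al_psd t u (F : 'M[R]_d) : U u ->
  (forall xi : Rd, 0 <= (xi *m F *m xi^T) 0 0) -> 0 <= \tr (chart_al t u *m F).
Proof.
move=> Uu F0; have [W AW] := cholesky (A_sym (clamp_itv T0 t) (chart_image cphi Uu))
  (A_posdef (clamp_itv T0 t) (chart_image cphi Uu)).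
have -> : chart_al t u = (W *m S t u)^T *m (W *m S t u).
  by rewrite /chart_al {1}AW (trmx_mul W) (mulmxA (S t u)^T) -!mulmxA.
exact: psd_trace.
Qed.

(** The form of [A] is evaluated at [xi S^T], which is nonzero because [J] is a left inverse of
    [S]. *)
Lemma chart_al_pos t u (xi : Rd) : U u -> xi != 0 -> 0 < (xi *m chart_al t u *m xi^T) 0 0.
Proof.
move=> Uu xi0; have -> : xi *m chart_al t u *m xi^T = xi *m (S t u)^T *m Ac t u *m (xi *m (S t u)^T)^T.
  by rewrite /chart_al (trmx_mul xi) trmxK -!mulmxA.
apply: (A_posdef (clamp_itv T0 t) (chart_image cphi Uu)).
apply: contra_neq xi0 => e.
have : xi *m (S t u)^T *m (J t u)^T = 0 by rewrite e mul0mx.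
rewrite -(mulmxA xi) -(trmx_mul (J t u)) mul_frame_dual ?trmx1 ?mulmx1//.
exact: jac_position_free.
Qed.

Lemma elliptic_scale (f : R -> Rd -> R) a (al : R -> Rd -> 'M[R]_d) be c t u :
  jC 2 U f -> U u ->
  elliptic al be c (fun v => a * f t v) t u = a * elliptic al be c (f t) t u.
Proof.
move=> jf Uu.
have pdZ (h : R -> Rd -> R) v i : jC 1 U h -> U v -> pd i (fun v => a * h t v) v = a * pd i (h t) v.
  move=> jh Uv; rewrite (@pdM _ _ (fun _ => a) (h t)); first by rewrite pd_cst mulr0 addr0.
    exact: derivable_cst.
  exact: (@jC_derivable _ _ _ _ _ _ t v i jh Uv).
have gE : grad (fun v => a * f t v) u = a *: grad (f t) u.
  by apply/rowP => i; rewrite [RHS]mxE !grad_entry (pdZ f)//; exact: jCW.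
have hE : hess (fun v => a * f t v) u = a *: hess (f t) u.
  apply/matrixP => i j; apply: (etrans (hess_entry _ u i j)).
  rewrite [RHS]mxE (hess_entry (f t) u i j).
  transitivity (pd i (fun v => a * pd j (f t) v) u).
    by apply: (pd_eq_on i oU Uu) => v Uv; rewrite (pdZ f)//; exact: jCW.
  by rewrite (pdZ (fun t => pd j (f t)))//; exact: jC_pd.
rewrite /elliptic gE hE -scalemxAr mxtraceZ -scalemxAl [X in _ + X + _]mxE.
by move: (\tr _) ((_ *m _) 0 0) (c t u) (f t u) => p q r s; ring.
Qed.

Variable L : R.
Hypothesis C_lt : forall t p, t \in `[0, T] -> M p -> C t p < L.

(* exp(- L t) H, whose equation has the negative zeroth order coefficient
   C - L. *)
Definition decayed_curv (t : R) (u : Rd) : R := amplitude 0 L 1 t * chart_curv t u.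

Let c t u := C (clamp t) (phi u) - L.

Lemma jC_decayed_curv : jC 2 U decayed_curv.
Proof.
have ca : continuous (amplitude 0 L 1) by exact: continuous_amplitude.
exact: (jC_M oU (jC_time oU 2 ca) jC_chart_curv).
Qed.

Let c_lt0 t u : U u -> c t u < 0.
Proof. by move=> Uu; rewrite subr_lt0; exact: (C_lt (clamp_itv T0 t) (chart_image cphi Uu)). Qed.

Let jc : jC 0 U c.
Proof.
exact: (jC_D oU (jcont_jC (jcont_chart T0 cphi C_cont)) (jC_cst oU 0 (- L))).
Qed.

Lemma dq_decayed_curv t u : 0 < t <= T -> U u ->
  has_dq t^'- (fun s => (s - t)^-1) (fun s => decayed_curv s u) (decayed_curv t u)
    (elliptic chart_al chart_be c (decayed_curv t) t u).
Proof.
move=> tT Uu; have dH := dq_curv tT Uu; rewrite (equation_chart tT Uu) in dH.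
suff -> : elliptic chart_al chart_be c (decayed_curv t) t u =
    - L * amplitude 0 L 1 t * chart_curv t u + amplitude 0 L 1 t *
    elliptic chart_al chart_be (fun t u => C (clamp t) (phi u)) (chart_curv t) t u.
  exact: (dqM (dq_amplitude 0 L 1 t) dH).
rewrite (elliptic_scale _ _ _ _ _ jC_chart_curv Uu) /elliptic /c.
by move: (\tr _) ((_ *m _) 0 0) (C _ _) (chart_curv t u) (amplitude _ _ _ _) => p q r s a; ring.
Qed.

Lemma decayed_curv_min_ge0 t u : 0 < t <= T -> U u ->
  (\forall v \near u, decayed_curv t u <= decayed_curv t v) ->
  (\forall s \near t^'-, decayed_curv t u <= decayed_curv s u) ->
  0 <= decayed_curv t u.
Proof.
move=> tT Uu umin tmin.
(* With [eps = 0] the barrier is the zero function, and the touching lemma becomes the weak maximum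
   principle. *)
pose w0 := barrier u 0 0 0 0 0 : R -> Rd -> R.
have amp0 s : amplitude (0 : R) 0 0 s = 0 by rewrite /amplitude mul0r.
have w0E s v : w0 s v = 0 by rewrite /w0 /barrier amp0 mul0r.
have dw0 := dq_barrier u 0 0 0 0 0 t u; rewrite amp0 mul0r in dw0.
have ew0 : 0 <= elliptic chart_al chart_be c (w0 t) t u.
  by rewrite [leRHS](elliptic_barrier _ _ _ _ _ _ _ _ _ _ Uu) amp0 mul0r.
have umin0 : \forall v \near u, decayed_curv t u - w0 t u <= decayed_curv t v - w0 t v.
  apply: filterS umin => v.
  by move: (decayed_curv t u) (decayed_curv t v) => a b; rewrite !w0E !subr0.
have tmin0 : \forall s \near t^'-, decayed_curv t u - w0 t u <= decayed_curv s u - w0 s u.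
  apply: filterS tmin => s.
  by move: (decayed_curv t u) (decayed_curv s u) => a b; rewrite !w0E !subr0.
have := no_touching_from_below oU jC_decayed_curv chart_al_psd dq_decayed_curv c_lt0
  (jC_barrier u 0 0 0 0 0 oU 2) tT Uu dw0 ew0 umin0 tmin0.
by rewrite -/w0 w0E subr0.
Qed.

Lemma curv_positivity_spreads x rho kap s0 t1 : 0 < rho -> 0 <= kap -> 0 <= s0 ->
  s0 < t1 -> t1 <= T -> (forall y, dist2 x y <= rho + kap * (t1 - s0) -> U y) ->
  (forall t y, s0 <= t <= t1 -> U y -> 0 <= chart_curv t y) ->
  (forall y, dist2 x y <= rho -> 0 < chart_curv s0 y) ->
  forall y, dist2 x y < rho + kap * (t1 - s0) -> 0 < chart_curv t1 y.
Proof.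
move=> rho0 kap0 s00 st tT bU H0 Hs y yr.
have a0 t : 0 < amplitude 0 L 1 t by rewrite mulr_gt0// expR_gt0.
have v0 t v : s0 <= t <= t1 -> U v -> 0 <= decayed_curv t v.
  by move=> tI Uv; exact: mulr_ge0 (ltW (a0 t)) (H0 t v tI Uv).
have vs v : dist2 x v <= rho -> 0 < decayed_curv s0 v.
  by move=> vr; exact: mulr_gt0 (a0 s0) (Hs v vr).
have : 0 < decayed_curv t1 y.
  exact: (positivity_spreads oU jC_decayed_curv chart_al_psd dq_decayed_curv c_lt0 mjC_chart_al
    mjC_chart_be jc chart_al_pos rho0 kap0 s00 st tT bU v0 vs yr).
by rewrite -(pmulr_rgt0 (chart_curv t1 y) (a0 t1)).
Qed.

End MaterialChart.

Local Transparent jC mjC mpd jac grad hess dual_frame.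

(** * Global argument *)

Section Distance.
Variables (R : realType) (d : nat).
Notation Rd := 'rV[R]_d.

Lemma dist2_sym (x y : Rd) : dist2 x y = dist2 y x.
Proof. by apply: eq_bigr => k _; ring. Qed.

(** The factor 2 is the price of working with squared distances; coordinatewise the gap is a perfect
    square. *)
Lemma dist2_triangle (x y z : Rd) : dist2 x z <= 2 * (dist2 x y + dist2 y z).
Proof.
rewrite /dist2 -big_split mulr_sumr /=; apply: ler_sum => k _.
rewrite -subr_ge0; have -> : 2 * ((y 0 k - x 0 k) * (y 0 k - x 0 k) + (z 0 k - y 0 k) * (z 0 k - y 0 k)) -
  (z 0 k - x 0 k) * (z 0 k - x 0 k) = (x 0 k + z 0 k - 2 * y 0 k) ^+ 2 by ring.
exact: sqr_ge0.
Qed.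

Lemma dist2xx (x : Rd) : dist2 x x = 0.
Proof. by rewrite /dist2 big1// => k _; rewrite subrr mul0r. Qed.

Lemma nbhs_dist2 (x : Rd) (P : set Rd) : nbhs x P ->
  exists2 r, 0 < r & forall y, dist2 x y <= r -> P y.
Proof.
move=> /nbhs_ballP[e /= e0 eP]; exists ((e / 2) ^+ 2); first by rewrite exprn_gt0// divr_gt0.
move=> y yr; apply: eP; rewrite -ball_normE /=.
apply: (@le_lt_trans _ _ (e / 2)); last by lra.
have e2 : 0 <= e / 2 by rewrite divr_ge0// ltW.
apply: normr_mx_le => // i k; rewrite ord1 sub_entry distrC.
have := le_trans (coord_dist2 x y k) yr.
by rewrite -[leLHS]real_normK ?num_real// ler_pXn2r// nnegrE.
Qed.

Lemma open_dist2 (x : Rd) r : open [set y | dist2 x y < r].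
Proof.
apply: (@open_comp _ _ (dist2 x) [set a | a < r]); last exact: open_lt.
by move=> y _; exact: continuous_dist2.
Qed.

End Distance.

Local Opaque jC mjC mpd jac grad hess dual_frame.

Section StrongMaximumPrinciple.
Variables (R : realType) (d : nat) (T : R).
Hypothesis d_gt0 : (0 < d)%N.
Hypothesis T0 : 0 < T.
Notation Rd := 'rV[R]_d.
Notation Rd1 := 'rV[R]_d.+1.
Notation clamp := (clamp T).
Variables (M : set Rd1) (theta nu theta' : R -> Rd1 -> Rd1).
Hypothesis M_closed : closed_hypersurface 4 M.
Hypothesis theta_C4 : forall t, t \in `[0, T] ->
  CkM 4 4 M (theta t) /\ CkM_cvg 4 4 M (within `[0, T] (nbhs t)) theta (theta t).
Hypothesis theta'_slope : forall t, t \in `[0, T] ->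
  CkM_cvg 4 2 M (within `[0, T] t^')
    (fun s p => (s - t)^-1 *: (theta s p - theta t p)) (theta' t).
Hypothesis theta'_C2 : forall t, t \in `[0, T] ->
  CkM 4 2 M (theta' t) /\ CkM_cvg 4 2 M (within `[0, T] (nbhs t)) theta' (theta' t).
Hypothesis theta_imm : forall t, t \in `[0, T] -> immersion M (theta t).
Hypothesis nu_normal : evolving_normal T M theta nu.
Variables (H V : R -> Rd1 -> R).
Hypothesis HE : forall t p, t \in `[0, T] -> M p ->
  H t p = mean_curvature M (theta t) (nu t) p.
Hypothesis VE : forall t p, t \in `[0, T] -> M p -> V t p = normal_velocity T theta nu t p.
Variables (A : R -> Rd1 -> 'M[R]_d.+1) (B : R -> Rd1 -> Rd1) (C : R -> Rd1 -> R).
Hypothesis equation : forall t p, t \in `[0, T] -> M p ->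
  laplace_beltrami M (theta t) (V t) p
    + V t p * mxdot (surf_jac M (theta t) (nu t) p) (surf_jac M (theta t) (nu t) p)
  = mxdot (A t p) (surf_hess M (theta t) (H t) p)
    + dot (B t p) (surf_grad M (theta t) (H t) p) + C t p * H t p.
Hypothesis A_cont : {within `[0, T] `*` M, continuous (fun x : R * Rd1 => A x.1 x.2)}.
Hypothesis B_cont : {within `[0, T] `*` M, continuous (fun x : R * Rd1 => B x.1 x.2)}.
Hypothesis C_cont : {within `[0, T] `*` M, continuous (fun x : R * Rd1 => C x.1 x.2)}.
Hypothesis A_sym : forall t p, t \in `[0, T] -> M p -> (A t p)^T = A t p.
Hypothesis A_posdef : forall t p, t \in `[0, T] -> M p -> posdef (A t p).
Hypothesis H0_ge0 : forall p, M p -> 0 <= H 0 p.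

Let zero_itv : 0 \in `[0, T].
Proof. by rewrite in_itv /= lexx ltW. Qed.

Let compactM : compact M. Proof. by case: M_closed. Qed.

Lemma charts_cover p : M p ->
  exists (U : set Rd) (phi : Rd -> Rd1) u, [/\ is_chart 4 M U phi, U u & phi u = p].
Proof.
case: M_closed => _ _ cov _ /cov[U [phi [cphi [u Uu <-]]]].
by exists U, phi, u.
Qed.

Lemma chart_nbhs U (phi : Rd -> Rd1) u (W : set Rd) : is_chart 4 M U phi -> U u ->
  open W -> W u -> exists D : set Rd1, [/\ open D, D (phi u) &
    forall q, M q -> D q -> exists v, [/\ W v, U v & phi v = q]].
Proof.
move=> [oU _ _ _ op] Uu oW Wu.
have [D oD e] := op (W `&` U) (openI oW oU) (@subIsetr _ _ _).
exists D; split => //.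
  by have [] : (M `&` D) (phi u) by rewrite -e; exists u.
move=> q Mq Dq; have : (M `&` D) q by [].
by rewrite -e => -[v [Wv Uv] <-]; exists v.
Qed.

Let Hchart U phi t u : is_chart 4 M U phi -> U u ->
  H (clamp t) (phi u) = chart_curv T theta nu phi t u.
Proof.
by move=> cphi Uu; exact: (H_chart T0 theta_C4 theta_imm nu_normal cphi HE).
Qed.

Let jcH U phi : is_chart 4 M U phi -> jcont U (chart_curv T theta nu phi).
Proof. by move=> cphi; exact: (jC_cont (jC_chart_curv T0 theta_C4 theta_imm nu_normal cphi)). Qed.

Lemma continuous_of_charts (f : R -> Rd1 -> R) :
  (forall U phi, is_chart 4 M U phi -> jcont U (fun t u => f (clamp t) (phi u))) ->
  {within `[0, T] `*` M, continuous (fun x : R * Rd1 => f x.1 x.2)}.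
Proof.
move=> jf; apply/subspace_continuousP => -[t p] [/= tI Mp].
have [U [phi [u [cphi Uu pE]]]] := charts_cover Mp.
have ct := clampE tI.
have := jf U phi cphi t u Uu; rewrite /prop_for /continuous_at /= ct pE => cf.
move=> P /cf [[I W] /= [It Wu] IW].
move: Wu; rewrite nbhsE => -[W' [oW' W'u] W'W].
have [D [oD Dp Dq]] := chart_nbhs cphi Uu oW' W'u.
exists (I, D) => /=; first by split => //; apply: open_nbhs_nbhs; rewrite -pE.
move=> [s q] /= [Is Dqq] [sI Mq]; have [v [Wv Uv vq]] := Dq q Mq Dqq.
have := IW (s, v) (conj Is (W'W _ Wv)) => /=; rewrite clampE// vq; exact.
Qed.

Lemma compact_cylinder : compact (`[0, T]%classic `*` M).
Proof. by apply: compact_setX; [exact: segment_compact|exact: compactM]. Qed.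

Lemma C_bounded : exists L, forall t p, t \in `[0, T] -> M p -> C t p < L.
Proof.
have [M0|/set0P/negP] := pselect (M !=set0); last first.
  by rewrite negbK => /eqP ->; exists 0.
have K0 : (`[0, T]%classic `*` M) !=set0 by have [p Mp] := M0; exists (0, p).
have [z _ zmax] := compact_EVT_max K0 compact_cylinder C_cont.
(* The added 1 makes the bound strict, so that [C - L] is negative. *)
exists (C z.1 z.2 + 1) => t p tI Mp.
have := zmax (t, p); rewrite inE /= => /(_ (conj tI Mp)) h.
by apply: le_lt_trans h _; rewrite ltrDl.
Qed.

Let jH U phi : is_chart 4 M U phi -> jC 0 U (fun t u => H (clamp t) (phi u)).
Proof.
move=> cphi; have [oU _ _ _ _] := cphi; apply: jcont_jC.
by apply: (jcont_ext oU _ (jcH cphi)) => t u Uu; exact: esym (Hchart t cphi Uu).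
Qed.

Lemma H_ge0 t p : t \in `[0, T] -> M p -> 0 <= H t p.
Proof.
move=> tI Mp; have [L CL] := C_bounded.
pose g t p := amplitude 0 L 1 t * H t p.
have a0 s : 0 < amplitude 0 L 1 s by rewrite mulr_gt0// expR_gt0.
have cg : {within `[0, T] `*` M, continuous (fun x : R * Rd1 => g x.1 x.2)}.
  apply: continuous_of_charts => U phi cphi; have [oU _ _ _ _] := cphi.
  have ca : continuous (fun s => amplitude 0 L 1 (clamp s)).
    move=> s; apply: (@continuous_comp _ _ _ clamp (amplitude 0 L 1)).
      exact: continuous_clamp.
    exact: continuous_amplitude.
  exact: (jC_cont (jC_M oU (jC_time oU 0 ca) (jH cphi))).
have K0 : (`[0, T]%classic `*` M) !=set0 by exists (t, p).
have [[t0 p0]] := compact_EVT_min K0 compact_cylinder cg.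
rewrite inE => -[/= t0I Mp0] zmin.
have gmin s q : s \in `[0, T] -> M q -> g t0 p0 <= g s q.
  by move=> sI Mq; apply: (zmin (s, q)); rewrite inE.
suff g0 : 0 <= g t0 p0.
  by have := le_trans g0 (gmin t p tI Mp); rewrite /g pmulr_rge0.
have [t00|t00] := eqVneq t0 0; first by rewrite t00; exact: mulr_ge0 (ltW (a0 0)) (H0_ge0 Mp0).
have t0T : 0 < t0 <= T by move: t0I; rewrite in_itv /= lt_neqAle eq_sym t00.
have [U [phi [u [cphi Uu pE]]]] := charts_cover Mp0.
have [oU _ _ _ _] := cphi.
have gE s v : s \in `[0, T] -> U v -> g s (phi v) = decayed_curv T theta nu phi L s v.
  by move=> sI Uv; rewrite /g /decayed_curv -(Hchart s cphi Uv) clampE.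
rewrite -pE gE//; apply: (decayed_curv_min_ge0 T0 theta_C4 theta'_slope theta'_C2 theta_imm
  nu_normal cphi HE VE equation A_sym A_posdef CL t0T Uu).
- apply: filterS (open_nbhs_nbhs (conj oU Uu)) => v Uv.
  by rewrite -!gE// pE; apply: gmin => //; exact: (chart_image cphi Uv).
- have [t0p _] := andP t0T.
  apply: filterS2 (nbhs_left_gt t0p) (nbhs_left_lt t0) => s s0 st.
  have sI : s \in `[0, T].
    by rewrite in_itv /= (ltW s0) (le_trans (ltW st))//; case/andP: t0T.
  by rewrite -!gE// pE; exact: gmin.
Qed.

Lemma H0_gt0 : M !=set0 -> exists2 p, M p & 0 < H 0 p.
Proof.
move=> [p1 Mp1]; pose f (t : R) p := (theta t p *m (theta t p)^T) 0 0.
have cf : {within `[0, T] `*` M, continuous (fun x : R * Rd1 => f x.1 x.2)}.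
  apply: continuous_of_charts => U phi cphi; have [oU _ _ _ _] := cphi.
  have jp := mjC_position T0 theta_C4 cphi.
  exact: (jC_cont (mjC_entry 0 0 (mjC_mul oU jp (mjC_tr oU jp)))).
pose K : set (R * Rd1) := [set 0] `*` M.
have KS : K `<=` `[0, T]%classic `*` M by move=> [s q] [/= -> Mq].
have cK : compact K by apply: compact_setX; [exact: compact_set1|exact: compactM].
have K0 : K !=set0 by exists (0, p1).
have [[s p]] := compact_EVT_max K0 cK (continuous_subspaceW KS cf).
rewrite inE => -[/= -> Mp] pmax.
have [U [phi [u [cphi Uu pE]]]] := charts_cover Mp; have [oU _ _ _ _] := cphi.
exists p => //; rewrite lt_neqAle H0_ge0// andbT eq_sym.
have c0 := clampE zero_itv.
have -> : H 0 p = chart_curv T theta nu phi 0 u by rewrite -(Hchart 0 cphi Uu) pE c0.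
apply: (curv_neq0_at_max T0 theta_C4 theta_imm nu_normal cphi d_gt0 Uu).
apply: filterS (open_nbhs_nbhs (conj oU Uu)) => v Uv.
rewrite /chart_map /= c0 pE; apply: (pmax (0, phi v)); rewrite inE.
by split => //; exact: (chart_image cphi Uv).
Qed.

(* Around two points of a small chart ball centered at u0 the barrier starts from
   a ball around the first one and sweeps over the second one before time t. *)
Lemma local_spread p : M p -> exists2 D : set Rd1, open D /\ D p &
  forall x y s t, M x -> M y -> D x -> D y -> 0 <= s -> s < t -> t <= T ->
    0 < H s x -> 0 < H t y.
Proof.
move=> Mp; have [L CL] := C_bounded.
have [U [phi [u0 [cphi Uu0 pE]]]] := charts_cover Mp; have [oU _ _ _ _] := cphi.
have [e e0 eU] := nbhs_dist2 (open_nbhs_nbhs (conj oU Uu0)).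
(* The final squared radius will be [5 r]. A ball of that size around a point within [r] of [u0]
   lies within [2 (r + 5 r) = e] of [u0], and two points within [r] of [u0] are at squared distance
   below [4 r]. *)
pose r := e / 12; have r0 : 0 < r by rewrite divr_gt0.
have u0W : [set y | dist2 u0 y < r] u0 by rewrite /= dist2xx.
have [D [oD Dp Dq]] := chart_nbhs cphi Uu0 (@open_dist2 _ _ u0 r) u0W.
exists D; first by rewrite -pE.
move=> x y s t Mx My Dx Dy s0 st tT Hx.
have [u [/= ur Uu ux]] := Dq x Mx Dx; have [v [/= vr Uv vy]] := Dq y My Dy.
have sI : s \in `[0, T] by rewrite in_itv /= s0 (le_trans (ltW st)).
have tI : t \in `[0, T] by rewrite in_itv /= tT (le_trans s0 (ltW st)).
have HE' s' w : s' \in `[0, T] -> U w -> H s' (phi w) = chart_curv T theta nu phi s' w.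
  by move=> s'I Uw; rewrite -(Hchart s' cphi Uw) clampE.
have spos : 0 < chart_curv T theta nu phi s u by rewrite -(HE' s u sI Uu) ux.
have cs := @jcont_at _ _ _ U _ s u (jcH cphi) Uu.
have [rho' rho'0 rhoP] := nbhs_dist2 (cvgr_gt _ cs _ spos).
pose rho := Num.min rho' r.
have rho0 : 0 < rho by rewrite lt_min rho'0.
have rhor : rho <= r by rewrite ge_min lexx orbT.
(* The rate is chosen so that the squared radius equals [5 r] at time [t], however short [t - s]
   is. *)
pose kap := (5 * r - rho) / (t - s).
have ts : 0 < t - s by rewrite subr_gt0.
have kE : rho + kap * (t - s) = 5 * r by rewrite /kap divfK ?gt_eqF// addrC subrK.
have kap0 : 0 <= kap by apply: divr_ge0; [lra|exact: ltW].
have bU w : dist2 u w <= rho + kap * (t - s) -> U w.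
  rewrite kE => wr; apply: eU; have := dist2_triangle u0 u w.
  move: ur wr r0; rewrite /r; move: (dist2 u0 u) (dist2 u w) (dist2 u0 w) => a b c'; lra.
have curv0 t' w : s <= t' <= t -> U w -> 0 <= chart_curv T theta nu phi t' w.
  move=> _ Uw; rewrite -(Hchart t' cphi Uw).
  by apply: H_ge0; [exact: clamp_itv|exact: (chart_image cphi Uw)].
have curvs w : dist2 u w <= rho -> 0 < chart_curv T theta nu phi s w.
  by move=> wr; apply: rhoP; apply: le_trans wr _; rewrite ge_min lexx.
have vrho : dist2 u v < rho + kap * (t - s).
  rewrite kE; have := dist2_triangle u u0 v; rewrite (dist2_sym u u0).
  by move: ur vr r0; move: (dist2 u0 u) (dist2 u0 v) (dist2 u v) => a b c'; lra.
rewrite -vy (HE' t v tI Uv).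
exact: (curv_positivity_spreads T0 theta_C4 theta'_slope theta'_C2 theta_imm nu_normal cphi
  HE VE equation A_sym A_cont B_cont C_cont A_posdef CL rho0 kap0 s0 st tT bU curv0 curvs vrho).
Qed.

Theorem H_gt0 t p : t \in `]0, T] -> M p -> 0 < H t p.
Proof.
move=> tI Mp; pose G := [set q | M q /\ forall t, t \in `]0, T] -> 0 < H t q].
(* Membership in [G] says nothing about time 0, so spreading to time [t'] starts at [t' / 2]. *)
have half t' : t' \in `]0, T] -> [/\ t' / 2 \in `]0, T], 0 <= t' / 2, t' / 2 < t' & t' <= T].
  by rewrite !in_itv /= => /andP[a b]; split; lra.
have spread q x : M q -> M x -> forall D : set Rd1,
    (forall x y s t, M x -> M y -> D x -> D y -> 0 <= s -> s < t -> t <= T ->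
      0 < H s x -> 0 < H t y) -> D q -> D x -> G x -> G q.
  move=> Mq Mx D Dsp Dq Dx [_ Gx]; split => // t' /[dup] t'I /half[h1 h2 h3 h4].
  exact: (Dsp x q (t' / 2) t' Mx Mq Dx Dq h2 h3 h4 (Gx _ h1)).
have [p0 Mp0 Hp0] := H0_gt0 (ex_intro _ p Mp).
(* At [p0] positivity is known at time 0; it spreads from [p0] to [p0] itself at all later times. *)
have G0 : G p0.
  have [D [oD Dp] Dsp] := local_spread Mp0; split => // t'.
  rewrite in_itv /= => /andP[a b].
  exact: (Dsp p0 p0 0 t' Mp0 Mp0 Dp Dp (lexx 0) a b Hp0).
have cM : connected M by case: M_closed.
suff GM : G = M by have [_ /(_ t tI)] : G p by rewrite GM.
apply: cM; first by exists p0.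
(* Relatively open: positivity at [q] spreads to its neighbours. *)
- exists (\bigcup_(D in [set D : set Rd1 | open D /\ M `&` D `<=` G]) D).
    by apply: bigcup_open => D [].
  apply/seteqP; split => [q Gq|q [Mq [D [_ DG] Dq]]]; last exact: DG.
  have [Mq _] := Gq; split => //; have [D [oD Dq] Dsp] := local_spread Mq.
  exists D => //; split => // x [Mx Dx]; exact: (spread x q Mx Mq D Dsp Dx Dq Gq).
(* Relatively closed: a neighbour in [G] would spread positivity back to a point outside [G]. *)
- exists (~` \bigcup_(D in [set D : set Rd1 | open D /\ M `&` D `<=` ~` G]) D).
    by apply: open_closedC; apply: bigcup_open => D [].
  apply/seteqP; split => [q Gq|q [Mq nD]].
    have [Mq _] := Gq; split => // -[D [_ DG] Dq].
    by have := DG q (conj Mq Dq).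
  have [//|nG] := pselect (G q); case: nD.
  have [D [oD Dq] Dsp] := local_spread Mq; exists D => //; split => // x [Mx Dx] Gx.
  by apply: nG; exact: (spread q x Mq Mx D Dsp Dq Dx Gx).
Qed.

End StrongMaximumPrinciple.

Theorem theorem3p6 (R : realType) (d : nat) (d_ge1 : (1 <= d)%N)
  (T : R) (T_gt0 : 0 < T)
  (M : set 'rV[R]_d.+1) (theta nu : R -> 'rV[R]_d.+1 -> 'rV[R]_d.+1)
  (evolC2C2 : evolving_hypersurface T 1 0 M theta)
  (evolC1C4 : evolving_hypersurface T 0 2 M theta)
  (normal_nu : evolving_normal T M theta nu)
  (H V : R -> 'rV[R]_d.+1 -> R)
  (HE : forall t p, t \in `[0, T] -> M p ->
     H t p = mean_curvature M (theta t) (nu t) p)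
  (VE : forall t p, t \in `[0, T] -> M p ->
     V t p = normal_velocity T theta nu t p)
  (A : R -> 'rV[R]_d.+1 -> 'M[R]_d.+1)
  (B : R -> 'rV[R]_d.+1 -> 'rV[R]_d.+1)
  (C : R -> 'rV[R]_d.+1 -> R)
  (A_cont : {within `[0, T] `*` M,
     continuous (fun x : R * 'rV[R]_d.+1 => A x.1 x.2)})
  (B_cont : {within `[0, T] `*` M,
     continuous (fun x : R * 'rV[R]_d.+1 => B x.1 x.2)})
  (C_cont : {within `[0, T] `*` M,
     continuous (fun x : R * 'rV[R]_d.+1 => C x.1 x.2)})
  (A_sym : forall t p, t \in `[0, T] -> M p -> (A t p)^T = A t p)
  (A_posdef : forall t p, t \in `[0, T] -> M p -> posdef (A t p))
  (equation : forall t p, t \in `[0, T] -> M p ->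
     laplace_beltrami M (theta t) (V t) p
       + V t p * mxdot (surf_jac M (theta t) (nu t) p)
                       (surf_jac M (theta t) (nu t) p)
     = mxdot (A t p) (surf_hess M (theta t) (H t) p)
       + dot (B t p) (surf_grad M (theta t) (H t) p)
       + C t p * H t p)
  (H0_ge0 : forall p, M p -> 0 <= H 0 p) :
  forall t p, t \in `]0, T] -> M p -> 0 < H t p.
Proof.
(* The case [l = 0], [k = 2] provides charts of class 4, positions in C^4 and a velocity [theta'] in
   C^2, so that second spatial derivatives of the position can be differentiated in time. *)
have [Mc [_ [theta' theta'_slope [theta'_C2 _]]] [theta_C4 _] imm] := evolC1C4.
exact: (H_gt0 d_ge1 T_gt0 Mc theta_C4 theta'_slope theta'_C2 imm normal_nu HE VE equation
  A_cont B_cont C_cont A_sym A_posdef H0_ge0).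
Qed.
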